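(* Let $H=H_\omega$ be a weighted analytic Hilbert space and $\varphi\in H$ an analytic self-map of $\mathbb{D}$ with $\|\varphi\|_\infty<1$. Then $$\liminf_{n\to\infty}[a_n(C_\varphi)]^{1/n}\ge\exp\big(-1/\operatorname{Cap}[\varphi(\mathbb{D})]\big).$$
   Context: Weighted analytic Hilbert space: $\omega\colon[0,1)\to(0,\infty)$ continuous, positive, integrable, extended radially; $H_\omega$ is the space of analytic $f$ on $\mathbb{D}$ with $\|f\|_\omega^2=|f(0)|^2+\int_{\mathbb{D}}|f'|^2\omega\,dA<\infty$ ($dA$ normalized area measure). $C_\varphi f=f\circ\varphi$ (bounded on $H$ under these hypotheses). $a_n(T)=\inf\{\|T-R\|:\operatorname{rank}R<n\}$. Green capacity: $g(z,w)=\log\left|\frac{1-\bar wz}{z-w}\right|$, $I(\mu)=\iint g\,d\mu\,d\mu$, $V(E)=\inf I(\mu)$ over probability measures supported by a compact subset of $E$, $\operatorname{Cap}(E)=1/V(E)$. *)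

(* Defs.v *)
(* mathcomp-analysis over an abstract R : realType,
   complex numbers R[i] from mathcomp-real-closed. *)
From HB Require Import structures.
From mathcomp Require Import all_boot all_order all_algebra.
From mathcomp Require Import all_classical all_reals all_analysis.
From mathcomp Require Import complex.
Import Order.TTheory GRing.Theory Num.Theory.
Import numFieldNormedType.Exports.

Set Implicit Arguments.
Unset Strict Implicit.
Unset Printing Implicit Defensive.

Local Open Scope classical_set_scope.
Local Open Scope ring_scope.

(* modulus |z| of a complex number, as a real number *)
Definition cnorm {R : realType} (z : R[i]) : R := Normc.normc z.

(* the open unit disc D *)
Definition disc {R : realType} : set R[i] := [set z | cnorm z < 1].

(* identification of the plane R x R (carrying Lebesgue / Borel measures)
   with C : (x, y) |-> x + i y *)
Definition toC {R : realType} (p : (R * R)%type) : R[i] := (p.1 +i* p.2)%C.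

(* w is the complex derivative of f at z *)
Definition has_cderiv {R : realType} (f : R[i] -> R[i]) (z w : R[i]) : Prop :=
  forall e : R, 0 < e -> exists2 d : R, 0 < d &
    forall h : R[i], 0 < cnorm h < d -> cnorm ((f (z + h) - f z) / h - w) < e.

(* admissible weight: omega : [0,1) -> (0,oo) continuous, positive, integrable *)
Definition admissible_weight {R : realType} (omega : R -> R) : Prop :=
  [/\ {within [set r : R | 0 <= r < 1], continuous omega},
      (forall r : R, 0 <= r < 1 -> 0 < omega r) &
      (@lebesgue_measure R).-integrable [set r : R | 0 <= r < 1] (fun r => (omega r)%:E)].

(* squared norm in H_omega:
   ||f||^2 = |f(0)|^2 + int_D |f'|^2 omega(|z|) dA(z),  dA = dx dy / pi.
   f' ranges over complex derivatives of f on D (so the set below is empty,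
   and the "norm" is +oo, exactly when f is not analytic on D; otherwise
   it is a singleton). *)
Definition Hnorm2 {R : realType} (omega : R -> R) (f : R[i] -> R[i]) : \bar R :=
  ereal_inf [set (((cnorm (f 0)) ^+ 2)%R%:E +
      (pi^-1)%R%:E * \int[(@lebesgue_measure R \x @lebesgue_measure R)%E]_(p in
          [set p : (R * R)%type | (cnorm (toC p) < 1)%R])
        ((cnorm (g (toC p))) ^+ 2 * omega (cnorm (toC p)))%R%:E)%E
    | g in [set g : R[i] -> R[i] | forall z, disc z -> has_cderiv f z (g z)]].

(* the weighted analytic Hilbert space H_omega (functions are considered on D) *)
Definition Hspace {R : realType} (omega : R -> R) : set (R[i] -> R[i]) :=
  [set f | (Hnorm2 omega f < +oo)%E].

(* composition operator C_phi f = f o phi *)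
Definition Comp {R : realType} (phi : R[i] -> R[i]) (f : R[i] -> R[i]) :
  R[i] -> R[i] := f \o phi.

(* squared operator norm ||S||^2 = sup { ||S f||^2 : f in H, ||f|| <= 1 } *)
Definition opnorm2 {R : realType} (omega : R -> R)
    (S : (R[i] -> R[i]) -> (R[i] -> R[i])) : \bar R :=
  ereal_sup [set Hnorm2 omega (S f) | f in [set f | (Hnorm2 omega f <= 1)%E]].

(* Rop is a linear operator on H_omega of rank < n: linear on H, and its range
   lies in the span of m < n elements of H *)
Definition rank_lt {R : realType} (omega : R -> R) (n : nat)
    (Rop : (R[i] -> R[i]) -> (R[i] -> R[i])) : Prop :=
  (forall f g, Hspace omega f -> Hspace omega g -> forall a b : R[i],
     forall z, disc z ->
       Rop (fun x => a * f x + b * g x) z = a * Rop f z + b * Rop g z) /\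
  exists m : nat, (m < n)%N /\
    exists gs : 'I_m -> (R[i] -> R[i]), (forall i, Hspace omega (gs i)) /\
      forall f, Hspace omega f -> exists c : 'I_m -> R[i],
        forall z, disc z -> Rop f z = \sum_(i < m) c i * gs i z.

(* n-th approximation number a_n(T) = inf { ||T - Rop|| : rank Rop < n } *)
Definition approx_num {R : realType} (omega : R -> R)
    (T : (R[i] -> R[i]) -> (R[i] -> R[i])) (n : nat) : \bar R :=
  ((ereal_inf [set opnorm2 omega (fun f z => (T f z - Rop f z)%R)
      | Rop in [set Rop | rank_lt omega n Rop]]) `^ (2^-1)%R)%E.

(* Green function of the disc; +oo on the diagonal *)
Definition green {R : realType} (z w : R[i]) : \bar R :=
  if z == w then +oo%E
  else (ln (cnorm (1 - (w^*)%C * z) / cnorm (z - w)))%:E.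

(* Green energy of a (probability) measure on the plane *)
Definition energy {R : realType} (mu : probability (R * R)%type R) : \bar R :=
  (\int[mu]_p \int[mu]_q green (toC p) (toC q))%E.

(* V(E) = inf of the energies of probability measures supported by a compact
   subset of E *)
Definition Vgreen {R : realType} (E : set R[i]) : \bar R :=
  ereal_inf [set energy mu | mu in
    [set mu : probability (R * R)%type R | exists K : set (R * R)%type,
       [/\ compact K, (forall p, K p -> E (toC p)) & mu (~` K) = 0%E]]].

(* Green capacity Cap(E) = 1 / V(E) (with 1/0 = +oo, 1/+oo = 0) *)
Definition Cap {R : realType} (E : set R[i]) : \bar R := ((Vgreen E)^-1)%E.

(* Main.v *)
(** Let [mu] be a probability measure of Green energy [I] carried by a compact
    subset of [phi(D)]. Up to an arbitrarily small loss of mass it is carried by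
    the image under [phi] of a closed disc [|z| <= rho < 1]. Choosing points at
    random according to [mu] shows that the minimal Green energy [E n] of [n]
    points of that image is at most [n (n - 1) / 2 * I]. Since [E n] divided by
    [n (n - 1) / 2] is nondecreasing, there are, slightly above every large [N],
    integers [n] for which [E n - E (n - 1)] is at most about [n I]. For nearly
    minimizing points [w_1, ..., w_n] the Blaschke products [B_j] vanishing at
    the [w_i], [i <> j], then satisfy [|B_j(w_j)| >= exp (- n I)] up to a factor
    [exp (o(n))], while [B_j] and [B_j' / n] are bounded on [D]. An operator of
    rank [< n] kills some nonzero [f = sum_j c_j B_j]; as [f(w_j) = c_j B_j(w_j)],
    and point evaluations on [|z| <= rho] are bounded on [H_omega], the norm of
    [f o phi] is at least [exp (- n I)] times the norm of [f], up to a factor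
    [exp (o(n))].

    Boundedness of point evaluations rests on Goursat's theorem for squares:
    Cauchy's formula and an integration by parts bound [|f'(z)|] by an integral of
    [|f'|] over the boundary of a square centred at [z], then averaging over the
    size of the square gives an area integral, and [omega] is bounded below on
    compact subsets of [[0, 1)]. *)
Require Import Defs.
From HB Require Import structures.
From mathcomp Require Import all_boot all_order all_algebra.
From mathcomp Require Import all_classical all_reals all_analysis.
From mathcomp Require Import measurable_realfun.
From mathcomp Require Import complex ring lra.
Import Order.TTheory GRing.Theory Num.Theory.
Import numFieldNormedType.Exports.

Set Implicit Arguments.
Unset Strict Implicit.
Unset Printing Implicit Defensive.

Local Open Scope classical_set_scope.
Local Open Scope ring_scope.

(** The index [j] at which the combination is tested is imposed by the operator: it is that of a
    large coefficient of an unknown kernel vector. Hence the potentials of all the chosen points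
    must be at most about [n I] at once, whereas a small total energy controls only their mean. Near
    minimality supplies this: deleting any point leaves a competitor for [E (n - 1)], so each
    potential is at most [E n - E (n - 1)] plus a small error. Working with some [n] slightly above
    [N] is legitimate because an operator of rank [< N] has rank [< n]; it only multiplies the
    exponent by about [1 + delta]. The points stay in [|w| <= r < 1], so the poles of the Blaschke
    products stay away from the closed disc; this gives [|B_j'| <= C n] on all of [D]. Together with
    the integrability of the weight over the disc, it bounds the norm of [sum_j c_j B_j] by a
    constant times [n sum_j |c_j|]. Restricting [mu] to a set of mass [m] and renormalizing divides
    the energy by [m ^+ 2], so the mass lost has to be small compared with the gap between [I] and
    the target exponent. Norms are handled squared, whence the factors 2 in exponents and the powers
    [n ^+ 4]. *)

Arguments cnorm {R} z : simpl never.

(** * Modulus, real part and imaginary part *)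

Section ComplexModulus.
Context {R : realType}.
Implicit Types (z w : R[i]) (x y : R).

Lemma cnorm0 : cnorm (0 : R[i]) = 0. Proof. exact: Normc.normc0. Qed.

Lemma cnorm1 : cnorm (1 : R[i]) = 1. Proof. exact: Normc.normc1. Qed.

Lemma cnormM z w : cnorm (z * w) = cnorm z * cnorm w.
Proof. exact: Normc.normcM. Qed.

Lemma cnormV z : cnorm z^-1 = (cnorm z)^-1. Proof. exact: Normc.normcV. Qed.

Lemma cnormN z : cnorm (- z) = cnorm z. Proof. exact: normcN. Qed.

Lemma cnormB z w : cnorm (z - w) = cnorm (w - z).
Proof. by rewrite -cnormN opprB. Qed.

Lemma cnormD z w : cnorm (z + w) <= cnorm z + cnorm w.
Proof. exact: le_normcD. Qed.

Lemma cnorm_ge0 z : 0 <= cnorm z.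
Proof. by case: z => a b; rewrite /cnorm /= sqrtr_ge0. Qed.

Lemma cnorm_eq0 z : (cnorm z == 0) = (z == 0).
Proof.
by apply/eqP/eqP => [/Normc.eq0_normc//|->]; rewrite cnorm0.
Qed.

Lemma cnorm_gt0 z : (0 < cnorm z) = (z != 0).
Proof. by rewrite lt0r cnorm_ge0 andbT cnorm_eq0. Qed.

Lemma cnormX z n : cnorm (z ^+ n) = cnorm z ^+ n.
Proof.
by elim: n => [|n IH]; rewrite ?expr0 ?cnorm1// !exprS cnormM IH.
Qed.

Lemma cnorm_real x : cnorm x%:C%C = `|x|.
Proof. by rewrite /cnorm /= expr0n/= addr0 sqrtr_sqr. Qed.

Lemma cnorm_i : cnorm ('i%C : R[i]) = 1.
Proof. by rewrite /cnorm /= expr0n/= expr1n add0r sqrtr1. Qed.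

Lemma cnorm_conj z : cnorm (z^*)%C = cnorm z.
Proof. by case: z => a b; rewrite /cnorm /= sqrrN. Qed.

Lemma cnorm_sqr z : cnorm z ^+ 2 = complex.Re z ^+ 2 + complex.Im z ^+ 2.
Proof. by case: z => a b; rewrite /cnorm /= sqr_sqrtr// addr_ge0 ?sqr_ge0. Qed.

Lemma ler_Re_cnorm z : `|complex.Re z| <= cnorm z.
Proof.
by case: z => a b; rewrite /cnorm /= -sqrtr_sqr ler_wsqrtr// lerDl sqr_ge0.
Qed.

Lemma ler_Im_cnorm z : `|complex.Im z| <= cnorm z.
Proof.
by case: z => a b; rewrite /cnorm /= -sqrtr_sqr ler_wsqrtr// lerDr sqr_ge0.
Qed.

Lemma cnorm_le_ReIm z : cnorm z <= `|complex.Re z| + `|complex.Im z|.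
Proof.
rewrite {1}[z]complexE.
by rewrite (le_trans (cnormD _ _))// cnormM cnorm_i mul1r !cnorm_real.
Qed.

Lemma cnorm_dist z w : cnorm z - cnorm w <= cnorm (z - w).
Proof. by rewrite lerBlDr -{1}(subrK w z) cnormD. Qed.

Lemma cnorm_sum (I : Type) (s : seq I) (F : I -> R[i]) :
  cnorm (\sum_(i <- s) F i) <= \sum_(i <- s) cnorm (F i).
Proof.
elim/big_ind2 : _ => [|a b c d ab cd|//]; first by rewrite cnorm0.
by rewrite (le_trans (cnormD _ _))// lerD.
Qed.

Lemma cnorm_prod (I : Type) (s : seq I) (P : pred I) (F : I -> R[i]) :
  cnorm (\prod_(i <- s | P i) F i) = \prod_(i <- s | P i) cnorm (F i).
Proof.
by elim/big_rec2 : _ => [|i a b _ <-]; rewrite ?cnorm1 ?cnormM.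
Qed.

Lemma Re_add z w : complex.Re (z + w) = complex.Re z + complex.Re w.
Proof. by case: z w => [a b] [c d]. Qed.

Lemma Im_add z w : complex.Im (z + w) = complex.Im z + complex.Im w.
Proof. by case: z w => [a b] [c d]. Qed.

Lemma Re_opp z : complex.Re (- z) = - complex.Re z.
Proof. by case: z. Qed.

Lemma Im_opp z : complex.Im (- z) = - complex.Im z.
Proof. by case: z. Qed.

Lemma Re_mul z w : complex.Re (z * w) =
  complex.Re z * complex.Re w - complex.Im z * complex.Im w.
Proof. by case: z w => [a b] [c d]. Qed.

Lemma Im_mul z w : complex.Im (z * w) =
  complex.Re z * complex.Im w + complex.Im z * complex.Re w.
Proof. by case: z w => [a b] [c d]. Qed.

Lemma complexD x y x' y' : ((x +i* y) + (x' +i* y') = (x + x') +i* (y + y'))%C.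
Proof. by []. Qed.

Lemma complexB x y x' y' : ((x +i* y) - (x' +i* y') = (x - x') +i* (y - y'))%C.
Proof. by []. Qed.

End ComplexModulus.

(** * Complex continuity and differentiation *)

Definition ccont {R : realType} (f : R[i] -> R[i]) (z : R[i]) : Prop :=
  forall e : R, 0 < e -> exists2 d : R, 0 < d &
    forall w : R[i], cnorm (w - z) < d -> cnorm (f w - f z) < e.

Section ComplexDerivative.
Context {R : realType}.
Implicit Types (f g : R[i] -> R[i]) (z w a b : R[i]).

(** The division-free form includes [u = z], so that the chain rule needs no separate case for
    [g u = g z]. *)
Lemma has_cderivP f z w : has_cderiv f z w <->
  forall e : R, 0 < e -> exists2 d : R, 0 < d & forall u : R[i], cnorm (u - z) < d ->
    cnorm (f u - f z - w * (u - z)) <= e * cnorm (u - z).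
Proof.
split=> H e e0.
  have [d d0 Hd] := H e e0; exists d => // u uz.
  have [->|uz0] := eqVneq u z; first by rewrite !subrr mulr0 subrr cnorm0 mulr0.
  have uz1 : u - z != 0 by rewrite subr_eq0.
  have /Hd : 0 < cnorm (u - z) < d by rewrite cnorm_gt0 uz1.
  rewrite (addrC z) subrK => /ltW.
  have -> : f u - f z - w * (u - z) = ((f u - f z) / (u - z) - w) * (u - z).
    by rewrite mulrBl divfK.
  by rewrite cnormM => h; rewrite ler_wpM2r ?cnorm_ge0.
have e20 : 0 < e / 2 by lra.
have [d d0 Hd] := H _ e20; exists d => // h /andP[h0 hd].
have hn0 : h != 0 by rewrite -cnorm_gt0.
have := Hd (z + h); rewrite [z + h - z]addrC addKr => /(_ hd) hh.
have -> : (f (z + h) - f z) / h - w = (f (z + h) - f z - w * h) / h.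
  by field.
rewrite cnormM cnormV ltr_pdivrMr//; apply: (le_lt_trans hh).
by rewrite ltr_pM2r//; lra.
Qed.

Lemma has_cderiv_cont f z w : has_cderiv f z w -> ccont f z.
Proof.
move=> /has_cderivP /(_ 1 ltr01)[d d0 Hd] e e0.
have c0 : 0 < 1 + cnorm w by have := cnorm_ge0 w; lra.
exists (Num.min d (e / (1 + cnorm w))).
  by rewrite lt_min d0 divr_gt0.
move=> u; rewrite lt_min => /andP[ud ue].
have h := Hd u ud.
have -> : f u - f z = (f u - f z - w * (u - z)) + w * (u - z) by rewrite subrK.
apply: (le_lt_trans (cnormD _ _)); rewrite cnormM.
apply: (@le_lt_trans _ _ ((1 + cnorm w) * cnorm (u - z))); first by rewrite mulrDl; lra.
by rewrite mulrC -ltr_pdivlMr.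
Qed.

Lemma has_cderiv_cst a z : has_cderiv (fun=> a) z 0.
Proof.
move=> e e0; exists 1 => // h _; by rewrite subrr mul0r subrr cnorm0.
Qed.

Lemma has_cderiv_id z : has_cderiv id z 1.
Proof.
move=> e e0; exists 1 => // h /andP[h0 _].
by rewrite [z + h - z]addrC addKr divff ?subrr ?cnorm0// -cnorm_gt0.
Qed.

Lemma has_cderivD f g z w w' : has_cderiv f z w -> has_cderiv g z w' ->
  has_cderiv (fun u => f u + g u) z (w + w').
Proof.
move=> Hf Hg e e0; have e20 : 0 < e / 2 by lra.
have [d d0 Hd] := Hf _ e20; have [d' d'0 Hd'] := Hg _ e20.
exists (Num.min d d'); first by rewrite lt_min d0.
move=> h /andP[h0]; rewrite lt_min => /andP[hd hd'].
have -> : (f (z + h) + g (z + h) - (f z + g z)) / h - (w + w') =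
  ((f (z + h) - f z) / h - w) + ((g (z + h) - g z) / h - w') by ring.
apply: (le_lt_trans (cnormD _ _)).
by have := Hd h; have := Hd' h; rewrite h0 hd hd' => /(_ isT) ? /(_ isT) ?; lra.
Qed.

Lemma has_cderivM f g z w w' : has_cderiv f z w -> has_cderiv g z w' ->
  has_cderiv (fun u => f u * g u) z (w * g z + f z * w').
Proof.
move=> Hf Hg e e0.
(* The total error will be at most [e1 * (cnorm (g z) + 1 + cnorm w + cnorm (f z)) = e1 * A / 3];
   the spare factor 3 makes the last inequality strict. *)
have A0 : 0 < 3 * (1 + cnorm w + cnorm (f z) + cnorm (g z)).
  by have := cnorm_ge0 w; have := cnorm_ge0 (f z); have := cnorm_ge0 (g z); lra.
set A := 3 * _ in A0.
have cA : [/\ cnorm w * 3 <= A, cnorm (f z) * 3 <= A, cnorm (g z) * 3 <= A & 3 <= A].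
  rewrite /A; have := cnorm_ge0 w; have := cnorm_ge0 (f z).
  by have := cnorm_ge0 (g z); split; lra.
have [cw cf cg c3] := cA.
pose e1 := Num.min 1 (e / A).
have e10 : 0 < e1 by rewrite lt_min ltr01 divr_gt0.
have e11 : e1 <= 1 by rewrite ge_min lexx.
have e1A : e1 * A <= e by rewrite -ler_pdivlMr// ge_min lexx orbT.
have [d d0 Hd] := Hf _ e10; have [d' d'0 Hd'] := Hg _ e10.
have [d2 d20 Hd2] := has_cderiv_cont Hg e10.
exists (Num.min d (Num.min d' d2)); first by rewrite !lt_min d0 d'0.
move=> h /andP[h0]; rewrite !lt_min => /and3P[hd hd' hd2].
have -> : (f (z + h) * g (z + h) - f z * g z) / h - (w * g z + f z * w') =
  ((f (z + h) - f z) / h - w) * g (z + h) + w * (g (z + h) - g z)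
  + f z * ((g (z + h) - g z) / h - w') by ring.
have a1 : cnorm ((f (z + h) - f z) / h - w) < e1 by apply: Hd; rewrite h0.
have a2 : cnorm ((g (z + h) - g z) / h - w') < e1 by apply: Hd'; rewrite h0.
have a3 : cnorm (g (z + h) - g z) < e1.
  by apply: Hd2; rewrite [z + h - z]addrC addKr.
have a4 : cnorm (g (z + h)) <= cnorm (g z) + 1.
  by have := cnorm_dist (g (z + h)) (g z); lra.
apply: (le_lt_trans (cnormD _ _)).
apply: (@le_lt_trans _ _ (cnorm (((f (z + h) - f z) / h - w) * g (z + h)) +
  cnorm (w * (g (z + h) - g z)) + cnorm (f z * ((g (z + h) - g z) / h - w')))).
  by rewrite lerD2r cnormD.
rewrite !cnormM.
apply: (@le_lt_trans _ _
  (e1 * (cnorm (g z) + 1) + cnorm w * e1 + cnorm (f z) * e1)).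
  by rewrite !lerD// ler_pM ?cnorm_ge0// ltW.
have : e1 * A = 3 * (e1 * (cnorm (g z) + 1) + cnorm w * e1 + cnorm (f z) * e1).
  by rewrite /A; ring.
lra.
Qed.

Lemma has_cderivZ f z w a : has_cderiv f z w ->
  has_cderiv (fun u => a * f u) z (a * w).
Proof.
move=> Hf; have := has_cderivM (has_cderiv_cst a z) Hf.
by rewrite mul0r add0r.
Qed.

Lemma has_cderivB f g z w w' : has_cderiv f z w -> has_cderiv g z w' ->
  has_cderiv (fun u => f u - g u) z (w - w').
Proof.
move=> Hf Hg; have := has_cderivD Hf (has_cderivZ (-1) Hg).
rewrite mulN1r; congr has_cderiv; apply/funext => u; by rewrite mulN1r.
Qed.

Lemma has_cderiv_comp f g z w w' : has_cderiv g z w -> has_cderiv f (g z) w' ->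
  has_cderiv (f \o g) z (w' * w).
Proof.
move=> Hg Hf; apply/has_cderivP => e e0.
have A0 : 0 < 2 * (1 + cnorm w + cnorm w').
  by have := cnorm_ge0 w; have := cnorm_ge0 w'; lra.
set A := 2 * _ in A0.
pose e1 := Num.min 1 (e / A).
have e10 : 0 < e1 by rewrite lt_min ltr01 divr_gt0.
have e11 : e1 <= 1 by rewrite ge_min lexx.
have e1A : e1 * A <= e by rewrite -ler_pdivlMr// ge_min lexx orbT.
have [d d0 Hd] := (has_cderivP _ _ _).1 Hf _ e10.
have [d1 d10 Hd1] := (has_cderivP _ _ _).1 Hg _ e10.
have [d2 d20 Hd2] := has_cderiv_cont Hg d0.
exists (Num.min d1 d2); first by rewrite lt_min d10.
move=> u; rewrite lt_min => /andP[ud1 ud2] /=.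
have h1 := Hd1 u ud1; have h2 := Hd _ (Hd2 u ud2).
have -> : f (g u) - f (g z) - w' * w * (u - z) =
  (f (g u) - f (g z) - w' * (g u - g z)) + w' * (g u - g z - w * (u - z)) by ring.
apply: (le_trans (cnormD _ _)); rewrite cnormM.
have h3 : cnorm (g u - g z) <= (e1 + cnorm w) * cnorm (u - z).
  rewrite -(subrK (w * (u - z)) (g u - g z)) (le_trans (cnormD _ _))//.
  by rewrite cnormM mulrDl lerD2r.
apply: (@le_trans _ _ (e1 * ((e1 + cnorm w) * cnorm (u - z)) +
   cnorm w' * (e1 * cnorm (u - z)))).
  apply: lerD; first by rewrite (le_trans h2)// ler_wpM2l// ltW.
  by rewrite ler_wpM2l ?cnorm_ge0.
have -> : e1 * ((e1 + cnorm w) * cnorm (u - z)) + cnorm w' * (e1 * cnorm (u - z))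
  = (e1 * (e1 + cnorm w + cnorm w')) * cnorm (u - z) by ring.
rewrite ler_wpM2r ?cnorm_ge0// (le_trans _ e1A)// ler_wpM2l ?(ltW e10)//.
by rewrite /A; have := cnorm_ge0 w; have := cnorm_ge0 w'; lra.
Qed.

Lemma has_cderivV z : z != 0 -> has_cderiv (fun u => u^-1) z (- (z ^- 2)).
Proof.
move=> z0; apply/has_cderivP => e e0.
have nz0 : 0 < cnorm z by rewrite cnorm_gt0.
exists (Num.min (cnorm z / 2) (e * cnorm z ^+ 3 / 2)).
  by rewrite lt_min !divr_gt0// mulr_gt0// exprn_gt0.
move=> u; rewrite lt_min => /andP[u1 u2].
have nu : cnorm z / 2 < cnorm u.
  by have := cnorm_dist z u; rewrite cnormB; lra.
have nu0 : 0 < cnorm u by apply: lt_trans nu; rewrite divr_gt0.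
have u0 : u != 0 by rewrite -cnorm_gt0.
have -> : u^-1 - z^-1 - - z ^- 2 * (u - z) = (u - z) ^+ 2 / (u * z ^+ 2).
  by field; rewrite z0 u0.
rewrite cnormM cnormV cnormM !cnormX ler_pdivrMr; last by rewrite mulr_gt0 ?exprn_gt0.
rewrite expr2 [leRHS]mulrAC ler_wpM2r ?cnorm_ge0//.
rewrite (le_trans (ltW u2))//.
have -> : e * cnorm z ^+ 3 / 2 = e * (cnorm z / 2 * cnorm z ^+ 2) by field.
by rewrite ler_wpM2l ?(ltW e0)// ler_wpM2r ?(ltW nu)// exprn_ge0// ltW.
Qed.

End ComplexDerivative.

(** * Integrals over segments and over boundaries of rectangles *)

Definition pcont {R : realType} (f : R -> R[i]) (a b : R) : Prop :=
  forall x, a <= x <= b -> forall e : R, 0 < e -> exists2 d : R, 0 < d &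
    forall y, a <= y <= b -> `|y - x| < d -> cnorm (f y - f x) < e.

(** Taken componentwise, because the integral on the right is real-valued. *)
Definition cint {R : realType} (f : R -> R[i]) (a b : R) : R[i] :=
  ((\int[@lebesgue_measure R]_(x in `[a, b]) complex.Re (f x)) +i*
   (\int[@lebesgue_measure R]_(x in `[a, b]) complex.Im (f x)))%C.

Section ComplexIntegral.
Context {R : realType}.
Local Notation mu := (@lebesgue_measure R).
Implicit Types (f g F : R -> R[i]) (a b c : R).

Lemma within_continuous_itvP (f : R -> R) a b :
  (forall x, a <= x <= b -> forall e : R, 0 < e -> exists2 d : R, 0 < d &
    forall y, a <= y <= b -> `|y - x| < d -> `|f y - f x| < e) ->
  {within `[a, b], continuous f}.
Proof.
move=> H; apply/subspace_continuousP => x /=; rewrite in_itv/= => xab.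
apply/cvgrPdist_lt => e e0; have [d d0 Hd] := H x xab e e0.
exists d => //= y xy; rewrite /= in_itv/= => yab.
by rewrite distrC; apply: Hd => //; rewrite distrC.
Qed.

Lemma pcont_Re f a b : pcont f a b ->
  {within `[a, b], continuous (fun x => complex.Re (f x))}.
Proof.
move=> H; apply: within_continuous_itvP => x xab e e0.
have [d d0 Hd] := H x xab e e0; exists d => // y yab yx.
by rewrite -Re_opp -Re_add (le_lt_trans (ler_Re_cnorm _))// Hd.
Qed.

Lemma pcont_Im f a b : pcont f a b ->
  {within `[a, b], continuous (fun x => complex.Im (f x))}.
Proof.
move=> H; apply: within_continuous_itvP => x xab e e0.
have [d d0 Hd] := H x xab e e0; exists d => // y yab yx.
by rewrite -Im_opp -Im_add (le_lt_trans (ler_Im_cnorm _))// Hd.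
Qed.

Lemma pcont_cnorm f a b : pcont f a b ->
  {within `[a, b], continuous (fun x => cnorm (f x))}.
Proof.
move=> H; apply: within_continuous_itvP => x xab e e0.
have [d d0 Hd] := H x xab e e0; exists d => // y yab yx.
have h := Hd y yab yx; rewrite ltr_norml.
have := cnorm_dist (f y) (f x); have := cnorm_dist (f x) (f y).
by rewrite (cnormB (f x)) => *; apply/andP; split; lra.
Qed.

Lemma integrable_itv (f : R -> R) a b : {within `[a, b], continuous f} ->
  mu.-integrable `[a, b] (EFin \o f).
Proof.
by move=> cf; apply: continuous_compact_integrable => //; exact: segment_compact.
Qed.

Lemma pcontZ f (k : R[i]) a b : pcont f a b -> pcont (fun x => k * f x) a b.
Proof.
move=> Hf x xab e e0; have k0 : 0 < 1 + cnorm k by have := cnorm_ge0 k; lra.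
have ek : 0 < e / (1 + cnorm k) by rewrite divr_gt0.
have [d d0 Hd] := Hf x xab _ ek; exists d => // y yab yx.
have := Hd y yab yx; rewrite ltr_pdivlMr// -mulrBr cnormM => h.
by apply: le_lt_trans h; rewrite mulrC ler_wpM2l ?cnorm_ge0//; lra.
Qed.

Lemma pcontN f a b : pcont f a b -> pcont (fun x => - f x) a b.
Proof.
move=> H; rewrite (_ : (fun x => - f x) = (fun x => (-1) * f x)).
  exact: pcontZ.
by apply/funext => x; rewrite mulN1r.
Qed.

Lemma pcontS f a b a' b' : a <= a' -> b' <= b -> pcont f a b -> pcont f a' b'.
Proof.
move=> aa bb H x /andP[x1 x2] e e0.
have [|d d0 Hd] := H x _ e e0; first by apply/andP; split; lra.
by exists d => // y /andP[y1 y2]; apply: Hd; apply/andP; split; lra.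
Qed.

Lemma eq_cint f g a b : (forall x, a <= x <= b -> f x = g x) ->
  cint f a b = cint g a b.
Proof.
move=> fg; rewrite /cint; congr Complex; apply: eq_Rintegral => x;
  by rewrite inE/= in_itv/= => /fg ->.
Qed.

Lemma cintD f g a b : pcont f a b -> pcont g a b ->
  cint (fun x => f x + g x) a b = cint f a b + cint g a b.
Proof.
move=> Hf Hg; rewrite /cint complexD -!RintegralD//; last first.
- exact/integrable_itv/pcont_Re.
- exact/integrable_itv/pcont_Re.
- exact/integrable_itv/pcont_Im.
- exact/integrable_itv/pcont_Im.
by congr Complex; apply: eq_Rintegral => x _; rewrite (Re_add, Im_add).
Qed.

Lemma cintZ f (k : R[i]) a b : pcont f a b ->
  cint (fun x => k * f x) a b = k * cint f a b.
Proof.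
move=> Hf; have iR := integrable_itv (pcont_Re Hf).
have iI := integrable_itv (pcont_Im Hf).
case: k => k1 k2; apply/eqP; rewrite eq_complex Re_mul Im_mul/=.
have iZ (h : R -> R) r : mu.-integrable `[a, b] (EFin \o h) ->
    mu.-integrable `[a, b] (EFin \o (fun x => r * h x)).
  by move=> ih; apply: (integrableZl _ r ih).
apply/andP; split; apply/eqP.
  rewrite -!RintegralZl// -RintegralB//; [|exact: iZ|exact: iZ].
  by apply: eq_Rintegral => x _; case: (f x).
rewrite -!RintegralZl// -RintegralD//; [|exact: iZ|exact: iZ].
by apply: eq_Rintegral => x _; case: (f x).
Qed.

Lemma cintN f a b : pcont f a b -> cint (fun x => - f x) a b = - cint f a b.
Proof.
move=> H; rewrite -mulN1r -cintZ//.
by apply: eq_cint => x _; rewrite mulN1r.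
Qed.

Lemma cintB f g a b : pcont f a b -> pcont g a b ->
  cint (fun x => f x - g x) a b = cint f a b - cint g a b.
Proof.
by move=> Hf Hg; rewrite cintD ?cintN//; exact: pcontN.
Qed.

Lemma cint_chasles f a b c : a <= b -> b <= c -> pcont f a c ->
  cint f a c = cint f a b + cint f b c.
Proof.
move=> ab bc Hf.
have key (h : R -> R) : mu.-integrable `[a, c] (EFin \o h) ->
  \int[mu]_(x in `[a, c]) h x =
  \int[mu]_(x in `[a, b]) h x + \int[mu]_(x in `[b, c]) h x.
  move=> ih; have := @Rintegral_itvB R h (BLeft a) (BRight c) b ih.
  rewrite !bnd_simp ab bc => /(_ isT isT) /eqP.
  rewrite subr_eq => /eqP ->; rewrite addrC; congr (_ + _).
  rewrite Rintegral_itv_obnd_cbnd//; apply: integrableS ih => //.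
  by apply: subset_itvr; rewrite bnd_simp.
by rewrite /cint complexD !key//; [exact/integrable_itv/pcont_Im
  |exact/integrable_itv/pcont_Re].
Qed.

(** Real and imaginary parts are estimated separately, whence the factor 2; it only affects
    constants. *)
Lemma cint_norm f a b : pcont f a b ->
  cnorm (cint f a b) <= 2 * \int[mu]_(x in `[a, b]) cnorm (f x).
Proof.
move=> Hf; apply: (le_trans (cnorm_le_ReIm _)) => /=.
have icf := integrable_itv (pcont_cnorm Hf).
have key (h : R -> R) : mu.-integrable `[a, b] (EFin \o h) ->
    (forall x, `|h x| <= cnorm (f x)) ->
    `|\int[mu]_(x in `[a, b]) h x| <= \int[mu]_(x in `[a, b]) cnorm (f x).
  move=> ih hf; apply: (le_trans (le_normr_Rintegral _ ih)) => //.
  apply: le_Rintegral => //.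
  exact: (integrable_norm ih).
rewrite mulr_natl mulr2n lerD// key//.
- exact/integrable_itv/pcont_Re.
- by move=> x; exact: ler_Re_cnorm.
- exact/integrable_itv/pcont_Im.
- by move=> x; exact: ler_Im_cnorm.
Qed.

Lemma cint_le f a b M : a <= b -> pcont f a b ->
  (forall x, a <= x <= b -> cnorm (f x) <= M) ->
  cnorm (cint f a b) <= 2 * (M * (b - a)).
Proof.
move=> ab Hf fM; apply: (le_trans (cint_norm Hf)); rewrite ler_wpM2l//.
have -> : M * (b - a) = \int[mu]_(x in `[a, b]) M.
  rewrite Rintegral_cst//; congr (_ * _).
  have mE : mu `[a, b]%classic = (b - a)%:E.
    rewrite lebesgue_measure_itv/= lte_fin.
    by case: ltP => //= ba; rewrite (_ : b = a) ?subrr//; lra.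
  by rewrite -[LHS]/(fine (b - a)%:E) -mE.
apply: le_Rintegral => //.
- exact/integrable_itv/pcont_cnorm.
- apply: integrable_itv; apply: within_continuous_itvP => x _ e e0.
  by exists 1 => // y _ _; rewrite subrr normr0.
Qed.

(** The real fundamental theorem is applied to both components through [key], stated for a
    real-linear functional [p] dominated by the modulus. The increments of [F] are controlled for
    all [y] near [x], also outside [[a, b]], which gives two-sided derivatives at the endpoints. *)
Lemma cint_FTC F f a b : a <= b ->
  (forall x, a <= x <= b -> forall e : R, 0 < e -> exists2 d : R, 0 < d &
    forall y, `|y - x| < d ->
      cnorm (F y - F x - f x * (y - x)%:C%C) <= e * `|y - x|) ->
  pcont f a b -> cint f a b = F b - F a.
Proof.
rewrite le_eqVlt => /predU1P[-> _ _|ab dF Hf].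
  rewrite subrr /cint set_itv1 !Rintegral_set1//.
have key (p : R[i] -> R) : (forall z, `|p z| <= cnorm z) ->
    (forall z w : R[i], p (z + w) = p z + p w) ->
    (forall z : R[i], p (- z) = - p z) -> (forall (z : R[i]) (r : R), p (z * r%:C%C) = p z * r) ->
    {within `[a, b], continuous (fun x => p (f x))} ->
    \int[mu]_(x in `[a, b]) p (f x) = p (F b) - p (F a).
  move=> pn pD pN pZ cpf.
  have D x : a <= x <= b ->
      (fun h => h^-1 *: (p (F (h + x)) - p (F x))) @ 0^' --> p (f x).
    move=> xab; apply/cvgrPdist_lt => e e0; have e20 : 0 < e / 2 by lra.
    have [d d0 Hd] := dF x xab _ e20.
    exists d => //= h hh h0.
    have hd : `|h| < d by move: hh; rewrite /ball_/= ?sub0r ?normrN.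
    have := Hd (h + x); rewrite addrK => /(_ hd) Hh.
    have := le_trans (pn _) Hh; rewrite !(pD, pN, pZ) => Hh'.
    have -> : p (f x) - h^-1 *: (p (F (h + x)) - p (F x)) =
      - ((p (F (h + x)) - p (F x) - p (f x) * h) / h).
      by rewrite /GRing.scale/=; field.
    have nh0 : 0 < `|h| by rewrite normr_gt0.
    rewrite normrN normrM normfV ltr_pdivrMr// (le_lt_trans Hh')//.
    by rewrite ltr_pM2r//; lra.
  have dpF x : a <= x <= b -> derivable (fun y => p (F y)) x 1.
    move=> xab; apply/cvg_ex; exists (p (f x)).
    suff -> : (fun h : R => h^-1 *: (((fun y => p (F y)) \o shift x) h%:A - p (F x)))
      = (fun h : R => h^-1 *: (p (F (h + x)) - p (F x))) by exact: D.
    by apply/funext => h; rewrite /= [h%:A]mulr1.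
  have cpF x : a <= x <= b -> {for x, continuous (fun y => p (F y))}.
    by move=> xab; apply: differentiable_continuous; apply/derivable1_diffP/dpF.
  rewrite /Rintegral (@continuous_FTC2 _ (fun x => p (f x)) (fun x => p (F x)))//.
  - split.
    + by move=> x; rewrite in_itv/= => /andP[/ltW ? /ltW ?]; apply: dpF; apply/andP.
    + by apply: cvg_at_right_filter; apply: cpF; rewrite lexx ltW.
    + by apply: cvg_at_left_filter; apply: cpF; rewrite lexx ltW.
  - move=> x; rewrite in_itv/= => /andP[/ltW ? /ltW ?]; rewrite /derive1.
    by apply: cvg_lim => //; apply: D; apply/andP.
rewrite /cint key; first last.
- exact: pcont_Re.
- by move=> [z1 z2] r; rewrite Re_mul/= mulr0 subr0.
- exact: Re_opp.
- exact: Re_add.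
- exact: ler_Re_cnorm.
rewrite key; first last.
- exact: pcont_Im.
- by move=> [z1 z2] r; rewrite Im_mul/= mulr0 add0r.
- exact: Im_opp.
- exact: Im_add.
- exact: ler_Im_cnorm.
by case: (F a) => ? ?; case: (F b).
Qed.

End ComplexIntegral.

(** The contour integral along the boundary of [[a, b] x [c, d]], counterclockwise; on the vertical
    sides [dz = i dy]. *)
Definition rectint {R : realType} (f : R[i] -> R[i]) (a b c d : R) : R[i] :=
  cint (fun x => f (x +i* c)%C) a b - cint (fun x => f (x +i* d)%C) a b +
  'i%C * (cint (fun y => f (b +i* y)%C) c d - cint (fun y => f (a +i* y)%C) c d).

Section RectangleIntegral.
Context {R : realType}.
Implicit Types (f g G : R[i] -> R[i]) (a b c d : R).

Lemma ccont_hpcont f a b c :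
  (forall x, a <= x <= b -> ccont f (x +i* c)%C) ->
  pcont (fun x => f (x +i* c)%C) a b.
Proof.
move=> H x xab e e0; have [d d0 Hd] := H x xab e e0; exists d => // y _ yx.
apply: Hd; rewrite complexB subrr (_ : ((y - x) +i* 0)%C = (y - x)%:C%C)//.
by rewrite cnorm_real.
Qed.

Lemma ccont_vpcont f a b c :
  (forall y, a <= y <= b -> ccont f (c +i* y)%C) ->
  pcont (fun y => f (c +i* y)%C) a b.
Proof.
move=> H x xab e e0; have [d d0 Hd] := H x xab e e0; exists d => // y _ yx.
apply: Hd; rewrite complexB subrr.
rewrite (_ : (0 +i* (y - x))%C = 'i%C * (y - x)%:C%C).
  by rewrite cnormM cnorm_i mul1r cnorm_real.
by apply/eqP; rewrite eq_complex/=; apply/andP; split; apply/eqP; ring.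
Qed.

Definition rcont f a b c d := forall x y, a <= x <= b -> c <= y <= d ->
  ccont f (x +i* y)%C.

Definition onbd a b c d (x y : R) :=
  [&& a <= x <= b, c <= y <= d & [|| x == a, x == b, y == c | y == d]].

(** Continuity on the boundary alone, since the Cauchy kernels have a pole inside the rectangle. *)
Definition bcont f a b c d := forall x y, onbd a b c d x y -> ccont f (x +i* y)%C.

Lemma rcont_bcont f a b c d : rcont f a b c d -> bcont f a b c d.
Proof. by move=> H x y /and3P[xab ycd _]; exact: H. Qed.

Lemma onbd_sides a b c d : a <= b -> c <= d ->
  [/\ forall x, a <= x <= b -> onbd a b c d x c,
      forall x, a <= x <= b -> onbd a b c d x d,
      forall y, c <= y <= d -> onbd a b c d b y &
      forall y, c <= y <= d -> onbd a b c d a y].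
Proof.
by move=> ab cd; split=> u uab; rewrite /onbd uab ?ab ?cd ?lexx ?eqxx ?orbT.
Qed.

Lemma bcont_pcont f a b c d : a <= b -> c <= d -> bcont f a b c d ->
  [/\ pcont (fun x => f (x +i* c)%C) a b, pcont (fun x => f (x +i* d)%C) a b,
      pcont (fun y => f (b +i* y)%C) c d & pcont (fun y => f (a +i* y)%C) c d].
Proof.
move=> ab cd H; have [s1 s2 s3 s4] := onbd_sides ab cd; split.
- by apply: ccont_hpcont => x xab; apply: H; exact: s1.
- by apply: ccont_hpcont => x xab; apply: H; exact: s2.
- by apply: ccont_vpcont => x xab; apply: H; exact: s3.
- by apply: ccont_vpcont => x xab; apply: H; exact: s4.
Qed.

Lemma rectintB f g a b c d : a <= b -> c <= d ->
  bcont f a b c d -> bcont g a b c d ->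
  rectint (fun z => f z - g z) a b c d = rectint f a b c d - rectint g a b c d.
Proof.
move=> ab cd /(bcont_pcont ab cd)[f1 f2 f3 f4] /(bcont_pcont ab cd)[g1 g2 g3 g4].
by rewrite /rectint !cintB//; ring.
Qed.

Lemma rectintZ f (k : R[i]) a b c d : a <= b -> c <= d -> bcont f a b c d ->
  rectint (fun z => k * f z) a b c d = k * rectint f a b c d.
Proof.
by move=> ab cd /(bcont_pcont ab cd)[f1 f2 f3 f4]; rewrite /rectint !cintZ//; ring.
Qed.

(** The two integrals along the common side [x = m] have opposite orientations and cancel. *)
Lemma rectint_hsplit f a m b c d : a <= m -> m <= b -> c <= d ->
  rcont f a b c d ->
  rectint f a b c d = rectint f a m c d + rectint f m b c d.
Proof.
move=> am mb cd H; have ab := le_trans am mb.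
have [f1 f2 f3 f4] := bcont_pcont ab cd (rcont_bcont H).
rewrite /rectint (cint_chasles am mb f1) (cint_chasles am mb f2); ring.
Qed.

Lemma rectint_vsplit f a b c m d : a <= b -> c <= m -> m <= d ->
  rcont f a b c d ->
  rectint f a b c d = rectint f a b c m + rectint f a b m d.
Proof.
move=> ab cm md H; have cd := le_trans cm md.
have [f1 f2 f3 f4] := bcont_pcont ab cd (rcont_bcont H).
rewrite /rectint (cint_chasles cm md f3) (cint_chasles cm md f4); ring.
Qed.

Lemma rectint_le f a b c d M : a <= b -> c <= d -> bcont f a b c d ->
  (forall x y, onbd a b c d x y -> cnorm (f (x +i* y)%C) <= M) ->
  cnorm (rectint f a b c d) <= 4 * (M * ((b - a) + (d - c))).
Proof.
move=> ab cd /(bcont_pcont ab cd)[f1 f2 f3 f4] fM.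
have [s1 s2 s3 s4] := onbd_sides ab cd.
have c1 : cnorm (cint (fun x => f (x +i* c)%C) a b) <= 2 * (M * (b - a)).
  by apply: cint_le => // x xab; apply: fM; auto.
have c2 : cnorm (cint (fun x => f (x +i* d)%C) a b) <= 2 * (M * (b - a)).
  by apply: cint_le => // x xab; apply: fM; auto.
have c3 : cnorm (cint (fun y => f (b +i* y)%C) c d) <= 2 * (M * (d - c)).
  by apply: cint_le => // x xab; apply: fM; auto.
have c4 : cnorm (cint (fun y => f (a +i* y)%C) c d) <= 2 * (M * (d - c)).
  by apply: cint_le => // x xab; apply: fM; auto.
rewrite /rectint.
have h1 := cnormD (cint (fun x => f (x +i* c)%C) a b) (- cint (fun x => f (x +i* d)%C) a b).
have h2 := cnormD (cint (fun y => f (b +i* y)%C) c d) (- cint (fun y => f (a +i* y)%C) c d).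
rewrite !cnormN in h1 h2.
apply: (le_trans (cnormD _ _)); rewrite [cnorm (_ * _)]cnormM cnorm_i mul1r; lra.
Qed.

Lemma has_cderiv_hline G (z' : R[i]) (x y : R) : has_cderiv G (x +i* y)%C z' ->
  forall e : R, 0 < e -> exists2 d : R, 0 < d & forall x' : R, `|x' - x| < d ->
   cnorm (G (x' +i* y)%C - G (x +i* y)%C - z' * (x' - x)%:C%C) <= e * `|x' - x|.
Proof.
move=> /has_cderivP H e e0; have [d d0 Hd] := H e e0; exists d => // x' x'x.
have := Hd (x' +i* y)%C; rewrite complexB subrr.
by rewrite (_ : ((x' - x) +i* 0)%C = (x' - x)%:C%C)// cnorm_real => /(_ x'x).
Qed.

Lemma has_cderiv_vline G (z' : R[i]) (x y : R) : has_cderiv G (x +i* y)%C z' ->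
  forall e : R, 0 < e -> exists2 d : R, 0 < d & forall y' : R, `|y' - y| < d ->
   cnorm (G (x +i* y')%C - G (x +i* y)%C - 'i%C * z' * (y' - y)%:C%C)
     <= e * `|y' - y|.
Proof.
move=> /has_cderivP H e e0; have [d d0 Hd] := H e e0; exists d => // y' y'y.
have := Hd (x +i* y')%C; rewrite complexB subrr.
have -> : (0 +i* (y' - y))%C = 'i%C * (y' - y)%:C%C.
  by apply/eqP; rewrite eq_complex/=; apply/andP; split; apply/eqP; ring.
rewrite cnormM cnorm_i mul1r cnorm_real => /(_ y'y).
by rewrite mulrA [z' * 'i%C]mulrC.
Qed.

(** Each side contributes the increment of [G] between its corners, and these increments cancel
    around the contour. On a vertical side the factor ['i] of the contour integral is the one that
    the chain rule produces. *)
Lemma rectint_primitive G g a b c d : a <= b -> c <= d ->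
  (forall x y, onbd a b c d x y ->
     has_cderiv G (x +i* y)%C (g (x +i* y)%C)) ->
  bcont g a b c d -> rectint g a b c d = 0.
Proof.
move=> ab cd H /(bcont_pcont ab cd)[f1 f2 f3 f4].
have [s1 s2 s3 s4] := onbd_sides ab cd.
rewrite /rectint mulrBr -!cintZ//.
rewrite (@cint_FTC _ (fun x => G (x +i* c)%C) (fun x => g (x +i* c)%C))//; last first.
  by move=> x xab; apply: has_cderiv_hline; apply: H; auto.
rewrite (@cint_FTC _ (fun x => G (x +i* d)%C) (fun x => g (x +i* d)%C))//; last first.
  by move=> x xab; apply: has_cderiv_hline; apply: H; auto.
rewrite (@cint_FTC _ (fun y => G (b +i* y)%C) (fun y => 'i%C * g (b +i* y)%C))//; last 2 first.
  by move=> x xab; apply: has_cderiv_vline; apply: H; auto.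
  exact: pcontZ.
rewrite (@cint_FTC _ (fun y => G (a +i* y)%C) (fun y => 'i%C * g (a +i* y)%C))//; last 2 first.
  by move=> x xab; apply: has_cderiv_vline; apply: H; auto.
  exact: pcontZ.
ring.
Qed.

End RectangleIntegral.

(** * Goursat's theorem for rectangles *)

Section Goursat.
Context {R : realType}.

(* Otherwise, repeated halving of a rectangle violating [P] gives a nested
   sequence of violating rectangles shrinking to a point. *)
Lemma rectangle_bisection (P : R -> R -> R -> R -> Prop) (a b c d : R) :
  a < b -> c < d ->
  (forall a' b' c' d', a <= a' -> a' < b' -> b' <= b -> c <= c' -> c' < d' ->
     d' <= d ->
     let m := (a' + b') / 2 in let n := (c' + d') / 2 in
     P a' m c' n -> P m b' c' n -> P a' m n d' -> P m b' n d' -> P a' b' c' d') ->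
  (forall x y, a <= x <= b -> c <= y <= d -> exists2 e, 0 < e &
     forall a' b' c' d', a <= a' -> b' <= b -> c <= c' -> d' <= d ->
     a' <= x <= b' -> c' <= y <= d' -> a' < b' -> c' < d' ->
     (b' - a') * (d - c) = (d' - c') * (b - a) ->
     b' - a' < e -> d' - c' < e -> P a' b' c' d') ->
  P a b c d.
Proof.
move=> ab cd step loc; apply: contrapT => nP.
pose w := b - a; pose h := d - c.
have w0 : 0 < w by rewrite subr_gt0.
have h0 : 0 < h by rewrite subr_gt0.
pose st n (p : R * R) := [/\ a <= p.1, p.1 + w / 2 ^+ n <= b, c <= p.2,
  p.2 + h / 2 ^+ n <= d &
  ~ P p.1 (p.1 + w / 2 ^+ n) p.2 (p.2 + h / 2 ^+ n)].
have pw n : 0 < w / 2 ^+ n by rewrite divr_gt0// exprn_gt0.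
have ph n : 0 < h / 2 ^+ n by rewrite divr_gt0// exprn_gt0.
have pwS n : w / 2 ^+ n.+1 = (w / 2 ^+ n) / 2 by rewrite exprSr invfM mulrA.
have phS n : h / 2 ^+ n.+1 = (h / 2 ^+ n) / 2 by rewrite exprSr invfM mulrA.
(* The implication stands under the existential so that [choice] yields a total step function; where
   the invariant fails, any [q] will do. *)
have nxt n p : exists q, st n p -> [/\ st n.+1 q, p.1 <= q.1,
    q.1 + w / 2 ^+ n.+1 <= p.1 + w / 2 ^+ n, p.2 <= q.2 &
    q.2 + h / 2 ^+ n.+1 <= p.2 + h / 2 ^+ n].
  have [sp|] := pselect (st n p); last by exists p.
  have [p1 p2 p3 p4 p5] := sp; case: p sp p1 p2 p3 p4 p5 => x y /= _ p1 p2 p3 p4 p5.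
  have := pw n; have := ph n; rewrite /st pwS phS.
  set W := w / 2 ^+ n in p2 p5 *; set H := h / 2 ^+ n in p4 p5 * => H0 W0.
  apply: contrapT => /forallNP nq; apply: p5.
  have hx : (x + (x + W)) / 2 = x + W / 2 by field.
  have hy : (y + (y + H)) / 2 = y + H / 2 by field.
  have hx' : x + W = x + W / 2 + W / 2 by field.
  have hy' : y + H = y + H / 2 + H / 2 by field.
  apply: step => //; rewrite ?hx ?hy; try lra.
  - apply: contrapT => nPq; apply: (nq (x, y)) => _ /=; split; try lra.
    by split => //; lra.
  - rewrite hx'; apply: contrapT => nPq.
    apply: (nq (x + W / 2, y)) => _ /=; split; try lra.
    by split => //=; lra.
  - rewrite hy'; apply: contrapT => nPq.
    apply: (nq (x, y + H / 2)) => _ /=; split; try lra.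
    by split => //=; lra.
  - rewrite hx' hy'; apply: contrapT => nPq.
    apply: (nq (x + W / 2, y + H / 2)) => _ /=; split; try lra.
    by split => //=; lra.
have /choice[nx Hnx] : forall np : nat * (R * R), exists q, st np.1 np.2 ->
    [/\ st np.1.+1 q, np.2.1 <= q.1,
    q.1 + w / 2 ^+ np.1.+1 <= np.2.1 + w / 2 ^+ np.1, np.2.2 <= q.2 &
    q.2 + h / 2 ^+ np.1.+1 <= np.2.2 + h / 2 ^+ np.1].
  by move=> [n p]; exact: nxt.
pose s := fix s n := if n is n'.+1 then nx (n', s n') else (a, c).
have s0 : st 0%N (s 0%N).
  rewrite /st/= !expr0 !divr1 /w /h; split => //=; try lra.
  by rewrite !addrA ![_ + _ - _]addrC !addKr.
have sst n : st n (s n).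
  by elim: n => [//|n IH]; have [] := Hnx (n, s n) IH.
have smono n : [/\ (s n).1 <= (s n.+1).1,
    (s n.+1).1 + w / 2 ^+ n.+1 <= (s n).1 + w / 2 ^+ n,
    (s n).2 <= (s n.+1).2 &
    (s n.+1).2 + h / 2 ^+ n.+1 <= (s n).2 + h / 2 ^+ n].
  by have [] := Hnx (n, s n) (sst n).
have smono2 n m : (n <= m)%N -> [/\ (s n).1 <= (s m).1,
    (s m).1 + w / 2 ^+ m <= (s n).1 + w / 2 ^+ n,
    (s n).2 <= (s m).2 &
    (s m).2 + h / 2 ^+ m <= (s n).2 + h / 2 ^+ n].
  elim: m => [|m IH]; first by rewrite leqn0 => /eqP ->.
  rewrite leq_eqVlt => /predU1P[->//|]; rewrite ltnS => /IH[i1 i2 i3 i4].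
  by have [j1 j2 j3 j4] := smono m; split; lra.
(* The common point of the nested rectangles is the supremum, coordinate by coordinate, of their
   lower left corners; every upper right corner is an upper bound. *)
pose X := [set (s n).1 | n in [set: nat]].
pose Y := [set (s n).2 | n in [set: nat]].
have ubX n : ubound X ((s n).1 + w / 2 ^+ n).
  move=> _ [m _ <-]; have := pw m; have := pw n.
  have [/smono2[? ? ? ?]|/ltnW/smono2[? ? ? ?]] := leqP n m; lra.
have ubY n : ubound Y ((s n).2 + h / 2 ^+ n).
  move=> _ [m _ <-]; have := ph m; have := ph n.
  have [/smono2[? ? ? ?]|/ltnW/smono2[? ? ? ?]] := leqP n m; lra.
have supX : has_sup X by split; [exists (s 0%N).1; exists 0%N|exists ((s 0%N).1 + w / 2 ^+ 0)].
have supY : has_sup Y by split; [exists (s 0%N).2; exists 0%N|exists ((s 0%N).2 + h / 2 ^+ 0)].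
have xin n : (s n).1 <= sup X <= (s n).1 + w / 2 ^+ n.
  apply/andP; split; first by apply: ub_le_sup; [case: supX|exists n].
  by apply: ge_sup; [case: supX|exact: ubX].
have yin n : (s n).2 <= sup Y <= (s n).2 + h / 2 ^+ n.
  apply/andP; split; first by apply: ub_le_sup; [case: supY|exists n].
  by apply: ge_sup; [case: supY|exact: ubY].
have xab : a <= sup X <= b.
  by have /andP[] := xin 0%N; have [? ? _ _ _] := sst 0%N => *; apply/andP; split; lra.
have ycd : c <= sup Y <= d.
  by have /andP[] := yin 0%N; have [_ _ ? ? _] := sst 0%N => *; apply/andP; split; lra.
have [e e0 He] := loc _ _ xab ycd.
have [n Hn] : exists n, (w + h) / 2 ^+ n < e.
  exists (Num.bound ((w + h) / e)).
  rewrite ltr_pdivrMr ?exprn_gt0// -ltr_pdivrMl// mulrC.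
  have wh0 : 0 <= (w + h) / e by rewrite divr_ge0 ?(ltW e0)// addr_ge0// ltW.
  apply: (lt_trans (archi_boundP wh0)).
  by rewrite -natrX ltr_nat ltn_expl.
have [t1 t2 t3 t4 t5] := sst n; apply: t5.
have := pw n; have := ph n; move: Hn; rewrite mulrDl => Hn p1 p2.
apply: He => //; try lra.
by rewrite ![_ + _ - _]addrC !addKr -/h -/w; ring.
Qed.

Lemma rcontS (f : R[i] -> R[i]) (a b c d a' b' c' d' : R) :
  a <= a' -> b' <= b -> c <= c' -> d' <= d ->
  rcont f a b c d -> rcont f a' b' c' d'.
Proof.
move=> aa bb cc dd H x y /andP[x1 x2] /andP[y1 y2].
by apply: H; apply/andP; split; lra.
Qed.

(** The bound [P], quadratic in the half perimeter, passes from the four quarters to the whole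
    rectangle. Near a point [z], [f] differs from its affine part by at most
    [k / 4 * cnorm (u - z)]. The affine part has a primitive and integrates to zero; for the
    remainder, the denominator 4 offsets the factor 4 of [rectint_le]. *)
Lemma goursat (f g : R[i] -> R[i]) (a b c d : R) : a <= b -> c <= d ->
  (forall x y, a <= x <= b -> c <= y <= d ->
    has_cderiv f (x +i* y)%C (g (x +i* y)%C)) ->
  rectint f a b c d = 0.
Proof.
have cint0 (h : R -> R[i]) (u : R) : cint h u u = 0.
  by rewrite /cint set_itv1 !Rintegral_set1.
rewrite le_eqVlt => /predU1P[-> _ _|ab].
  by rewrite /rectint !cint0; ring.
rewrite le_eqVlt => /predU1P[-> _|cd].
  by rewrite /rectint !cint0; ring.
move=> H.
have cf : rcont f a b c d.
  by move=> x y xab ycd; apply: has_cderiv_cont; exact: H.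
apply/eqP; rewrite -cnorm_eq0 eq_le cnorm_ge0 andbT; apply/ler_addgt0Pr => e e0.
pose S := ((b - a) + (d - c)) ^+ 2.
have S0 : 0 < S by rewrite exprn_gt0// addr_gt0// subr_gt0.
pose k := e / S; have k0 : 0 < k by rewrite divr_gt0.
suff : cnorm (rectint f a b c d) <= k * ((b - a) + (d - c)) ^+ 2.
  by rewrite /k divfK ?add0r// gt_eqF.
pose P a' b' c' d' := cnorm (rectint f a' b' c' d') <=
  k * ((b' - a') + (d' - c')) ^+ 2.
apply: (@rectangle_bisection P) => //.
  move=> a' b' c' d' aa ab' bb cc cd' dd m n; rewrite /P => P1 P2 P3 P4.
  have am : a' <= m by rewrite /m; lra.
  have mb : m <= b' by rewrite /m; lra.
  have cn : c' <= n by rewrite /n; lra.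
  have nd : n <= d' by rewrite /n; lra.
  have cf' : rcont f a' b' c' d' by exact: rcontS cf.
  rewrite (rectint_hsplit am mb (ltW cd') cf').
  rewrite (rectint_vsplit am cn nd); last by apply: rcontS cf'.
  rewrite (rectint_vsplit mb cn nd); last by apply: rcontS cf'.
  have e1 : m - a' = (b' - a') / 2 by rewrite /m; field.
  have e2 : b' - m = (b' - a') / 2 by rewrite /m; field.
  have e3 : n - c' = (d' - c') / 2 by rewrite /n; field.
  have e4 : d' - n = (d' - c') / 2 by rewrite /n; field.
  rewrite !(e1, e2, e3, e4) in P1 P2 P3 P4.
  have t1 := cnormD (rectint f a' m c' n) (rectint f a' m n d').
  have t2 := cnormD (rectint f m b' c' n) (rectint f m b' n d').
  apply: (le_trans (cnormD _ _)).
  have -> : k * (b' - a' + (d' - c')) ^+ 2 =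
    4 * (k * ((b' - a') / 2 + (d' - c') / 2) ^+ 2) by field.
  lra.
move=> x y xab ycd; have k40 : 0 < k / 4 by rewrite divr_gt0.
set z := (x +i* y)%C.
have [e1 e10 He1] := (has_cderivP _ _ _).1 (H x y xab ycd) _ k40.
exists (e1 / 2); first by rewrite divr_gt0.
move=> a' b' c' d' aa bb cc dd /andP[x1 x2] /andP[y1 y2] ab' cd' _ we he; rewrite /P.
have cf' : rcont f a' b' c' d' by exact: rcontS cf.
pose A (u : R[i]) := f z + g z * (u - z).
have cA (u : R[i]) : has_cderiv A u (g z).
  have -> : g z = 0 + g z * (1 - 0) by ring.
  apply: has_cderivD; first exact: has_cderiv_cst.
  exact: has_cderivZ (has_cderivB (has_cderiv_id u) (has_cderiv_cst z u)).
have rA : rcont A a' b' c' d' by move=> *; exact: has_cderiv_cont (cA _).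
have IA : rectint A a' b' c' d' = 0.
  pose G (u : R[i]) := f z * u + g z / 2 * ((u - z) * (u - z)).
  apply: (@rectint_primitive _ G); [exact: ltW|exact: ltW| |exact: rcont_bcont].
  move=> x' y' _; set u := (x' +i* y')%C.
  have h0 := has_cderivB (has_cderiv_id u) (has_cderiv_cst z u).
  have := has_cderivD (has_cderivZ (f z) (has_cderiv_id u))
    (has_cderivZ (g z / 2) (has_cderivM h0 h0)).
  by congr has_cderiv; rewrite /A/=; field.
have -> : rectint f a' b' c' d' = rectint (fun u => f u - A u) a' b' c' d'.
  by rewrite rectintB ?(ltW ab') ?(ltW cd')// ?IA ?subr0//; exact: rcont_bcont.
have rB : rcont (fun u => f u - A u) a' b' c' d'.
  move=> x' y' /andP[? ?] /andP[? ?]; apply: has_cderiv_cont.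
  by apply: has_cderivB (cA _); apply: H; apply/andP; split; lra.
apply: (le_trans (rectint_le (M := k / 4 * ((b' - a') + (d' - c'))) _ _ (rcont_bcont rB) _)).
- exact: ltW.
- exact: ltW.
- move=> x' y' /and3P[/andP[x1' x2'] /andP[y1' y2'] _].
  have nu : cnorm ((x' +i* y')%C - z) <= (b' - a') + (d' - c').
    apply: (le_trans (cnorm_le_ReIm _)); rewrite /z complexB/= lerD// ler_norml;
    by apply/andP; split; lra.
  have := He1 (x' +i* y')%C; rewrite /A => /(_ _)/le_trans; rewrite opprD addrA; apply.
    by apply: (le_lt_trans nu); lra.
  by rewrite ler_wpM2l// ltW.
- by rewrite le_eqVlt; apply/orP; left; apply/eqP; field.
Qed.

Definition cderivable (f : R[i] -> R[i]) (z : R[i]) := exists w, has_cderiv f z w.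

Lemma goursat_cderivable (f : R[i] -> R[i]) (a b c d : R) : a <= b -> c <= d ->
  (forall x y, a <= x <= b -> c <= y <= d -> cderivable f (x +i* y)%C) ->
  rectint f a b c d = 0.
Proof.
move=> ab cd H; pose g z := xget 0 [set w | has_cderiv f z w].
apply: (@goursat f g) => // x y xab ycd.
have [w Hw] := H x y xab ycd; exact: (xgetPex 0 (ex_intro _ w Hw)).
Qed.

End Goursat.

(** * Cauchy's formula for the derivative *)

Section CauchyFormula.
Context {R : realType}.
Local Notation mu := (@lebesgue_measure R).
Implicit Types (f g h : R[i] -> R[i]) (a b c d e t : R).

(** The rectangle without the small square is cut into two full-width strips, below and above, and
    two blocks on the sides of the square. Goursat's theorem kills the four integrals, and the inner
    sides cancel. *)
Lemma rectint_annulus f a b c d x0 y0 e : 0 < e ->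
  a <= x0 - e -> x0 + e <= b -> c <= y0 - e -> y0 + e <= d ->
  (forall x y, a <= x <= b -> c <= y <= d -> (e <= `|x - x0|) || (e <= `|y - y0|) ->
    cderivable f (x +i* y)%C) ->
  rectint f a b c d = rectint f (x0 - e) (x0 + e) (y0 - e) (y0 + e).
Proof.
move=> e0 ha hb hc hd H.
have xe : x0 - e <= x0 + e by lra.
have ye : y0 - e <= y0 + e by lra.
have cf x y : a <= x <= b -> c <= y <= d -> (e <= `|x - x0|) || (e <= `|y - y0|) ->
    ccont f (x +i* y)%C.
  by move=> xab ycd xy; have [w /has_cderiv_cont] := H x y xab ycd xy.
have far (u u0 : R) : u <= u0 - e \/ u0 + e <= u -> e <= `|u - u0|.
  by move=> [?|?]; rewrite ler_normr; apply/orP; [right|left]; lra.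
have b0 : rectint f a b c (y0 - e) = 0.
  apply: goursat_cderivable; try lra.
  move=> x y xab /andP[? ?]; apply: H => //; first by apply/andP; split; lra.
  by rewrite (far y y0) ?orbT//; left.
have t0 : rectint f a b (y0 + e) d = 0.
  apply: goursat_cderivable; try lra.
  move=> x y xab /andP[? ?]; apply: H => //; first by apply/andP; split; lra.
  by rewrite (far y y0) ?orbT//; right.
have l0 : rectint f a (x0 - e) (y0 - e) (y0 + e) = 0.
  apply: goursat_cderivable; try lra.
  move=> x y /andP[? ?] /andP[? ?]; apply: H; try by apply/andP; split; lra.
  by rewrite (far x x0)//; left.
have r0 : rectint f (x0 + e) b (y0 - e) (y0 + e) = 0.
  apply: goursat_cderivable; try lra.
  move=> x y /andP[? ?] /andP[? ?]; apply: H; try by apply/andP; split; lra.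
  by rewrite (far x x0)//; right.
have va : pcont (fun y => f (a +i* y)%C) c d.
  apply: ccont_vpcont => y ycd; apply: cf => //; first by apply/andP; split; lra.
  by rewrite (far a x0)//; left.
have vb : pcont (fun y => f (b +i* y)%C) c d.
  apply: ccont_vpcont => y ycd; apply: cf => //; first by apply/andP; split; lra.
  by rewrite (far b x0)//; right.
have hm : pcont (fun x => f (x +i* (y0 - e))%C) a b.
  apply: ccont_hpcont => x xab; apply: cf => //; first by apply/andP; split; lra.
  by rewrite (far (y0 - e) y0) ?orbT//; left; lra.
have hp : pcont (fun x => f (x +i* (y0 + e))%C) a b.
  apply: ccont_hpcont => x xab; apply: cf => //; first by apply/andP; split; lra.
  by rewrite (far (y0 + e) y0) ?orbT//; right; lra.
have split3 (k : R -> R[i]) u v w s : u <= v -> v <= w -> w <= s -> pcont k u s ->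
    cint k u s = cint k u v + cint k v w + cint k w s.
  move=> uv vw ws Hk; rewrite (cint_chasles (le_trans uv vw) ws Hk).
  by rewrite (cint_chasles uv vw)//; apply: pcontS Hk.
apply/eqP; rewrite -subr_eq0; apply/eqP.
transitivity (rectint f a b c (y0 - e) + rectint f a b (y0 + e) d +
  rectint f a (x0 - e) (y0 - e) (y0 + e) +
  rectint f (x0 + e) b (y0 - e) (y0 + e)); last by rewrite b0 t0 l0 r0 !addr0.
rewrite /rectint.
rewrite (split3 _ _ _ _ _ hc ye hd va) (split3 _ _ _ _ _ hc ye hd vb).
rewrite (split3 _ _ _ _ _ ha xe hb hm) (split3 _ _ _ _ _ ha xe hb hp).
ring.
Qed.

Lemma eq_rectint f g a b c d : a <= b -> c <= d ->
  (forall x y, onbd a b c d x y -> f (x +i* y)%C = g (x +i* y)%C) ->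
  rectint f a b c d = rectint g a b c d.
Proof.
move=> ab cd H; have [s1 s2 s3 s4] := onbd_sides ab cd.
rewrite /rectint; congr (_ - _ + 'i%C * (_ - _)); apply: eq_cint => u uab; apply: H; auto.
Qed.

Lemma has_cderiv_invsub (w z : R[i]) : z != w ->
  has_cderiv (fun u => (u - w)^-1) z (- (z - w) ^- 2).
Proof.
move=> zw; have h0 := has_cderivB (has_cderiv_id z) (has_cderiv_cst w z).
have zw0 : z - w != 0 by rewrite subr_eq0.
by have := has_cderiv_comp h0 (has_cderivV zw0); rewrite subr0 mulr1.
Qed.

Definition strictly_in a b c d (w : R[i]) :=
  (a < complex.Re w < b) /\ (c < complex.Im w < d).

Lemma onbd_neq a b c d w x y : strictly_in a b c d w -> onbd a b c d x y ->
  (x +i* y)%C != w.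
Proof.
case: w => w1 w2 [/= /andP[? ?] /andP[? ?]] /and3P[_ _ xy]; apply/eqP => -[? ?].
by case/or4P : xy => /eqP ?; lra.
Qed.

Lemma bcont_invsub a b c d w : strictly_in a b c d w ->
  bcont (fun u => (u - w)^-1) a b c d.
Proof.
move=> sw x y xy; apply: has_cderiv_cont (has_cderiv_invsub _).
exact: onbd_neq sw xy.
Qed.

Lemma has_cderiv_invsub2 (w z : R[i]) : z != w ->
  has_cderiv (fun u => (u - w)^-1 ^+ 2) z (- 2 * (z - w) ^- 3).
Proof.
move=> zw; have h0 := has_cderiv_invsub zw.
have := has_cderivM h0 h0; congr has_cderiv.
have zw0 : z - w != 0 by rewrite subr_eq0.
by field.
Qed.

(** Subtracting the first-order expansion of [h] at [w] leaves a quotient [k] that is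
    [o(1 / |z - w|)], so its integral over a shrinking square tends to zero. The term in [h w]
    disappears because [(z - w)^-2] has a primitive on the boundary. The integral of [(z - w)^-1] is
    left unevaluated: a lower bound for its modulus will do. *)
Lemma cauchy_derivative h (l w : R[i]) a b c d : strictly_in a b c d w ->
  (forall x y, a <= x <= b -> c <= y <= d -> cderivable h (x +i* y)%C) ->
  has_cderiv h w l ->
  l * rectint (fun z => (z - w)^-1) a b c d =
  rectint (fun z => h z * (z - w)^-1 ^+ 2) a b c d.
Proof.
move=> sw Hh hw; case: (sw) => /andP[aw wb] /andP[cw wd].
have ab : a <= b by lra.
have cd : c <= d by lra.
pose q (z : R[i]) := (z - w)^-1.
pose k z := (h z - h w - l * (z - w)) * q z ^+ 2.
have dk x y : a <= x <= b -> c <= y <= d -> (x +i* y)%C != w ->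
    cderivable k (x +i* y)%C.
  move=> xab ycd xyw; have [v hv] := Hh x y xab ycd; set z := (x +i* y)%C in hv xyw *.
  have h1 := has_cderivB (has_cderivB hv (has_cderiv_cst (h w) z))
    (has_cderivZ l (has_cderivB (has_cderiv_id z) (has_cderiv_cst w z))).
  by eexists; exact: has_cderivM h1 (has_cderiv_invsub2 xyw).
have bk : bcont k a b c d.
  move=> x y xy; have /and3P[xab ycd _] := xy.
  by have [v /has_cderiv_cont] := dk x y xab ycd (onbd_neq sw xy).
have k0 : rectint k a b c d = 0.
  apply/eqP; rewrite -cnorm_eq0 eq_le cnorm_ge0 andbT; apply/ler_addgt0Pr => e0 e00.
  (* On the square of half side [e] the integrand is at most [eta / e], and [rectint_le] gives
     [4 * (eta / e * (4 * e)) = 16 * eta]. *)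
  pose eta := e0 / 16; have eta0 : 0 < eta by rewrite divr_gt0.
  have [dl dl0 Hd] := (has_cderivP _ _ _).1 hw _ eta0.
  pose w1 := complex.Re w; pose w2 := complex.Im w.
  have [e e_gt0 [e1 e2 e3 e4 e5]] : exists2 e, 0 < e &
      [/\ e <= w1 - a, e <= b - w1, e <= w2 - c, e <= d - w2 & 2 * e < dl].
    exists (Num.min (dl / 4) (Num.min (Num.min (w1 - a) (b - w1)) (Num.min (w2 - c) (d - w2)))).
      by rewrite !lt_min !subr_gt0 aw wb cw wd divr_gt0.
    set m := Num.min _ _.
    have m1 : m <= dl / 4 by rewrite ge_min lexx.
    have m2 : m <= w1 - a by rewrite !ge_min lexx ?orbT.
    have m3 : m <= b - w1 by rewrite !ge_min lexx ?orbT.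
    have m4 : m <= w2 - c by rewrite !ge_min lexx ?orbT.
    have m5 : m <= d - w2 by rewrite !ge_min lexx ?orbT.
    by split => //; lra.
  rewrite (@rectint_annulus k a b c d w1 w2 e)//; try lra; last first.
    move=> x y xab ycd xy; apply: dk => //; apply: contraTN xy => /eqP wE.
    by rewrite /w1 /w2 -wE/= !subrr normr0 negb_or -!ltNge e_gt0.
  apply: (le_trans (rectint_le (M := eta / e) _ _ _ _)); try lra.
  - move=> x y /and3P[/andP[? ?] /andP[? ?] xy].
    have xyw : (x +i* y)%C != w.
      apply/eqP => wE; move: xy; rewrite /w1 /w2 -wE/=.
      by case/or4P => /eqP ?; lra.
    have [|||v /has_cderiv_cont]// := dk x y; by apply/andP; split; lra.
  - move=> x y /and3P[/andP[? ?] /andP[? ?] xy].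
    have reE : complex.Re ((x +i* y)%C - w) = x - w1 by rewrite Re_add Re_opp.
    have imE : complex.Im ((x +i* y)%C - w) = y - w2 by rewrite Im_add Im_opp.
    have n1 : e <= cnorm ((x +i* y)%C - w).
      have : (e <= `|x - w1|) || (e <= `|y - w2|).
        case/or4P : xy => /eqP ->.
        - by rewrite ler_normr; apply/orP; left; apply/orP; right; lra.
        - by rewrite ler_normr; apply/orP; left; apply/orP; left; lra.
        - by rewrite [X in _ || X]ler_normr; apply/orP; right; apply/orP; right; lra.
        - by rewrite [X in _ || X]ler_normr; apply/orP; right; apply/orP; left; lra.
      case/orP => /le_trans; apply.
        by rewrite -reE ler_Re_cnorm.
      by rewrite -imE ler_Im_cnorm.
    have n2 : cnorm ((x +i* y)%C - w) < dl.
      apply: le_lt_trans (cnorm_le_ReIm _) _; rewrite reE imE.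
      have : `|x - w1| <= e by rewrite ler_norml; apply/andP; split; lra.
      have : `|y - w2| <= e by rewrite ler_norml; apply/andP; split; lra.
      lra.
    have n0 : 0 < cnorm ((x +i* y)%C - w) by lra.
    have := Hd _ n2; rewrite /k /q cnormM cnormX cnormV => hk.
    rewrite expr2 mulrA ler_pM ?invr_ge0 ?mulr_ge0 ?invr_ge0 ?cnorm_ge0//.
      by rewrite ler_pdivrMr.
    by rewrite lef_pV2.
  have -> : (w1 + e - (w1 - e) + (w2 + e - (w2 - e))) = 4 * e by ring.
  by rewrite /eta add0r le_eqVlt; apply/orP; left; apply/eqP; field; rewrite gt_eqF.
have bq : bcont q a b c d by exact: bcont_invsub.
have bh : bcont h a b c d.
  by move=> x y /and3P[xab ycd _]; have [v /has_cderiv_cont] := Hh x y xab ycd.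
have bq2 : bcont (fun z => q z ^+ 2) a b c d.
  by move=> x y xy; apply: has_cderiv_cont (has_cderiv_invsub2 (onbd_neq sw xy)).
have bhq2 : bcont (fun z => h z * q z ^+ 2) a b c d.
  move=> x y xy; have /and3P[xab ycd _] := xy; have [v hv] := Hh x y xab ycd.
  exact: has_cderiv_cont (has_cderivM hv (has_cderiv_invsub2 (onbd_neq sw xy))).
have q20 : rectint (fun z => q z ^+ 2) a b c d = 0.
  apply: (@rectint_primitive _ (fun z => (-1) * q z)) => // x y xy.
  have := has_cderivZ (-1) (has_cderiv_invsub (onbd_neq sw xy)).
  by congr has_cderiv; rewrite mulN1r opprK /q exprVn.
pose k2 z := h z * q z ^+ 2 - h w * q z ^+ 2 - l * q z.
have b1 : bcont (fun z => h w * q z ^+ 2) a b c d.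
  move=> x y xy; apply: has_cderiv_cont.
  exact: has_cderivZ (has_cderiv_invsub2 (onbd_neq sw xy)).
have b2 : bcont (fun z => h z * q z ^+ 2 - h w * q z ^+ 2) a b c d.
  move=> x y xy; have /and3P[xab ycd _] := xy; have [v hv] := Hh x y xab ycd.
  exact: has_cderiv_cont (has_cderivB
   (has_cderivM hv (has_cderiv_invsub2 (onbd_neq sw xy)))
   (has_cderivZ _ (has_cderiv_invsub2 (onbd_neq sw xy)))).
have b3 : bcont (fun z => l * q z) a b c d.
  move=> x y xy; apply: has_cderiv_cont.
  exact: has_cderivZ (has_cderiv_invsub (onbd_neq sw xy)).
have : rectint k2 a b c d = 0.
  rewrite -k0; apply: eq_rectint => // x y xy.
  have xyw : (x +i* y)%C - w != 0 by rewrite subr_eq0 (onbd_neq sw xy).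
  by rewrite /k2 /k /q; field.
rewrite /k2 rectintB// rectintB// rectintZ// q20 mulr0 subr0 rectintZ//.
by move/eqP; rewrite subr_eq0 => /eqP.
Qed.

(** The difference of the two integrands is the derivative of [h z / (z - w)], which is
    single-valued on the boundary. *)
Lemma cauchy_by_parts h g w a b c d : strictly_in a b c d w ->
  (forall x y, a <= x <= b -> c <= y <= d ->
     has_cderiv h (x +i* y)%C (g (x +i* y)%C)) ->
  bcont g a b c d -> bcont (fun z => g z * (z - w)^-1) a b c d ->
  rectint (fun z => h z * (z - w)^-1 ^+ 2) a b c d =
  rectint (fun z => g z * (z - w)^-1) a b c d.
Proof.
move=> sw H bg bgq; case: (sw) => /andP[aw wb] /andP[cw wd].
have ab : a <= b by lra.
have cd : c <= d by lra.
have bhq2 : bcont (fun z => h z * (z - w)^-1 ^+ 2) a b c d.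
  move=> x y xy; have /and3P[xab ycd _] := xy.
  exact: has_cderiv_cont (has_cderivM (H x y xab ycd) (has_cderiv_invsub2 (onbd_neq sw xy))).
apply/esym/eqP; rewrite -subr_eq0 -rectintB//; apply/eqP.
apply: (@rectint_primitive _ (fun z => h z * (z - w)^-1)) => //.
  move=> x y xy; have /and3P[xab ycd _] := xy.
  have := has_cderivM (H x y xab ycd) (has_cderiv_invsub (onbd_neq sw xy)).
  by congr has_cderiv; rewrite mulrN exprVn.
move=> x y xy e e0; have e20 : 0 < e / 2 by rewrite divr_gt0.
have [d1 d10 H1] := bgq x y xy _ e20; have [d2 d20 H2] := bhq2 x y xy _ e20.
exists (Num.min d1 d2); first by rewrite lt_min d10.
move=> u; rewrite lt_min => /andP[u1 u2].
have := H1 u u1; have := H2 u u2.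
set A := g u * _; set B := h u * _; set C := g _ * _; set D := h _ * _ => hD hC.
have -> : A - B - (C - D) = (A - C) - (B - D) by ring.
by apply: (le_lt_trans (cnormD _ _)); rewrite cnormN; lra.
Qed.

Lemma Re_inv (z : R[i]) : complex.Re z^-1 = complex.Re z / (complex.Re z ^+ 2 + complex.Im z ^+ 2).
Proof. by case: z. Qed.

Lemma Im_inv (z : R[i]) : complex.Im z^-1 =
  - (complex.Im z / (complex.Re z ^+ 2 + complex.Im z ^+ 2)).
Proof. by case: z. Qed.

Lemma Rintegral_ge (p : R -> R) a b m : a <= b -> {within `[a, b], continuous p} ->
  (forall x, a <= x <= b -> m <= p x) -> m * (b - a) <= \int[mu]_(x in `[a, b]) p x.
Proof.
move=> ab cp mp; have -> : m * (b - a) = \int[mu]_(x in `[a, b]) m.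
  rewrite Rintegral_cst//; congr (_ * _).
  have mE : mu `[a, b]%classic = (b - a)%:E.
    rewrite lebesgue_measure_itv/= lte_fin.
    by case: ltP => //= ba; rewrite (_ : b = a) ?subrr//; lra.
  by rewrite -[LHS]/(fine (b - a)%:E) -mE.
apply: le_Rintegral => //; last exact: integrable_itv.
apply: integrable_itv; apply: within_continuous_itvP => x _ e e0.
by exists 1 => // y _ _; rewrite subrr normr0.
Qed.

(** A bound below the exact modulus [2 pi]: each side contributes to the imaginary part the integral
    of [t / (s ^+ 2 + t ^+ 2) >= 1 / (2 * t)] over a length [2 * t], hence at least 1. *)
Lemma rectint_invsub_ge x0 y0 t : 0 < t ->
  4 <= cnorm (rectint (fun z => (z - (x0 +i* y0)%C)^-1) (x0 - t) (x0 + t) (y0 - t) (y0 + t)).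
Proof.
move=> t0; apply: le_trans (ler_Im_cnorm _); apply: le_trans (ler_norm _).
have sw : strictly_in (x0 - t) (x0 + t) (y0 - t) (y0 + t) (x0 +i* y0)%C.
  by split => /=; apply/andP; split; lra.
have xt : x0 - t <= x0 + t by lra.
have yt : y0 - t <= y0 + t by lra.
have [c1 c2 c3 c4] := bcont_pcont xt yt (bcont_invsub sw).
rewrite /rectint !(Im_add, Im_opp, Im_mul, Re_add, Re_opp)/= mul0r add0r mul1r.
have key (p : R -> R) x1 : {within `[x1 - t, x1 + t], continuous p} ->
    (forall x, x1 - t <= x <= x1 + t -> p x = t / ((x - x1) ^+ 2 + t ^+ 2)) ->
    1 <= \int[mu]_(x in `[x1 - t, x1 + t]) p x.
  move=> cp pE; have -> : 1 = (2 * t)^-1 * ((x1 + t) - (x1 - t)).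
    by field; rewrite gt_eqF.
  apply: Rintegral_ge => //; first lra.
  move=> x /andP[? ?]; rewrite pE; last by apply/andP.
  rewrite ler_pdivlMr ?ltr_wpDl ?sqr_ge0 ?exprn_gt0//.
  rewrite -ler_pdivlMl ?invr_gt0 ?mulr_gt0// invrK.
  have : (x - x1) ^+ 2 <= t ^+ 2.
    rewrite -ler_sqrt ?sqr_ge0// !sqrtr_sqr (gtr0_norm t0) ler_norml.
    by apply/andP; split; lra.
  by rewrite !expr2; lra.
have k1 := key _ _ (pcont_Im c1).
have k2 := key (fun x => - complex.Im ((x +i* (y0 + t))%C - (x0 +i* y0)%C)^-1) x0.
have k3 := key _ _ (pcont_Re c3).
have k4 := key (fun y => - complex.Re (((x0 - t) +i* y)%C - (x0 +i* y0)%C)^-1) y0.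
have N (p : R -> R) u v : {within `[u, v], continuous p} ->
    {within `[u, v], continuous (fun x => - p x)} /\
    \int[mu]_(x in `[u, v]) (- p x) = - \int[mu]_(x in `[u, v]) p x.
  move=> cp; split; first by move=> x; apply: continuousN; exact: cp.
  rewrite -mulN1r -RintegralZl//; last exact: integrable_itv.
  by apply: eq_Rintegral => x _; rewrite mulN1r.
have [n2 i2] := N _ _ _ (pcont_Im c2); have [n4 i4] := N _ _ _ (pcont_Re c4).
rewrite -i2 -i4.
have e1 : y0 - t - y0 = - t by ring.
have e2 : y0 + t - y0 = t by ring.
have e3 : x0 + t - x0 = t by ring.
have e4 : x0 - t - x0 = - t by ring.
have l2 := k2 n2; have l4 := k4 n4.
have {}l2 : 1 <= \int[mu]_(x in `[x0 - t, x0 + t])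
    - complex.Im ((x +i* (y0 + t))%C - (x0 +i* y0)%C)^-1.
  by apply: l2 => x _; rewrite complexB Im_inv/= opprK e2.
have {}l4 : 1 <= \int[mu]_(y in `[y0 - t, y0 + t])
    - complex.Re (((x0 - t) +i* y)%C - (x0 +i* y0)%C)^-1.
  by apply: l4 => x _; rewrite complexB Re_inv/= e4 mulNr opprK sqrrN [_ ^+ 2 + _]addrC.
have l1 : 1 <= \int[mu]_(x in `[x0 - t, x0 + t])
    complex.Im ((x +i* (y0 - t))%C - (x0 +i* y0)%C)^-1.
  by apply: k1 => x _; rewrite complexB Im_inv/= e1 mulNr opprK sqrrN.
have l3 : 1 <= \int[mu]_(y in `[y0 - t, y0 + t])
    complex.Re (((x0 + t) +i* y)%C - (x0 +i* y0)%C)^-1.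
  by apply: k3 => x _; rewrite complexB Re_inv/= e3 [_ ^+ 2 + _]addrC.
lra.
Qed.

End CauchyFormula.

(** * Measurability in the plane, invariance of Lebesgue measure *)

Section PlaneMeasurability.
Context {R : realType}.
Local Notation mu := (@lebesgue_measure R).

Definition popen (U : set (R * R)) := forall p, U p -> exists2 e : R, 0 < e &
  forall q : R * R, `|q.1 - p.1| < e -> `|q.2 - p.2| < e -> U q.

Lemma open_popen (U : set (R * R)) : open U -> popen U.
Proof.
move=> oU p Up; have /nbhs_ballP[e /= e0 He] := open_nbhs_nbhs (conj oU Up).
exists e => // q q1 q2; apply: He; split; by rewrite /ball/= distrC.
Qed.

Lemma popen_open (U : set (R * R)) : popen U -> open U.
Proof.
move=> oU; rewrite openE => p /oU[e e0 He]; apply/nbhs_ballP; exists e => //=.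
by move=> q [q1 q2]; apply: He; rewrite distrC.
Qed.

(** The sigma-algebra of the plane is the product one, so an open set has to be displayed as a
    countable union of products: the boxes with rational centre and radius that it contains. *)
Lemma popen_measurable (U : set (R * R)) : popen U -> measurable U.
Proof.
move=> oU.
pose box (r s k : rat) : set (R * R) :=
  `](ratr r - ratr k), (ratr r + ratr k)[%classic `*`
  `](ratr s - ratr k), (ratr s + ratr k)[%classic.
have -> : U = \bigcup_(r : rat) \bigcup_(s : rat) \bigcup_(k : rat)
    (if `[< box r s k `<=` U >] then box r s k else set0).
  apply/seteqP; split => [p Up|p [r _ [s _ [k _]]]]; last first.
    by case: asboolP => // + ?; apply.
  have [e e0 He] := oU p Up.
  have rd (x y : R) : x < y -> exists q : rat, x < ratr q < y.
    by move=> xy; have [q] := rat_in_itvoo xy; rewrite in_itv/=; exists q.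
  (* A box of half side [k < e / 2] that contains [p] stays within [2 * k < e] of [p]. *)
  have [|k /andP[k0 ke]] := rd 0 (e / 2); first by lra.
  have [|r /andP[r1 r2]] := rd (p.1 - ratr k) (p.1 + ratr k); first by lra.
  have [|s /andP[s1 s2]] := rd (p.2 - ratr k) (p.2 + ratr k); first by lra.
  exists r => //; exists s => //; exists k => //.
  case: asboolP => [_|nb].
    by split => /=; rewrite in_itv/=; apply/andP; split; lra.
  case: nb => q [/=]; rewrite !in_itv/= => /andP[? ?] /andP[? ?].
  by apply: He; rewrite ltr_norml; apply/andP; split; lra.
apply: bigcupT_measurable_rat => r; apply: bigcupT_measurable_rat => s.
apply: bigcupT_measurable_rat => k; case: asboolP => // _.
by apply: measurableX; exact: measurable_itv.
Qed.

Lemma measurable_fun_popen (U : set (R * R)) (f : R * R -> R) : popen U ->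
  (forall p, U p -> forall e : R, 0 < e -> exists2 d : R, 0 < d &
    forall q : R * R, `|q.1 - p.1| < d -> `|q.2 - p.2| < d -> `|f q - f p| < e) ->
  measurable_fun U f.
Proof.
move=> oU cf mU; apply: (measurability _ (RGenOInfty.measurableE R)) => //.
move=> /= _ [_ [x ->] <-]; apply: popen_measurable => p [Up].
rewrite /= in_itv/= andbT => xf.
have [e e0 He] := oU p Up.
have fx : 0 < f p - x by rewrite subr_gt0.
have [d d0 Hd] := cf p Up _ fx.
exists (Num.min e d); first by rewrite lt_min e0.
move=> q; rewrite !lt_min => /andP[q1 q1'] /andP[q2 q2']; split; first exact: He.
rewrite /= in_itv/= andbT.
by have := Hd q q1' q2'; rewrite ltr_norml => /andP[? ?]; lra.
Qed.

Lemma cnorm_toC_le (p q : R * R) :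
  cnorm (toC q - toC p) <= `|q.1 - p.1| + `|q.2 - p.2|.
Proof. exact: cnorm_le_ReIm. Qed.

Lemma popen_disc : popen [set p : R * R | (cnorm (toC p) < 1)%R].
Proof.
move=> p /= p1; exists ((1 - cnorm (toC p)) / 2); first by rewrite divr_gt0// subr_gt0.
move=> q q1 q2 /=; have := cnorm_dist (toC q) (toC p).
have := cnorm_toC_le p q; lra.
Qed.

Lemma popen_closed_discC (rho : R) : popen (~` [set p : R * R | (cnorm (toC p) <= rho)%R]).
Proof.
move=> p /= /negP; rewrite -ltNge => rp.
exists ((cnorm (toC p) - rho) / 2); first by rewrite divr_gt0// subr_gt0.
move=> q q1 q2; apply/negP; rewrite -ltNge.
have := cnorm_dist (toC p) (toC q); have := cnorm_toC_le p q.
by rewrite (cnormB (toC q)); lra.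
Qed.

Lemma measurable_fun_cont (f : R[i] -> R) :
  (forall z, disc z -> forall e : R, 0 < e -> exists2 d : R, 0 < d &
    forall u : R[i], cnorm (u - z) < d -> `|f u - f z| < e) ->
  measurable_fun [set p : R * R | (cnorm (toC p) < 1)%R] (fun p => f (toC p)).
Proof.
move=> cf; apply: measurable_fun_popen; first exact: popen_disc.
move=> p p1 e e0; have [d d0 Hd] := cf _ p1 e e0.
exists (d / 2); first by lra.
by move=> q q1 q2; apply: Hd; have := cnorm_toC_le p q; lra.
Qed.

(** By uniqueness of Lebesgue measure, it suffices that the pushforward gives the right mass to each
    []a, b]]; for [s = -1] the preimage is closed on the left and open on the right, with the same
    length. *)
Lemma ge0_integral_affine (F : R -> \bar R) (s c : R) : (s = 1 \/ s = -1) ->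
  measurable_fun [set: R] F -> (forall x, 0 <= F x)%E ->
  (\int[mu]_x F (s * x + c)%R = \int[mu]_x F x)%E.
Proof.
move=> s1 mF F0.
pose ph (x : measurableTypeR R) : measurableTypeR R := s * x + c.
have mph : measurable_fun setT ph.
  by apply: measurable_funD => //; apply: measurable_funM.
pose phm : {mfun (measurableTypeR R) >-> (measurableTypeR R)} :=
  HB.pack ph (isMeasurableFun.Build _ _ _ _ ph mph).
rewrite [RHS](eq_measure_integral (pushforward mu phm)) => [|A mA _].
  by rewrite (ge0_integral_pushforward mph).
apply: (lebesgue_measure_unique (mu := pushforward mu phm)) => //.
move=> _ [[a b] _ <-]; rewrite lebesgue_measure_itv/= /pushforward.
case: s1 => s1.
  rewrite (_ : _ @^-1` _ = `](a - c), (b - c)]%classic); last first.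
    by apply/seteqP; split => x /=; rewrite !in_itv/= /ph s1 => /andP[? ?];
      apply/andP; split; lra.
  rewrite lebesgue_measure_itv/= !lte_fin ltrD2r.
  by case: ifP => // _; congr EFin; ring.
rewrite (_ : _ @^-1` _ = `[(c - b), (c - a)[%classic); last first.
  by apply/seteqP; split => x /=; rewrite !in_itv/= /ph s1 => /andP[? ?];
    apply/andP; split; lra.
rewrite lebesgue_measure_itv/= !lte_fin ltrD2l ltrN2.
by case: ifP => // _; congr EFin; ring.
Qed.

End PlaneMeasurability.

(** * Continuity of the derivative *)

Section DerivativeContinuity.
Context {R : realType}.
Local Notation mu := (@lebesgue_measure R).
Implicit Types (f g h p : R[i] -> R[i]) (a b c d e t : R).

(** Twice the integral of the modulus along the boundary; the factor 2 is that of [cint_norm]. *)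
Definition bdnorm p a b c d : R :=
  2 * ((\int[mu]_(x in `[a, b]) cnorm (p (x +i* c)%C)) +
       (\int[mu]_(x in `[a, b]) cnorm (p (x +i* d)%C)) +
       (\int[mu]_(y in `[c, d]) cnorm (p (b +i* y)%C)) +
       (\int[mu]_(y in `[c, d]) cnorm (p (a +i* y)%C))).

Lemma rectint_le_mul f p a b c d k : a <= b -> c <= d ->
  bcont f a b c d -> bcont p a b c d ->
  (forall x y, onbd a b c d x y -> cnorm (f (x +i* y)%C) <= k * cnorm (p (x +i* y)%C)) ->
  cnorm (rectint f a b c d) <= k * bdnorm p a b c d.
Proof.
move=> ab cd /(bcont_pcont ab cd)[f1 f2 f3 f4] /(bcont_pcont ab cd)[p1 p2 p3 p4] fp.
have [s1 s2 s3 s4] := onbd_sides ab cd.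
have key (q r : R -> R[i]) u v : pcont q u v -> pcont r u v ->
    (forall x, u <= x <= v -> cnorm (q x) <= k * cnorm (r x)) ->
    cnorm (cint q u v) <= k * (2 * \int[mu]_(x in `[u, v]) cnorm (r x)).
  move=> Hq Hr qr; apply: (le_trans (cint_norm Hq)).
  have ir := integrable_itv (pcont_cnorm Hr).
  rewrite mulrCA ler_wpM2l// -RintegralZl//.
  apply: le_Rintegral => //; first exact: integrable_itv (pcont_cnorm Hq).
  by apply: (integrableZl _ k ir).
have c1 := key _ _ _ _ f1 p1 (fun x H => fp _ _ (s1 x H)).
have c2 := key _ _ _ _ f2 p2 (fun x H => fp _ _ (s2 x H)).
have c3 := key _ _ _ _ f3 p3 (fun x H => fp _ _ (s3 x H)).
have c4 := key _ _ _ _ f4 p4 (fun x H => fp _ _ (s4 x H)).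
rewrite /rectint.
have h1 := cnormD (cint (fun x => f (x +i* c)%C) a b) (- cint (fun x => f (x +i* d)%C) a b).
have h2 := cnormD (cint (fun y => f (b +i* y)%C) c d) (- cint (fun y => f (a +i* y)%C) c d).
rewrite !cnormN in h1 h2.
apply: (le_trans (cnormD _ _)); rewrite [cnorm (_ * _)]cnormM cnorm_i mul1r.
rewrite /bdnorm; lra.
Qed.

Lemma square_in_disc (x0 y0 t x y : R) : cnorm (x0 +i* y0)%C + 2 * t < 1 ->
  x0 - t <= x <= x0 + t -> y0 - t <= y <= y0 + t -> disc (x +i* y)%C.
Proof.
move=> zt /andP[? ?] /andP[? ?]; rewrite /disc/=.
have := cnorm_dist (x +i* y)%C (x0 +i* y0)%C.
have := cnorm_le_ReIm ((x +i* y)%C - (x0 +i* y0)%C); rewrite complexB/=.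
have : `|x - x0| <= t by rewrite ler_norml; apply/andP; split; lra.
have : `|y - y0| <= t by rewrite ler_norml; apply/andP; split; lra.
lra.
Qed.

Lemma onbd_square_dist (x0 y0 t x y : R) : 0 < t ->
  onbd (x0 - t) (x0 + t) (y0 - t) (y0 + t) x y ->
  t <= cnorm ((x +i* y)%C - (x0 +i* y0)%C).
Proof.
move=> t0 /and3P[_ _ xy].
have : (t <= `|x - x0|) || (t <= `|y - y0|).
  case/or4P : xy => /eqP ->.
  - by rewrite ler_normr; apply/orP; left; apply/orP; right; lra.
  - by rewrite ler_normr; apply/orP; left; apply/orP; left; lra.
  - by rewrite [X in _ || X]ler_normr; apply/orP; right; apply/orP; right; lra.
  - by rewrite [X in _ || X]ler_normr; apply/orP; right; apply/orP; left; lra.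
case/orP => /le_trans; apply; rewrite complexB.
  exact: (ler_Re_cnorm ((x - x0) +i* (y - y0))%C).
exact: (ler_Im_cnorm ((x - x0) +i* (y - y0))%C).
Qed.

(** By [cauchy_derivative] on a fixed square, [g w] is a quotient of two contour integrals whose
    kernels depend on [w] in a Lipschitz way, and the denominator has modulus at least 4 at the
    centre. Continuity of [g] makes the contour integrals of the derivative meaningful and its
    modulus measurable. *)
Lemma derivative_cont h g : (forall z, disc z -> has_cderiv h z (g z)) ->
  forall z, disc z -> ccont g z.
Proof.
move=> H [x0 y0] z1; set z0 := (x0 +i* y0)%C.
have [t t0 zt] : exists2 t : R, 0 < t & cnorm z0 + 2 * t < 1.
  exists ((1 - cnorm z0) / 4); first by rewrite divr_gt0// subr_gt0.
  by move: (z1); rewrite /disc/= -/z0; lra.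
have xt : x0 - t <= x0 + t by lra.
have yt : y0 - t <= y0 + t by lra.
pose SQ f := rectint f (x0 - t) (x0 + t) (y0 - t) (y0 + t).
pose q (w z : R[i]) := (z - w)^-1.
have Hh x y : x0 - t <= x <= x0 + t -> y0 - t <= y <= y0 + t -> cderivable h (x +i* y)%C.
  by move=> xt' yt'; exists (g (x +i* y)%C); apply: H; exact: square_in_disc zt xt' yt'.
have sin (w : R[i]) : cnorm (w - z0) < t / 2 ->
    strictly_in (x0 - t) (x0 + t) (y0 - t) (y0 + t) w.
  case: w => w1 w2 wz.
  have := le_lt_trans (ler_Re_cnorm _) wz; have := le_lt_trans (ler_Im_cnorm _) wz.
  rewrite complexB/= !ltr_norml => /andP[? ?] /andP[? ?].
  by split => /=; apply/andP; split; lra.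
have win (w : R[i]) : cnorm (w - z0) < t / 2 -> disc w.
  by move=> wz; rewrite /disc/=; have := cnorm_dist w z0; lra.
have z0in : cnorm (z0 - z0) < t / 2 by rewrite subrr cnorm0 divr_gt0.
have form (w : R[i]) : cnorm (w - z0) < t / 2 ->
    g w * SQ (q w) = SQ (fun z => h z * q w z ^+ 2).
  by move=> wz; apply: cauchy_derivative (sin w wz) Hh (H w (win w wz)).
have bh : bcont h (x0 - t) (x0 + t) (y0 - t) (y0 + t).
  by move=> x y /and3P[xt' yt' _]; have [l /has_cderiv_cont] := Hh x y xt' yt'.
have b1 : bcont (fun=> 1) (x0 - t) (x0 + t) (y0 - t) (y0 + t).
  by move=> x y _; exact: has_cderiv_cont (has_cderiv_cst 1 _).
have bq w : cnorm (w - z0) < t / 2 -> bcont (q w) (x0 - t) (x0 + t) (y0 - t) (y0 + t).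
  by move=> wz; exact: bcont_invsub (sin w wz).
have bhq w : cnorm (w - z0) < t / 2 ->
    bcont (fun z => h z * q w z ^+ 2) (x0 - t) (x0 + t) (y0 - t) (y0 + t).
  move=> wz x y xy; have /and3P[xt' yt' _] := xy; have [l hl] := Hh x y xt' yt'.
  exact: has_cderiv_cont (has_cderivM hl (has_cderiv_invsub2 (onbd_neq (sin w wz) xy))).
pose N1 := bdnorm (fun=> 1) (x0 - t) (x0 + t) (y0 - t) (y0 + t).
pose Nh := bdnorm h (x0 - t) (x0 + t) (y0 - t) (y0 + t).
(* Boundary points are at distance at least [t] from [z0] and at least [t / 2] from [w], which
   produces the two constants. *)
have qdiff (w : R[i]) x y : cnorm (w - z0) < t / 2 ->
    onbd (x0 - t) (x0 + t) (y0 - t) (y0 + t) x y ->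
    cnorm (q w (x +i* y)%C - q z0 (x +i* y)%C) <= 2 / t ^+ 2 * cnorm (w - z0) /\
    cnorm (q w (x +i* y)%C + q z0 (x +i* y)%C) <= 3 / t.
  move=> wz xy; set z := (x +i* y)%C.
  have n0 : t <= cnorm (z - z0) by exact: onbd_square_dist xy.
  have nw : t / 2 <= cnorm (z - w).
    have -> : z - w = (z - z0) - (w - z0) by ring.
    by have := cnorm_dist (z - z0) (w - z0); lra.
  have n00 : 0 < cnorm (z - z0) by lra.
  have nw0 : 0 < cnorm (z - w) by lra.
  have zz0 : z - z0 != 0 by rewrite -cnorm_gt0.
  have zw0 : z - w != 0 by rewrite -cnorm_gt0.
  have i0 : (cnorm (z - z0))^-1 <= t^-1 by rewrite lef_pV2.
  have iw : (cnorm (z - w))^-1 <= 2 / t.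
    have -> : 2 / t = (t / 2)^-1 by rewrite invf_div.
    by rewrite lef_pV2 ?posrE ?divr_gt0.
  split.
    have -> : q w z - q z0 z = (w - z0) * (z - w)^-1 * (z - z0)^-1.
      by rewrite /q; field; rewrite zz0 zw0.
    rewrite !cnormM !cnormV -mulrA mulrC ler_wpM2r ?cnorm_ge0//.
    have -> : 2 / t ^+ 2 = 2 / t * t^-1 by field; rewrite gt_eqF.
    by rewrite ler_pM ?invr_ge0 ?cnorm_ge0.
  apply: (le_trans (cnormD _ _)); rewrite !cnormV.
  have -> : 3 / t = 2 / t + t^-1 by field; rewrite gt_eqF.
  by rewrite lerD.
have dA (w : R[i]) : cnorm (w - z0) < t / 2 ->
    cnorm (SQ (q w) - SQ (q z0)) <= 2 / t ^+ 2 * cnorm (w - z0) * N1.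
  move=> wz; rewrite /SQ -rectintB//; [|exact: bq|exact: bq].
  apply: rectint_le_mul => //.
    by move=> x y xy; apply: has_cderiv_cont; exact: has_cderivB
      (has_cderiv_invsub (onbd_neq (sin w wz) xy)) (has_cderiv_invsub (onbd_neq (sin z0 z0in) xy)).
  by move=> x y xy; rewrite cnorm1 mulr1; have [] := qdiff w x y wz xy.
have dB (w : R[i]) : cnorm (w - z0) < t / 2 ->
    cnorm (SQ (fun z => h z * q w z ^+ 2) - SQ (fun z => h z * q z0 z ^+ 2)) <=
    6 / t ^+ 3 * cnorm (w - z0) * Nh.
  move=> wz; rewrite /SQ -rectintB//; [|exact: bhq|exact: bhq].
  apply: rectint_le_mul => //.
    move=> x y xy; have /and3P[xt' yt' _] := xy; have [l hl] := Hh x y xt' yt'.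
    apply: has_cderiv_cont; exact: has_cderivB
      (has_cderivM hl (has_cderiv_invsub2 (onbd_neq (sin w wz) xy)))
      (has_cderivM hl (has_cderiv_invsub2 (onbd_neq (sin z0 z0in) xy))).
  move=> x y xy; have [d1 d2] := qdiff w x y wz xy.
  rewrite -mulrBr subr_sqr cnormM mulrC ler_wpM2r ?cnorm_ge0// cnormM.
  have -> : 6 / t ^+ 3 * cnorm (w - z0) = (2 / t ^+ 2 * cnorm (w - z0)) * (3 / t).
    by field; rewrite gt_eqF.
  by rewrite ler_pM ?cnorm_ge0.
have A0 := rectint_invsub_ge x0 y0 t0.
rewrite -/z0 -/(q z0) -/(SQ (q z0)) in A0.
have bdn p u v c d : 0 <= bdnorm p u v c d.
  rewrite mulr_ge0// !addr_ge0//; apply: Rintegral_ge0 => *; exact: cnorm_ge0.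
move=> e e0.
(* Distance below [1 / K] keeps [SQ (q w)] within 1 of [SQ (q z0)], hence of modulus at least 1;
   distance below [e / K] makes the right-hand side of [E] smaller than [e]. *)
pose K := 1 + 2 / t ^+ 2 * N1 * (1 + cnorm (g z0)) + 6 / t ^+ 3 * Nh.
have t2 : 0 <= 2 / t ^+ 2 * N1 by rewrite mulr_ge0 ?divr_ge0 ?exprn_ge0 ?(ltW t0)//; exact: bdn.
have t3 : 0 <= 6 / t ^+ 3 * Nh by rewrite mulr_ge0 ?divr_ge0 ?exprn_ge0 ?(ltW t0)//; exact: bdn.
have ng := cnorm_ge0 (g z0).
have tg : 0 <= 2 / t ^+ 2 * N1 * cnorm (g z0) by rewrite mulr_ge0.
have K0 : 0 < K by rewrite /K mulrDr mulr1; lra.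
exists (Num.min (t / 2) (Num.min (1 / K) (e / K))).
  by rewrite !lt_min !divr_gt0.
move=> w; rewrite !lt_min => /and3P[w1 w2 w3].
rewrite !ltr_pdivlMr// in w2 w3.
have a1 := dA w w1; have a2 := dB w w1.
set dl := cnorm (w - z0) in w1 w2 w3 a1 a2.
have dl0 : 0 <= dl by exact: cnorm_ge0.
have E : (g w - g z0) * SQ (q w) =
    (SQ (fun z => h z * q w z ^+ 2) - SQ (fun z => h z * q z0 z ^+ 2))
    - g z0 * (SQ (q w) - SQ (q z0)).
  by rewrite mulrBr !mulrBl !form// -/z0; ring.
have sA : cnorm (SQ (q w) - SQ (q z0)) <= 1.
  apply: (le_trans a1); apply: le_trans (ltW w2); rewrite mulrAC mulrC ler_wpM2l//.
  by rewrite /K mulrDr mulr1; lra.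
have nA : 1 <= cnorm (SQ (q w)).
  by have := cnorm_dist (SQ (q z0)) (SQ (q w)); rewrite (cnormB (SQ (q z0))); lra.
apply: (@le_lt_trans _ _ (cnorm ((g w - g z0) * SQ (q w)))).
  by rewrite cnormM ler_peMr// cnorm_ge0.
rewrite E; apply: (le_lt_trans (cnormD _ _)); rewrite cnormN cnormM.
apply: le_lt_trans w3.
have : cnorm (g z0) * cnorm (SQ (q w) - SQ (q z0)) <=
   cnorm (g z0) * (2 / t ^+ 2 * dl * N1) by rewrite ler_wpM2l.
have -> : dl * K = dl + 2 / t ^+ 2 * dl * N1 + cnorm (g z0) * (2 / t ^+ 2 * dl * N1)
   + 6 / t ^+ 3 * dl * Nh by rewrite /K; ring.
have : 0 <= 2 / t ^+ 2 * dl * N1 by rewrite mulrAC mulr_ge0.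
lra.
Qed.

End DerivativeContinuity.

(** * Boundedness of point evaluations *)

Section PointEvaluation.
Context {R : realType}.
Local Notation mu := (@lebesgue_measure R).
Implicit Types (g h : R[i] -> R[i]).

Section AreaBound.
Variables (h g : R[i] -> R[i]) (x0 y0 delta : R).
Hypothesis H : forall z, disc z -> has_cderiv h z (g z).
Hypothesis delta0 : 0 < delta.
Hypothesis zd : cnorm (x0 +i* y0)%C + 2 * delta < 1.

Definition box : set (R * R) :=
  `[x0 - delta, x0 + delta]%classic `*` `[y0 - delta, y0 + delta]%classic.

Let gn (p : R * R) : R := cnorm (g (toC p)) ^+ 2.
(** Extended by zero outside the box, so that Tonelli's theorem and translations apply to integrals
    over full lines. *)
Let G : R * R -> \bar R := (fun p => (gn p)%:E) \_ box.

Lemma measurable_box : measurable box.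
Proof. by apply: measurableX; exact: measurable_itv. Qed.

Lemma box_disc p : box p -> (cnorm (toC p) < 1)%R.
Proof.
case: p => x y [/=]; rewrite !in_itv/= => xd yd; exact: square_in_disc zd xd yd.
Qed.

Lemma measurable_cnorm_sqr :
  measurable_fun [set p : R * R | (cnorm (toC p) < 1)%R]
    (fun p => cnorm (g (toC p)) ^+ 2).
Proof.
apply: measurable_funX; apply: (@measurable_fun_cont _ (fun z => cnorm (g z))).
move=> z z1 e e0; have [d d0 Hd] := derivative_cont H z1 e0.
exists d => // u uz; have hu := Hd u uz; rewrite ltr_norml.
have := cnorm_dist (g u) (g z); have := cnorm_dist (g z) (g u).
by rewrite (cnormB (g z)) => *; apply/andP; split; lra.
Qed.

Let mG : measurable_fun setT G.
Proof.
apply/(measurable_restrictT _ measurable_box).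
apply/measurable_EFinP; apply: measurable_funS measurable_cnorm_sqr.
  by apply: popen_measurable; exact: popen_disc.
by move=> p /box_disc.
Qed.

Let G0 p : (0 <= G p)%E.
Proof.
by rewrite /G patchE; case: ifP => // _; rewrite lee_fin sqr_ge0.
Qed.

Let hline (y : R) : y0 - delta <= y <= y0 + delta ->
  pcont (fun x => g (x +i* y)%C) (x0 - delta) (x0 + delta).
Proof.
move=> yd; apply: ccont_hpcont => x xd; apply: (derivative_cont H).
exact: square_in_disc zd xd yd.
Qed.

Let vline (x : R) : x0 - delta <= x <= x0 + delta ->
  pcont (fun y => g (x +i* y)%C) (y0 - delta) (y0 + delta).
Proof.
move=> xd; apply: ccont_vpcont => y yd; apply: (derivative_cont H).
exact: square_in_disc zd xd yd.
Qed.

Lemma within_continuous_sqr (f : R -> R) (a b : R) :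
  {within `[a, b], continuous f} -> {within `[a, b], continuous (fun x => f x ^+ 2)}.
Proof. by move=> cf x; apply: continuousM; exact: cf. Qed.

Let side (f : R -> R[i]) (F : R -> \bar R) (a b : R) : pcont f a b ->
  measurable_fun [set: R] F -> (forall x, (0 <= F x)%E) ->
  (forall x, a <= x <= b -> F x = (cnorm (f x) ^+ 2)%:E) ->
  ((\int[mu]_(x in `[a, b]) (cnorm (f x) ^+ 2))%R%:E <= \int[mu]_x F x)%E.
Proof.
move=> cf mF F0 fF.
have ic := integrable_itv (within_continuous_sqr (pcont_cnorm cf)).
rewrite /Rintegral fineK; last exact: integrable_fin_num.
rewrite [leLHS](_ : _ = \int[mu]_(x in `[a, b]) F x)%E; last first.
  by apply: eq_integral => x; rewrite inE/= in_itv/= => /fF ->.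
by apply: ge0_subset_integral.
Qed.

Let hside (y t : R) : y0 - delta <= y <= y0 + delta -> t <= delta ->
  ((\int[mu]_(x in `[x0 - t, x0 + t]) (cnorm (g (x +i* y)%C) ^+ 2))%R%:E <=
   \int[mu]_x G (x, y))%E.
Proof.
move=> yd td; apply: side => //.
- by apply: pcontS (hline yd); lra.
- by apply: (measurableT_comp mG); exact: pair2_measurable.
- move=> x /andP[? ?]; rewrite /G patchE ifT// inE; split => /=; rewrite in_itv/=//.
  by apply/andP; split; lra.
Qed.

Let vside (x t : R) : x0 - delta <= x <= x0 + delta -> t <= delta ->
  ((\int[mu]_(y in `[y0 - t, y0 + t]) (cnorm (g (x +i* y)%C) ^+ 2))%R%:E <=
   \int[mu]_y G (x, y))%E.
Proof.
move=> xd td; apply: side => //.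
- by apply: pcontS (vline xd); lra.
- by apply: (measurableT_comp mG); exact: pair1_measurable.
- move=> y /andP[? ?]; rewrite /G patchE ifT// inE; split => /=; rewrite in_itv/=//.
  by apply/andP; split; lra.
Qed.

(* pointwise AM-GM [c <= k + c^2 / (4 k)] integrated over a segment *)
Let amgm (f : R -> R[i]) (a b k : R) : a <= b -> 0 < k -> pcont f a b ->
  \int[mu]_(x in `[a, b]) cnorm (f x) <=
  k * (b - a) + (4 * k)^-1 * \int[mu]_(x in `[a, b]) (cnorm (f x) ^+ 2).
Proof.
move=> ab k0 cf.
have c2 := within_continuous_sqr (pcont_cnorm cf).
have i2 := integrable_itv c2.
have ck : {within `[a, b], continuous (fun=> k)}.
  apply: within_continuous_itvP => x _ e e0.
  by exists 1 => // y _ _; rewrite subrr normr0.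
have ik := integrable_itv ck.
have iz : mu.-integrable `[a, b] (EFin \o (fun x => (4 * k)^-1 * cnorm (f x) ^+ 2)).
  exact: (integrableZl _ (4 * k)^-1 i2).
have -> : k * (b - a) = \int[mu]_(x in `[a, b]) k.
  rewrite Rintegral_cst//; congr (_ * _).
  have mE : mu `[a, b]%classic = (b - a)%:E.
    rewrite lebesgue_measure_itv/= lte_fin.
    by case: ltP => //= ba; rewrite (_ : b = a) ?subrr//; lra.
  by rewrite -[LHS]/(fine (b - a)%:E) -mE.
rewrite -RintegralZl// -RintegralD//; apply: le_Rintegral => //.
- exact: integrable_itv (pcont_cnorm cf).
- exact: (integrableD _ ik iz).
- move=> x _; set c := cnorm (f x).
  rewrite -subr_ge0.
  have -> : k + (4 * k)^-1 * c ^+ 2 - c = (4 * k)^-1 * (2 * k - c) ^+ 2.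
    by field; rewrite gt_eqF.
  by rewrite mulr_ge0 ?sqr_ge0// invr_ge0 mulr_ge0// ltW.
Qed.

(** Cauchy's formula and [rectint_invsub_ge] give [delta * cnorm (g z0) <= s1 + s2 + s3 + s4], the
    four integrals of the modulus over the sides; [amgm] then trades them for integrals of squares,
    which are dominated by integrals of [G] over full lines. *)
Let square_bound (t : R) : delta / 2 <= t <= delta ->
  ((delta / 8 * cnorm (g (x0 +i* y0)%C) ^+ 2)%:E <=
   (\int[mu]_x G (x, y0 - t)%R + \int[mu]_x G (x, y0 + t)%R) +
   (\int[mu]_y G (x0 + t, y)%R + \int[mu]_y G (x0 - t, y)%R))%E.
Proof.
move=> /andP[t1 t2]; have d0 := delta0; have zd' := zd.
set z0 := (x0 +i* y0)%C.
have t0 : 0 < t by apply: lt_le_trans t1; rewrite divr_gt0.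
have [g0|g0] := eqVneq (cnorm (g z0)) 0.
  rewrite g0 expr0n/= mulr0.
  by apply: adde_ge0; apply: adde_ge0; apply: integral_ge0 => *; exact: G0.
have {}g0 : 0 < cnorm (g z0) by rewrite lt0r g0 cnorm_ge0.
have xt : x0 - t <= x0 + t by lra.
have yt : y0 - t <= y0 + t by lra.
have zt : cnorm z0 + 2 * t < 1 by rewrite /z0; lra.
have sw : strictly_in (x0 - t) (x0 + t) (y0 - t) (y0 + t) z0.
  by split => /=; apply/andP; split; lra.
have Hs x y : x0 - t <= x <= x0 + t -> y0 - t <= y <= y0 + t ->
    has_cderiv h (x +i* y)%C (g (x +i* y)%C).
  by move=> xt' yt'; apply: H; exact: square_in_disc zt xt' yt'.
have z0d : disc z0 by rewrite /disc/=; lra.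
have bg : bcont g (x0 - t) (x0 + t) (y0 - t) (y0 + t).
  move=> x y /and3P[xt' yt' _]; apply: (derivative_cont H).
  exact: square_in_disc zt xt' yt'.
(* Here [g] is only known to be continuous, so continuity of the product is proved by hand instead
   of coming from [has_cderivM]. *)
have bgq : bcont (fun z => g z * (z - z0)^-1) (x0 - t) (x0 + t) (y0 - t) (y0 + t).
  move=> x y xy e e0; set z := (x +i* y)%C.
  have cg := bg x y xy; have cq := bcont_invsub sw xy.
  rewrite -/z in cg cq.
  pose A := 2 * (1 + cnorm (g z) + cnorm (z - z0)^-1).
  have := cnorm_ge0 (g z); have := cnorm_ge0 (z - z0)^-1 => a1 a2.
  have A0 : 0 < A by rewrite /A; lra.
  have e10 : 0 < Num.min 1 (e / A) by rewrite lt_min ltr01 divr_gt0.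
  have [d1 d10 H1] := cg _ e10; have [d2 d20 H2] := cq _ e10.
  exists (Num.min d1 d2); first by rewrite lt_min d10.
  move=> u; rewrite lt_min => /andP[u1 u2].
  have := H1 u u1; have := H2 u u2; rewrite !lt_min => /andP[p1 p2] /andP[p3 p4].
  have -> : g u * (u - z0)^-1 - g z * (z - z0)^-1 =
    (g u - g z) * ((u - z0)^-1 - (z - z0)^-1) + (g u - g z) * (z - z0)^-1
    + g z * ((u - z0)^-1 - (z - z0)^-1) by ring.
  apply: (le_lt_trans (cnormD _ _)).
  apply: (@le_lt_trans _ _ (cnorm (g u - g z) * cnorm ((u - z0)^-1 - (z - z0)^-1) +
    cnorm (g u - g z) * cnorm (z - z0)^-1 +
    cnorm (g z) * cnorm ((u - z0)^-1 - (z - z0)^-1))).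
    by rewrite -!cnormM lerD2r cnormD.
  apply: (@le_lt_trans _ _ (e / A * 1 + e / A * cnorm (z - z0)^-1 + cnorm (g z) * (e / A))).
    by rewrite !lerD// ler_pM ?cnorm_ge0// ltW.
  have -> : e / A * 1 + e / A * cnorm (z - z0)^-1 + cnorm (g z) * (e / A) = e / 2.
    by rewrite /A; field; rewrite gt_eqF//; lra.
  lra.
have := cauchy_derivative sw (fun x y a b => ex_intro _ _ (Hs x y a b)) (H z0d).
rewrite (cauchy_by_parts sw Hs bg bgq) => E.
have A4 := rectint_invsub_ge x0 y0 t0; rewrite -/z0 in A4.
have B1 : cnorm (rectint (fun z => g z * (z - z0)^-1) (x0 - t) (x0 + t) (y0 - t) (y0 + t))
    <= t^-1 * bdnorm g (x0 - t) (x0 + t) (y0 - t) (y0 + t).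
  apply: rectint_le_mul => // x y xy.
  rewrite cnormM cnormV mulrC ler_wpM2r ?cnorm_ge0// lef_pV2 ?posrE//.
    exact: onbd_square_dist.
  exact: lt_le_trans t0 (onbd_square_dist t0 xy).
rewrite -E cnormM in B1.
have {A4 E}B2 : 4 * cnorm (g z0) <= 2 / delta * bdnorm g (x0 - t) (x0 + t) (y0 - t) (y0 + t).
  apply: (@le_trans _ _ (t^-1 * bdnorm g (x0 - t) (x0 + t) (y0 - t) (y0 + t))).
    by apply: le_trans B1; rewrite mulrC ler_wpM2l ?cnorm_ge0.
  apply: ler_wpM2r.
    by rewrite mulr_ge0// !addr_ge0//; apply: Rintegral_ge0 => *; exact: cnorm_ge0.
  have -> : 2 / delta = (delta / 2)^-1 by rewrite invf_div.
  by rewrite lef_pV2 ?posrE ?divr_gt0.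
(* With this [k] the linear term [8 * (k * delta)] is half of [delta * cnorm (g z0)] and can be
   absorbed on the left. *)
pose k := cnorm (g z0) / 16.
have k0 : 0 < k by rewrite divr_gt0.
have [p1 p2 p3 p4] := bcont_pcont xt yt bg.
have m1 := amgm xt k0 p1; have m2 := amgm xt k0 p2.
have m3 := amgm yt k0 p3; have m4 := amgm yt k0 p4.
have yd1 : y0 - delta <= y0 - t <= y0 + delta by apply/andP; split; lra.
have yd2 : y0 - delta <= y0 + t <= y0 + delta by apply/andP; split; lra.
have xd1 : x0 - delta <= x0 - t <= x0 + delta by apply/andP; split; lra.
have xd2 : x0 - delta <= x0 + t <= x0 + delta by apply/andP; split; lra.
apply: le_trans (leeD (leeD (hside yd1 t2) (hside yd2 t2)) (leeD (vside xd2 t2) (vside xd1 t2))).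
rewrite -!EFinD lee_fin.
move: m1 m2 m3 m4 B2; rewrite /bdnorm.
set s1 := \int[mu]_(x in _) cnorm (g (x +i* (y0 - t))%C).
set s2 := \int[mu]_(x in _) cnorm (g (x +i* (y0 + t))%C).
set s3 := \int[mu]_(x in _) cnorm (g ((x0 + t) +i* x)%C).
set s4 := \int[mu]_(x in _) cnorm (g ((x0 - t) +i* x)%C).
set S1 := \int[mu]_(x in _) (cnorm (g (x +i* (y0 - t))%C) ^+ 2).
set S2 := \int[mu]_(x in _) (cnorm (g (x +i* (y0 + t))%C) ^+ 2).
set S3 := \int[mu]_(x in _) (cnorm (g ((x0 + t) +i* x)%C) ^+ 2).
set S4 := \int[mu]_(x in _) (cnorm (g ((x0 - t) +i* x)%C) ^+ 2).
have -> : x0 + t - (x0 - t) = 2 * t by ring.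
have -> : y0 + t - (y0 - t) = 2 * t by ring.
move=> m1 m2 m3 m4 B2.
have kt : k * (2 * t) <= k * (2 * delta) by rewrite ler_wpM2l ?(ltW k0)//; lra.
have B3 : cnorm (g z0) <= delta^-1 * (s1 + s2 + s3 + s4).
  have E : 2 / delta * (2 * (s1 + s2 + s3 + s4)) = 4 * (delta^-1 * (s1 + s2 + s3 + s4)).
    by field; rewrite gt_eqF.
  by rewrite E in B2; lra.
have B4 : delta * cnorm (g z0) <= s1 + s2 + s3 + s4 by rewrite -ler_pdivlMl.
have B5 : delta * cnorm (g z0) <= 8 * (k * delta) + (4 * k)^-1 * (S1 + S2 + S3 + S4).
  by rewrite !mulrDr; lra.
have B6 : delta * cnorm (g z0) * k <= 8 * (k * delta) * k + (S1 + S2 + S3 + S4) / 4.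
  have E : 8 * (k * delta) * k + (S1 + S2 + S3 + S4) / 4 =
    (8 * (k * delta) + (4 * k)^-1 * (S1 + S2 + S3 + S4)) * k.
    by field; rewrite gt_eqF.
  by rewrite E ler_wpM2r// ltW.
have E1 : delta * cnorm (g z0) * k = delta * cnorm (g z0) ^+ 2 / 16.
  by rewrite /k; field.
have E2 : 8 * (k * delta) * k = delta * cnorm (g z0) ^+ 2 / 32.
  by rewrite /k; field.
rewrite E1 E2 in B6; lra.
Qed.

(** Integrate [square_bound] over [t] in [[delta / 2, delta]]: each of the four families of sides
    sweeps out at most the whole area integral [I]. Hence [delta / 8 * (delta / 2) * cnorm (g z0) ^+
    2 <= 4 * I], which explains the 64. *)
Lemma area_bound :
  ((delta ^+ 2 / 64 * cnorm (g (x0 +i* y0)%C) ^+ 2)%:E <=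
   \int[(mu \x mu)%E]_(p in box) (cnorm (g (toC p)) ^+ 2)%:E)%E.
Proof.
rewrite integral_mkcond -/G.
set I := (X in (_ <= X)%E).
have d0 := delta0; pose T : set R := `[delta / 2, delta]%classic.
have md : measurable T by exact: measurable_itv.
have mH : measurable_fun [set: R] (fun y => \int[mu]_x G (x, y))%E.
  exact: (measurable_fun_fubini_tonelli_G (m1 := mu) G mG G0).
have mV : measurable_fun [set: R] (fun x => \int[mu]_y G (x, y))%E.
  exact: (measurable_fun_fubini_tonelli_F (m2 := mu) G mG G0).
have IH : I = (\int[mu]_y \int[mu]_x G (x, y))%E by rewrite /I fubini_tonelli2.
have IV : I = (\int[mu]_x \int[mu]_y G (x, y))%E by rewrite /I fubini_tonelli1.
have aff (F : R -> \bar R) (s c : R) : (s = 1 \/ s = -1) ->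
    measurable_fun [set: R] F -> (forall x, 0 <= F x)%E ->
    measurable_fun [set: R] (fun x => F (s * x + c)).
  move=> s1 mF F0; apply: (measurableT_comp mF).
  by apply: measurable_funD => //; apply: measurable_funM.
have sub (F : R -> \bar R) (s c : R) : (s = 1 \/ s = -1) ->
    measurable_fun [set: R] F -> (forall x, 0 <= F x)%E ->
    (\int[mu]_(t in T) F (s * t + c)%R <= \int[mu]_x F x)%E.
  move=> s1 mF F0; rewrite -(ge0_integral_affine c s1 mF F0).
  by apply: ge0_subset_integral => //; exact: aff.
have H0 y : (0 <= \int[mu]_x G (x, y))%E by exact: integral_ge0.
have V0 x : (0 <= \int[mu]_y G (x, y))%E by exact: integral_ge0.
pose H1 t := (\int[mu]_x G (x, ((-1) * t + y0)%R))%E.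
pose H2 t := (\int[mu]_x G (x, (1 * t + y0)%R))%E.
pose V1 t := (\int[mu]_y G ((1 * t + x0)%R, y))%E.
pose V2 t := (\int[mu]_y G (((-1) * t + x0)%R, y))%E.
have s1 := sub _ (-1) y0 (or_intror erefl) mH H0.
have s2 := sub _ 1 y0 (or_introl erefl) mH H0.
have s3 := sub _ 1 x0 (or_introl erefl) mV V0.
have s4 := sub _ (-1) x0 (or_intror erefl) mV V0.
have m1 := aff _ (-1) y0 (or_intror erefl) mH H0.
have m2 := aff _ 1 y0 (or_introl erefl) mH H0.
have m3 := aff _ 1 x0 (or_introl erefl) mV V0.
have m4 := aff _ (-1) x0 (or_intror erefl) mV V0.
rewrite -/H1 -/H2 -/V1 -/V2 -?IH -?IV in s1 s2 s3 s4 m1 m2 m3 m4.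
have key : ((delta / 8 * cnorm (g (x0 +i* y0)%C) ^+ 2 * (delta / 2))%:E <= I + I + (I + I))%E.
  apply: (@le_trans _ _ (\int[mu]_(t in T)
    (delta / 8 * cnorm (g (x0 +i* y0)%C) ^+ 2)%:E)%E).
    have muT : mu T = (delta / 2)%:E.
      rewrite /T lebesgue_measure_itv/= lte_fin ifT; last by lra.
      by rewrite -EFinD; congr EFin; field.
    by rewrite integral_cst// EFinM -muT.
  apply: (@le_trans _ _ (\int[mu]_(t in T)
    ((H1 t + H2 t) + (V1 t + V2 t)))%E).
    apply: ge0_le_integral => //.
    - by move=> t _; rewrite lee_fin mulr_ge0 ?sqr_ge0// divr_ge0// ltW.
    - apply: measurable_funTS; apply: emeasurable_funD;
        by apply: emeasurable_funD.
    - move=> t; rewrite /T/= in_itv/= => td.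
      rewrite /H1 /H2 /V1 /V2 !mulN1r !mul1r [- t + y0]addrC [- t + x0]addrC.
      rewrite [t + y0]addrC [t + x0]addrC.
      exact: square_bound.
  have ge (A B : R -> \bar R) : (forall x, 0 <= A x)%E -> (forall x, 0 <= B x)%E ->
    measurable_fun [set: R] A -> measurable_fun [set: R] B ->
    (\int[mu]_(t in T) (A t + B t) =
     \int[mu]_(t in T) A t + \int[mu]_(t in T) B t)%E.
    by move=> A0 B0 mA mB; rewrite ge0_integralD//; exact: measurable_funTS.
  rewrite (ge (fun t => H1 t + H2 t)%E (fun t => V1 t + V2 t)%E).
  - have -> := ge H1 H2 (fun=> H0 _) (fun=> H0 _) m1 m2.
    have -> := ge V1 V2 (fun=> V0 _) (fun=> V0 _) m3 m4.
    exact: (leeD (leeD s1 s2) (leeD s3 s4)).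
  - by move=> x; apply: adde_ge0; exact: H0.
  - by move=> x; apply: adde_ge0; exact: V0.
  - exact: emeasurable_funD.
  - exact: emeasurable_funD.
have I0 : (0 <= I)%E by rewrite /I; exact: integral_ge0.
case: I I0 key {IH IV s1 s2 s3 s4} => [r| |]//= _.
  rewrite -!EFinD !lee_fin => k1.
  have -> : delta ^+ 2 / 64 * cnorm (g (x0 +i* y0)%C) ^+ 2 =
    (delta / 8 * cnorm (g (x0 +i* y0)%C) ^+ 2 * (delta / 2)) / 4 by field.
  lra.
by move=> _; rewrite leey.
Qed.

End AreaBound.

(** The fundamental theorem of calculus along the radius from [0] to [z]; the factor 2 is that of
    [cint_le]. *)
Lemma segment_bound h g (z : R[i]) (M : R) :
  (forall z, disc z -> has_cderiv h z (g z)) -> disc z ->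
  (forall u : R[i], cnorm u <= cnorm z -> cnorm (g u) <= M) ->
  cnorm (h z - h 0) <= 2 * (M * cnorm z).
Proof.
move=> H z1 gM.
have tz (t : R) : 0 <= t <= 1 -> cnorm ((t +i* 0)%C * z) <= cnorm z.
  move=> /andP[t0 t1]; rewrite cnormM (_ : (t +i* 0)%C = t%:C%C)// cnorm_real ger0_norm//.
  by rewrite ler_piMl ?cnorm_ge0.
have dz (t : R) : 0 <= t <= 1 -> disc ((t +i* 0)%C * z).
  by move=> t01; exact: le_lt_trans (tz t t01) z1.
have lin (u : R[i]) : has_cderiv (fun u => u * z) u z.
  have := has_cderivM (has_cderiv_id u) (has_cderiv_cst z u).
  by rewrite mul1r mulr0 addr0.
have D (t : R) : 0 <= t <= 1 ->
    has_cderiv (h \o (fun u => u * z)) (t +i* 0)%C (g ((t +i* 0)%C * z) * z).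
  by move=> t01; apply: has_cderiv_comp (lin _) _; apply: H; exact: dz.
have cg : pcont (fun t => g ((t +i* 0)%C * z) * z) 0 1.
  apply: (@ccont_hpcont _ (fun u => g (u * z) * z)) => t t01 e e0.
  have k0 : 0 < 1 + cnorm z by have := cnorm_ge0 z; lra.
  have ek : 0 < e / (1 + cnorm z) by rewrite divr_gt0.
  have [d d0 Hd] := derivative_cont H (dz t t01) ek.
  have [d' d'0 Hd'] := has_cderiv_cont (lin (t +i* 0)%C) d0.
  exists d' => // w wd; rewrite -mulrBl cnormM.
  have := Hd _ (Hd' w wd); rewrite ltr_pdivlMr// => hh.
  by apply: le_lt_trans hh; rewrite ler_wpM2l ?cnorm_ge0//; lra.
have := @cint_FTC _ (fun t => h ((t +i* 0)%C * z)) _ 0 1 ler01 _ cg.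
rewrite (_ : (1 +i* 0)%C * z = z) ?mul1r// (_ : (0 +i* 0)%C * z = 0) ?mul0r// => <-.
  apply: (le_trans (cint_le (M := M * cnorm z) ler01 cg _)).
    by move=> t t01; rewrite cnormM ler_wpM2r ?cnorm_ge0// gM// tz.
  by rewrite subr0 mulr1.
move=> t t01; apply: (@has_cderiv_hline _ (h \o (fun u => u * z))); exact: D.
Qed.

Lemma weight_lower_bound (omega : R -> R) (s : R) : admissible_weight omega ->
  0 <= s < 1 -> exists2 m : R, 0 < m & forall r : R, 0 <= r <= s -> m <= omega r.
Proof.
move=> [c p _] /andP[s0 s1].
have cs : {within `[0, s], continuous omega}.
  apply: continuous_subspaceW c => x /=; rewrite in_itv/= => /andP[? ?].
  by apply/andP; split; lra.
have [x xs Hx] := EVT_min s0 cs.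
exists (omega x).
  by move: xs; rewrite in_itv/= => /andP[? ?]; apply: p; apply/andP; split; lra.
by move=> r rs; apply: Hx; rewrite in_itv.
Qed.

Lemma measurable_weight (omega : R -> R) : admissible_weight omega ->
  measurable_fun [set p : R * R | (cnorm (toC p) < 1)%R]
    (fun p => omega (cnorm (toC p))).
Proof.
move=> [c _ _]; apply: (@measurable_fun_cont _ (fun z => omega (cnorm z))).
move=> z z1 e e0.
have zin : [set r : R | 0 <= r < 1] (cnorm z) by apply/andP; split; [exact: cnorm_ge0|].
have /cvgrPdist_lt/(_ e e0) := (subspace_continuousP _ _).1 c (cnorm z) zin.
move=> /nbhs_ballP[d /= d0 Hd].
exists (Num.min d (1 - cnorm z)); first by rewrite lt_min d0 subr_gt0.
move=> u; rewrite lt_min => /andP[u1 u2].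
have := cnorm_dist u z; have := cnorm_dist z u; rewrite (cnormB z) => k1 k2.
rewrite distrC; apply: Hd; last by apply/andP; split; [exact: cnorm_ge0|lra].
by rewrite /ball/= ltr_norml; apply/andP; split; lra.
Qed.

(** The bound is established for each derivative [g] in the infimum that defines [Hnorm2]; an empty
    infimum is [+oo]. The area bound controls [g] on [|u| <= s], and integration along a radius then
    controls [h]. *)
Lemma point_evaluation (omega : R -> R) (s : R) : admissible_weight omega ->
  0 <= s < 1 -> exists2 c : R, 0 < c & forall h (z : R[i]), cnorm z <= s ->
    ((c * cnorm (h z) ^+ 2)%:E <= Hnorm2 omega h)%E.
Proof.
move=> homega s01; have [s0 s1] := andP s01.
(* Squares of half side [delta] centred in [|z| <= s] stay in [|z| <= s + 2 * delta < 1], where the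
   weight has a positive lower bound [m]. *)
pose delta := (1 - s) / 8.
have delta0 : 0 < delta by rewrite divr_gt0// subr_gt0.
have s2 : 0 <= s + 2 * delta < 1 by rewrite /delta; apply/andP; split; lra.
have [m m0 Hm] := weight_lower_bound homega s2.
pose M1 := 64 / (delta ^+ 2 * m).
have M10 : 0 < M1 by rewrite divr_gt0// mulr_gt0// exprn_gt0.
have pi0 := @pi_gt0 R.
(* The end result is [cnorm (h z) ^+ 2 <= 2 * cnorm (h 0) ^+ 2 + 8 * (M1 * j)], to be compared with
   [cnorm (h 0) ^+ 2 + pi^-1 * j]: one entry of the minimum for each term. *)
pose c := Num.min (1 / 2) (8 * M1 * pi)^-1.
have MP0 : 0 < 8 * M1 * pi by apply: mulr_gt0 => //; exact: mulr_gt0.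
have c0 : 0 < c by rewrite lt_min divr_gt0//= invr_gt0.
exists c => // h z zs; apply: le_ereal_inf_tmp => _ [g Hg <-].
have mD : measurable [set p : R * R | (cnorm (toC p) < 1)%R].
  by apply: popen_measurable; exact: popen_disc.
have mgo : measurable_fun [set p : R * R | (cnorm (toC p) < 1)%R]
    (fun p => (cnorm (g (toC p)) ^+ 2 * omega (cnorm (toC p)))%:E).
  apply/measurable_EFinP; apply: measurable_funM; first exact: (measurable_cnorm_sqr Hg).
  exact: measurable_weight.
set J := integral _ _ _.
have gE (u : R[i]) : cnorm u <= s -> ((cnorm (g u) ^+ 2)%:E <= M1%:E * J)%E.
  case: u => x0 y0 us.
  have zd : cnorm (x0 +i* y0)%C + 2 * delta < 1 by rewrite /delta; lra.
  have := area_bound Hg delta0 zd.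
  set I := (X in (_ <= X)%E) => aI.
  have IJ : (m%:E * I <= J)%E.
    rewrite /I -ge0_integralZl_EFin//.
    - apply: (@le_trans _ _ (\int[(mu \x mu)%E]_(p in box x0 y0 delta)
        (cnorm (g (toC p)) ^+ 2 * omega (cnorm (toC p)))%:E)%E).
        apply: ge0_le_integral => //.
        - by exact: measurable_box.
        - by move=> p _; rewrite -EFinM lee_fin mulr_ge0 ?sqr_ge0 ?(ltW m0).
        - apply/measurable_EFinP; apply: measurable_funM => //.
          apply: measurable_funS (measurable_cnorm_sqr Hg) => //.
          by move=> p /(box_disc zd).
        - apply: measurable_funS mgo => //.
          by move=> p /(box_disc zd).
        - move=> p pb; rewrite -EFinM lee_fin mulrC ler_wpM2l ?sqr_ge0// Hm//.
          rewrite cnorm_ge0/=; case: p pb => x y [/=]; rewrite !in_itv/=.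
          move=> /andP[? ?] /andP[? ?].
          have := cnorm_dist (x +i* y)%C (x0 +i* y0)%C.
          have := cnorm_le_ReIm ((x +i* y)%C - (x0 +i* y0)%C); rewrite complexB/=.
          have : `|x - x0| <= delta by rewrite ler_norml; apply/andP; split; lra.
          have : `|y - y0| <= delta by rewrite ler_norml; apply/andP; split; lra.
          rewrite /toC/=; lra.
      apply: ge0_subset_integral => //.
      - exact: measurable_box.
      - move=> p p1; rewrite lee_fin mulr_ge0 ?sqr_ge0// ltW//.
        by case: homega => _ + _; apply; rewrite cnorm_ge0.
      - by move=> p /(box_disc zd).
    - exact: measurable_box.
    - by move=> p _; rewrite lee_fin sqr_ge0.
    - apply/measurable_EFinP; apply: measurable_funS (measurable_cnorm_sqr Hg) => //.
      by move=> p /(box_disc zd).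
    - exact: ltW.
  move: aI IJ; case: I => [i| |]//; last first.
    by rewrite gt0_muley ?lte_fin// => _; rewrite leye_eq => /eqP ->;
      rewrite gt0_muley ?leey// lte_fin.
  rewrite lee_fin => aI.
  case: J => [j| |]//; last by rewrite gt0_muley ?leey// lte_fin.
  rewrite -!EFinM !lee_fin => ij.
  have e1 : m * (delta ^+ 2 / 64 * cnorm (g (x0 +i* y0)%C) ^+ 2) <= j.
    by apply: le_trans ij; rewrite ler_wpM2l// ltW.
  rewrite /M1 mulrAC ler_pdivlMr ?mulr_gt0 ?exprn_gt0//; lra.
have J0 : (0 <= J)%E.
  apply: integral_ge0 => p p1; rewrite lee_fin mulr_ge0 ?sqr_ge0// ltW//.
  by case: homega => _ + _; apply; rewrite cnorm_ge0.
move: J J0 gE => [j| |]// j0 gE; last by rewrite gt0_muley ?lte_fin ?invr_gt0// addey ?leey.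
rewrite -EFinM -EFinD lee_fin; rewrite lee_fin in j0.
have Mj0 : 0 <= M1 * j by rewrite mulr_ge0// ltW.
have gM (u : R[i]) : cnorm u <= cnorm z -> cnorm (g u) <= Num.sqrt (M1 * j).
  move=> uz; have := gE u (le_trans uz zs); rewrite -EFinM lee_fin => gu.
  by rewrite -(ger0_norm (cnorm_ge0 (g u))) -sqrtr_sqr ler_wsqrtr.
have z1 : disc z by rewrite /disc/=; lra.
have sb := segment_bound Hg z1 gM.
have sq := sqr_sqrtr Mj0; have sq0 := sqrtr_ge0 (M1 * j).
set q := Num.sqrt (M1 * j) in sb sq sq0.
have hb : cnorm (h z) <= cnorm (h 0) + 2 * q.
  have := cnorm_dist (h z) (h 0); have := ler_wpM2l sq0 (ltW z1).
  by rewrite mulr1; lra.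
have hb2 : cnorm (h z) ^+ 2 <= 2 * cnorm (h 0) ^+ 2 + 8 * (M1 * j).
  rewrite -sq; have a0 := cnorm_ge0 (h 0); have b0 := cnorm_ge0 (h z).
  apply: (@le_trans _ _ ((cnorm (h 0) + 2 * q) ^+ 2)).
    by rewrite ler_pXn2r ?nnegrE//; lra.
  rewrite -subr_ge0 (_ : _ - _ = (cnorm (h 0) - 2 * q) ^+ 2) ?sqr_ge0//; ring.
have c1 : c <= 1 / 2 by rewrite ge_min lexx.
have c2 : c * (8 * M1 * pi) <= 1.
  by rewrite -ler_pdivlMr// mul1r ge_min lexx orbT.
apply: (@le_trans _ _ (c * (2 * cnorm (h 0) ^+ 2 + 8 * (M1 * j)))).
  by rewrite ler_wpM2l// ltW.
rewrite mulrDr lerD//.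
  have := ler_wpM2r (sqr_ge0 (cnorm (h 0))) c1; lra.
rewrite ler_pdivlMl//.
have -> : pi * (c * (8 * (M1 * j))) = c * (8 * M1 * pi) * j by ring.
by rewrite ler_piMl.
Qed.

End PointEvaluation.

(** * Integrability of the radial weight over the disc *)

Section WeightArea.
Context {R : realType}.
Local Notation mu := (@lebesgue_measure R).
Variable omega : R -> R.
Hypothesis homega : admissible_weight omega.

Let W : \bar R := (\int[mu]_(r in [set r : R | 0 <= r < 1]%R) (omega r)%:E)%E.

Lemma measurable_unit_itv : measurable [set r : R | 0 <= r < 1].
Proof.
rewrite (_ : [set r : R | 0 <= r < 1] = `[0, 1[%classic).
  exact: measurable_itv.
by apply/seteqP; split => r /=; rewrite in_itv.
Qed.

Let W0 : (0 <= W)%E.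
Proof.
apply: integral_ge0 => r r01; rewrite lee_fin ltW//; case: homega => _ + _; exact.
Qed.

Let Wfin : (W < +oo)%E.
Proof.
have [_ p /integrableP[_]] := homega; apply: le_lt_trans; rewrite /W.
rewrite le_eqVlt; apply/orP; left; apply/eqP; apply: eq_integral => r.
by rewrite inE => r01; rewrite gee0_abs// lee_fin ltW// p.
Qed.

(* The substitution [u = sqrt (x^2 + y^2)] has derivative at least [1/4]
   where [1/4 <= x] and [u <= 1]. *)
Lemma weight_line (y b : R) : 1 / 4 <= b -> b ^+ 2 + y ^+ 2 < 1 ->
  (\int[mu]_(x in `[(1 / 4)%R, b]) (omega (Num.sqrt (x ^+ 2 + y ^+ 2)%R))%:E
    <= 4%:E * W)%E.
Proof.
move=> b4 by1.
pose F (x : R) : R := Num.sqrt (x ^+ 2 + y ^+ 2).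
pose fp (x : R) : R := x / F x.
have [c p _] := homega.
have y2 := sqr_ge0 y.
have r0 (x : R) : 0 < x -> 0 < x ^+ 2 + y ^+ 2 by move=> x0; rewrite ltr_wpDr ?exprn_gt0.
have F0 (x : R) : 0 < x -> 0 < F x by move=> x0; rewrite sqrtr_gt0 r0.
have dF (x : R) : 0 < x -> is_derive x (1 : R) F (fp x).
  move=> x0; have h1 : is_derive x (1 : R) (fun x : R => x ^+ 2 + y ^+ 2) (2 * x).
    by apply: is_derive_eq; rewrite /GRing.scale/=; ring.
  have h2 := is_derive1_sqrt (r0 x x0).
  have := @is_derive1_comp _ (@Num.sqrt R) (fun x : R => x ^+ 2 + y ^+ 2) x _ _ h2 h1.
  move=> h3; apply: is_derive_eq h3 _.
  by rewrite /fp /F; field; rewrite gt_eqF// sqrtr_gt0 r0.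
have F'E (x : R) : 0 < x -> (derive1 F) x = fp x.
  by move=> x0; rewrite derive1E; have [_ ->] := dF x x0.
have cF (x : R) : 0 < x -> {for x, continuous F}.
  move=> x0; apply: differentiable_continuous; apply/derivable1_diffP.
  by have [] := dF x x0.
have cfp (x : R) : 0 < x -> {for x, continuous fp}.
  move=> x0; apply: continuousM => //; apply: continuousV; last exact: cF.
  by rewrite gt_eqF// F0.
have cF' (x : R) : 0 < x -> {for x, continuous (derive1 F)}.
  move=> x0; rewrite /prop_for /continuous_at F'E//.
  have : fp y @[y --> x] --> fp x by exact: cfp.
  apply: cvg_trans; apply: near_eq_cvg; near=> z; rewrite F'E//.
  by near: z; exact: lt_nbhsr.
have mono : {in `[1 / 4, b] &, {homo F : x y / x < y}}.
  move=> u v; rewrite !in_itv/= => /andP[u1 u2] /andP[v1 v2] uv.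
  have u0 : 0 < u by lra.
  rewrite ltr_sqrt ?r0//; last by lra.
  by rewrite ltrD2r ltr_pXn2r ?nnegrE//; lra.
have b0 : 0 < b by lra.
have cG : {within `[F (1 / 4), F b], continuous omega}.
  apply: continuous_subspaceW c => x /=; rewrite in_itv/= => /andP[x1 x2].
  apply/andP; split; first by apply: le_trans x1; exact: sqrtr_ge0.
  by apply: (le_lt_trans x2); rewrite -sqrtr1 ltr_sqrt.
have q0 : 0 < (1 / 4 : R) by lra.
have E : (\int[mu]_(x in `[F (1 / 4)%R, F b]) (omega x)%:E =
  \int[mu]_(x in `[(1 / 4)%R, b]) (((omega \o F) * (derive1 F)) x)%:E)%E.
  apply: (integration_by_substitution_increasing b4 mono) => //.
  - by move=> x; rewrite in_itv/= => /andP[? ?]; apply: cF'; lra.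
  - by apply/cvg_ex; exists ((derive1 F) (1 / 4)); apply: cvg_at_right_filter; exact: cF'.
  - by apply/cvg_ex; exists ((derive1 F) b); apply: cvg_at_left_filter; exact: cF'.
  - split.
    + move=> x; rewrite in_itv/= => /andP[? ?]; have x0 : 0 < x by lra.
      by have [] := dF x x0.
    + by apply: cvg_at_right_filter; exact: cF.
    + by apply: cvg_at_left_filter; exact: cF.
have FE (x : R) : 1 / 4 <= x <= b -> 0 <= F x < 1.
  move=> /andP[x1 x2]; rewrite sqrtr_ge0/= -sqrtr1 ltr_sqrt//.
  by apply: le_lt_trans by1; rewrite lerD2r ler_pXn2r ?nnegrE//; lra.
have moF : measurable_fun `[1 / 4, b] (fun x => omega (F x)).
  pose g (x : R) := (x, y).
  have mD : measurable [set p : R * R | (cnorm (toC p) < 1)%R].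
    by apply: popen_measurable; exact: popen_disc.
  apply: (measurable_comp (F := [set p : R * R | (cnorm (toC p) < 1)%R])
    (g := g) (f := fun p => omega (cnorm (toC p)))) => //.
  - by move=> _ [x /= + <-]; rewrite in_itv/= => /FE/andP[_].
  - exact: measurable_weight.
  - by apply: measurable_funTS; exact: pair2_measurable.
have mfp : measurable_fun `[1 / 4, b] fp.
  apply: subspace_continuous_measurable_fun => //.
  apply: continuous_in_subspaceT => x; rewrite inE/= in_itv/= => /andP[? ?].
  by apply: cfp; lra.
have fp4 (x : R) : 1 / 4 <= x <= b -> 1 <= 4 * fp x.
  move=> xb; have /andP[x1 x2] := xb; have /andP[_ Fx1] := FE x xb.
  have x0 : 0 < x by lra.
  by rewrite /fp mulrA ler_pdivlMr ?F0// mul1r; lra.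
apply: (@le_trans _ _ (\int[mu]_(x in `[(1 / 4)%R, b])
    (4%:E * (((omega \o F) * (derive1 F)) x)%:E))%E).
  have -> : (\int[mu]_(x in `[(1 / 4)%R, b]) (4%:E * (((omega \o F) * (derive1 F)) x)%:E) =
    \int[mu]_(x in `[(1 / 4)%R, b]) (4 * (omega (F x) * fp x))%:E)%E.
    apply: eq_integral => x; rewrite inE/= in_itv/= => /andP[x1 x2].
    have x0 : 0 < x by lra.
    by rewrite -EFinM; congr EFin; congr (_ * _); rewrite -(F'E x x0).
  apply: ge0_le_integral => //.
  - by move=> x /=; rewrite in_itv/= => /FE Fx; rewrite lee_fin ltW// p.
  - exact/measurable_EFinP.
  - apply/measurable_EFinP; apply: measurable_funM => //; exact: measurable_funM.
  - move=> x /=; rewrite in_itv/= => xb; rewrite lee_fin mulrCA ler_peMr//.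
      by rewrite ltW// p// FE.
    exact: fp4.
rewrite ge0_integralZl_EFin//; first last.
- apply/measurable_EFinP.
  apply: (eq_measurable_fun (fun x => omega (F x) * fp x)).
    move=> x; rewrite inE/= in_itv/= => /andP[x1 x2].
    have x0 : 0 < x by lra.
    by rewrite -(F'E x x0).
  exact: measurable_funM.
- move=> x /=; rewrite in_itv/= => xb; have /andP[x1 x2] := xb.
  have x0 : 0 < x by lra.
  rewrite lee_fin mulr_ge0//; first by rewrite ltW// p// FE.
  by rewrite F'E// divr_ge0 ?ltW// F0.
rewrite -E; apply: lee_wpmul2l => //; apply: ge0_subset_integral => //.
- exact: measurable_unit_itv.
- by case: homega => _ _ /integrableP[].
- by move=> r r01; rewrite lee_fin ltW// p.
- move=> x /=; rewrite in_itv/= => /andP[x1 x2].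
  apply/andP; split; first by apply: le_trans x1; exact: sqrtr_ge0.
  by apply: (le_lt_trans x2); rewrite -sqrtr1 ltr_sqrt.
Unshelve. all: by end_near.
Qed.

Let f (p : R * R) : \bar R := (omega (cnorm (toC p)))%:E.

(** Staying at [1 / 4 <= x] keeps the derivative [x / sqrt (x ^+ 2 + y ^+ 2)] of the radius along
    horizontal lines away from zero; reflections and the swap of coordinates carry this region
    around the disc. *)
Let quarter (rho : R) : set (R * R) :=
  [set p | (cnorm (toC p) <= rho)%R] `&` [set p | 1 / 4 <= p.1].

Lemma measurable_closed_disc (rho : R) :
  measurable [set p : R * R | (cnorm (toC p) <= rho)%R].
Proof.
rewrite -[X in measurable X]setCK; apply: measurableC; apply: popen_measurable.
exact: popen_closed_discC.
Qed.

Let mquarter rho : measurable (quarter rho).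
Proof.
apply: measurableI; first exact: measurable_closed_disc.
rewrite (_ : [set p : R * R | 1 / 4 <= p.1] = `[1 / 4, +oo[%classic `*` setT).
  by apply: measurableX.
by apply/seteqP; split => p /=; rewrite in_itv/= andbT; [split|case].
Qed.

Let f0 p : (cnorm (toC p) < 1)%R -> (0 <= f p)%E.
Proof.
move=> p1; rewrite lee_fin ltW//; case: homega => _ + _; apply.
by rewrite cnorm_ge0.
Qed.

Let mf : measurable_fun [set p : R * R | (cnorm (toC p) < 1)%R] f.
Proof. by apply/measurable_EFinP; exact: measurable_weight. Qed.

Let Q rho := f \_ (quarter rho).

Let Q0 rho p : rho < 1 -> (0 <= Q rho p)%E.
Proof.
move=> r1; rewrite /Q patchE; case: ifP => //; rewrite inE => -[p1 _].
by apply: f0; exact: le_lt_trans p1 r1.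
Qed.

Let mQ rho : rho < 1 -> measurable_fun setT (Q rho).
Proof.
move=> r1; apply/(measurable_restrictT _ (mquarter rho)).
apply: measurable_funS mf; first by apply: popen_measurable; exact: popen_disc.
by move=> p [/= p1 _]; exact: le_lt_trans p1 r1.
Qed.

(** The section at height [y] is the segment [[1 / 4, b]] with [b = sqrt (rho ^+ 2 - y ^+ 2)],
    possibly empty, to which [weight_line] applies. *)
Let Qline (rho y : R) : rho < 1 ->
  (\int[mu]_x Q rho (x, y) <= ((4%:E * W) * (\1_`[-1, 1] y)%:E))%E.
Proof.
move=> r1.
have Q00 : (forall x, Q rho (x, y) = 0%E) ->
    (\int[mu]_x Q rho (x, y) <= ((4%:E * W) * (\1_`[-1, 1] y)%:E))%E.
  by move=> h; rewrite integral0_eq// mule_ge0 ?mule_ge0// lee_fin.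
have [r0|r0] := ltP rho 0.
  apply: Q00 => x; rewrite /Q patchE memNset// => -[/= h _].
  by have := cnorm_ge0 (toC (x, y)); lra.
have [yr|yr] := ltP (rho ^+ 2) (y ^+ 2).
  apply: Q00 => x; rewrite /Q patchE memNset// => -[/= h _]; move: yr; apply/negP.
  rewrite -leNgt -(@ler_sqrt _ (y ^+ 2)) ?sqr_ge0// sqrtr_sqr.
  rewrite [leRHS]sqrtr_sqr (ger0_norm r0).
  exact: le_trans (ler_Im_cnorm _) h.
have y1 : -1 <= y <= 1.
  rewrite -ler_norml -sqrtr_sqr -[leRHS]sqrtr1 ler_wsqrtr//.
  by apply: (le_trans yr); rewrite expr_le1// ltW.
rewrite indicE mem_set//= mule1.
pose b := Num.sqrt (rho ^+ 2 - y ^+ 2).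
have b2 : b ^+ 2 = rho ^+ 2 - y ^+ 2 by rewrite sqr_sqrtr// subr_ge0.
have b0 : 0 <= b by exact: sqrtr_ge0.
have QE x : Q rho (x, y) =
    ((fun x => (omega (Num.sqrt (x ^+ 2 + y ^+ 2)))%:E) \_ `[1 / 4, b]) x.
  rewrite /Q !patchE; congr (if _ then _ else _).
  apply/idP/idP; rewrite !inE.
    move=> [/= h x4]; rewrite in_itv/= x4/= -(ger0_norm b0) -(@ger0_norm _ x); last by lra.
    rewrite -!sqrtr_sqr ler_sqrt ?sqr_ge0// b2 lerBrDr.
    move: h; rewrite -{1}(ger0_norm r0) -sqrtr_sqr /cnorm/= ler_sqrt ?sqr_ge0//.
  rewrite /= in_itv/= => /andP[x4 xb]; split => //=.
  rewrite -(ger0_norm r0) -sqrtr_sqr /cnorm/= ler_wsqrtr//.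
  rewrite -lerBrDr -b2 ler_pXn2r ?nnegrE//; lra.
under eq_integral do rewrite QE.
rewrite -integral_mkcond.
have [b4|b4] := leP (1 / 4) b.
  apply: weight_line => //; rewrite b2 subrK.
  by rewrite expr_lt1.
rewrite set_itv_ge ?bnd_simp -?ltNge// integral_set0.
by rewrite mule_ge0.
Qed.

Let Qarea (F : R -> \bar R) (rho : R) : rho < 1 ->
  (forall y, F y = \int[mu]_x Q rho (x, y))%E ->
  (\int[mu]_y F y <= 8%:E * W)%E.
Proof.
move=> r1 FE; under eq_integral do rewrite FE.
apply: (@le_trans _ _ (\int[mu]_y ((4%:E * W) * (\1_`[-1, 1] y)%:E))%E).
  apply: ge0_le_integral => //.
  - by move=> y _; apply: integral_ge0 => x _; exact: Q0.
  - exact: (measurable_fun_fubini_tonelli_G (m1 := mu) _ (mQ r1) (fun p => Q0 p r1)).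
  - apply: emeasurable_funM => //; exact/measurable_EFinP.
  - by move=> y _; exact: Qline.
rewrite ge0_integralZl//; first last.
- exact: mule_ge0.
- exact/measurable_EFinP.
have mu2 : mu `[-1, 1]%classic = 2%:E.
  rewrite lebesgue_measure_itv/= lte_fin ifT; last by lra.
  by rewrite -EFinD; congr EFin; ring.
rewrite integral_indic// setIT [X in (_ * X)%E](_ : _ = 2%:E); last exact: mu2.
by rewrite muleAC -EFinM; have -> : (4 * 2 : R) = 8 by ring.
Qed.

(** A point of the disc lies in one of the four images of the region [1 / 4 <= x], each contributing
    at most [8 * W], or satisfies [|x|, |y| < 1 / 4]; in the latter case its modulus is at most
    [1 / 2], where the weight is bounded by [M]. *)
Lemma weight_area_finite :
  (\int[(mu \x mu)%E]_(p in [set p : R * R | (cnorm (toC p) < 1)%R])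
     (omega (cnorm (toC p)))%:E < +oo)%E.
Proof.
have [c p _] := homega.
have [M Mb] : exists M : R, forall r, 0 <= r <= 1 / 2 -> omega r <= M.
  have cs : {within `[0, 1 / 2], continuous omega}.
    apply: continuous_subspaceW c => x /=; rewrite in_itv/= => /andP[? ?].
    by apply/andP; split; lra.
  have h2 : 0 <= 1 / 2 :> R by lra.
  have [x xs Hx] := EVT_max h2 cs.
  by exists (omega x) => r r2; apply: Hx; rewrite in_itv.
have M0 : 0 <= M.
  apply: le_trans (Mb 0 _); first by rewrite ltW// p//; apply/andP; split; lra.
  by apply/andP; split; lra.
(* The 4 is the area of the square [[-1, 1] x [-1, 1]], whose indicator, times [M], dominates the
   weight on the central region. *)
pose C := (M%:E * 4%:E + (8%:E * W + 8%:E * W + (8%:E * W + 8%:E * W)))%E.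
have Cfin : (C < +oo)%E.
  have W8 : (8%:E * W < +oo)%E by rewrite lte_mul_pinfty.
  by rewrite /C -EFinM !lte_add_pinfty// ltry.
have key (rho : R) : rho < 1 ->
    (\int[(mu \x mu)%E]_(p in [set p : R * R | (cnorm (toC p) <= rho)%R]) f p <= C)%E.
  move=> r1; rewrite integral_mkcond.
  pose B : set (R * R) := `[-1, 1]%classic `*` `[-1, 1]%classic.
  have mB : measurable B by apply: measurableX.
  pose Q1 (p : R * R) := Q rho (p.1, p.2).
  pose Q2 (p : R * R) := Q rho (- p.1, p.2).
  pose Q3 (p : R * R) := Q rho (p.2, p.1).
  pose Q4 (p : R * R) := Q rho (- p.2, p.1).
  pose Q5 (p : R * R) := (M%:E * (\1_B p)%:E)%E.
  have m1 : measurable_fun setT Q1.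
    by apply: (measurableT_comp (mQ r1)); apply: measurable_fun_pair.
  have m2 : measurable_fun setT Q2.
    apply: (measurableT_comp (mQ r1)); apply: measurable_fun_pair => //.
    exact: measurableT_comp.
  have m3 : measurable_fun setT Q3.
    by apply: (measurableT_comp (mQ r1)); apply: measurable_fun_pair.
  have m4 : measurable_fun setT Q4.
    apply: (measurableT_comp (mQ r1)); apply: measurable_fun_pair => //.
    exact: measurableT_comp.
  have m5 : measurable_fun setT Q5.
    by apply: emeasurable_funM => //; exact/measurable_EFinP.
  have n1 q : (0 <= Q1 q)%E by exact: Q0.
  have n2 q : (0 <= Q2 q)%E by exact: Q0.
  have n3 q : (0 <= Q3 q)%E by exact: Q0.
  have n4 q : (0 <= Q4 q)%E by exact: Q0.
  have n5 q : (0 <= Q5 q)%E by rewrite /Q5 mule_ge0 ?lee_fin.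
  have mD : measurable [set p : R * R | (cnorm (toC p) <= rho)%R].
    exact: measurable_closed_disc.
  have refl (y : R) : (\int[mu]_x Q rho (- x, y)%R = \int[mu]_x Q rho (x, y))%E.
    have mQy : measurable_fun [set: R] (fun x => Q rho (x, y)).
      by apply: (measurableT_comp (mQ r1)); exact: pair2_measurable.
    have := ge0_integral_affine 0 (or_intror erefl) mQy (fun x => Q0 (x, y) r1).
    by move=> <-; apply: eq_integral => x _; rewrite mulN1r addr0.
  have i1 : (\int[(mu \x mu)%E]_q Q1 q <= 8%:E * W)%E.
    by rewrite fubini_tonelli2//; apply: (Qarea r1).
  have i2 : (\int[(mu \x mu)%E]_q Q2 q <= 8%:E * W)%E.
    by rewrite fubini_tonelli2//; apply: (Qarea r1) => y; exact: refl.
  have i3 : (\int[(mu \x mu)%E]_q Q3 q <= 8%:E * W)%E.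
    by rewrite fubini_tonelli1//; apply: (Qarea r1).
  have i4 : (\int[(mu \x mu)%E]_q Q4 q <= 8%:E * W)%E.
    by rewrite fubini_tonelli1//; apply: (Qarea r1) => y; exact: refl.
  have i5 : (\int[(mu \x mu)%E]_q Q5 q <= M%:E * 4%:E)%E.
    rewrite ge0_integralZl//; last exact/measurable_EFinP.
    rewrite integral_indic// setIT.
    have mu2 : mu `[-1, 1]%classic = 2%:E.
      rewrite lebesgue_measure_itv/= lte_fin ifT; last by lra.
      by rewrite -EFinD; congr EFin; ring.
    rewrite [X in (_ * X)%E](_ : _ = 4%:E)//.
    transitivity (2%:E * 2%:E : \bar R)%E; last first.
      by rewrite -EFinM; congr EFin; ring.
    by rewrite -{1}mu2 -mu2; exact: product_measure1E.
  apply: (@le_trans _ _ (\int[(mu \x mu)%E]_q (Q5 q + (Q1 q + Q2 q + (Q3 q + Q4 q))))%E).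
    apply: ge0_le_integral => //.
    - move=> q _; rewrite patchE; case: ifP => //; rewrite inE => q1.
      by apply: f0; exact: le_lt_trans q1 r1.
    - apply/(measurable_restrictT _ mD); apply: measurable_funS mf.
        by apply: popen_measurable; exact: popen_disc.
      by move=> q /= q1; exact: le_lt_trans q1 r1.
    - apply: emeasurable_funD => //; apply: emeasurable_funD;
      exact: emeasurable_funD.
    - move=> q _; rewrite patchE; case: ifP => [|_]; last first.
        by rewrite !adde_ge0.
      rewrite inE/= => qr; case: q qr => x y qr.
      have nE (u v : R) : u ^+ 2 + v ^+ 2 = x ^+ 2 + y ^+ 2 ->
          1 / 4 <= u -> f (x, y) = Q rho (u, v).
        move=> uv u4; rewrite /Q patchE mem_set /f/= /cnorm/= ?uv//.
        by split => //=; rewrite /cnorm/= uv.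
      have [x4|x4] := leP (1 / 4) x.
        have -> : f (x, y) = Q1 (x, y) by exact: nE.
        apply: (@le_trans _ _ (Q1 (x, y) + Q2 (x, y) + (Q3 (x, y) + Q4 (x, y)))%E).
          by rewrite -addeA leeDl// !adde_ge0.
        by rewrite leeDr.
      have [x4'|x4'] := leP (1 / 4) (- x).
        have -> : f (x, y) = Q2 (x, y) by apply: nE => //; rewrite sqrrN.
        apply: (@le_trans _ _ (Q1 (x, y) + Q2 (x, y) + (Q3 (x, y) + Q4 (x, y)))%E).
          by rewrite addeAC leeDr// !adde_ge0.
        by rewrite leeDr.
      have [y4|y4] := leP (1 / 4) y.
        have -> : f (x, y) = Q3 (x, y) by apply: nE => //; rewrite addrC.
        apply: (@le_trans _ _ (Q1 (x, y) + Q2 (x, y) + (Q3 (x, y) + Q4 (x, y)))%E).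
          by rewrite addeCA leeDl// !adde_ge0.
        by rewrite leeDr.
      have [y4'|y4'] := leP (1 / 4) (- y).
        have -> : f (x, y) = Q4 (x, y) by apply: nE => //; rewrite sqrrN addrC.
        apply: (@le_trans _ _ (Q1 (x, y) + Q2 (x, y) + (Q3 (x, y) + Q4 (x, y)))%E).
          by rewrite addeA leeDr// !adde_ge0.
        by rewrite leeDr.
      have Bxy : B (x, y) by split => /=; rewrite in_itv/=; apply/andP; split; lra.
      apply: (@le_trans _ _ (Q5 (x, y))); last by rewrite leeDl// !adde_ge0.
      rewrite /Q5 indicE mem_set//= mule1 lee_fin Mb// cnorm_ge0/=.
      apply: (le_trans (cnorm_le_ReIm _)) => /=.
      have : `|x| <= 1 / 4 by rewrite ler_norml; apply/andP; split; lra.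
      have : `|y| <= 1 / 4 by rewrite ler_norml; apply/andP; split; lra.
      lra.
  have a12 q : (0 <= Q1 q + Q2 q)%E by exact: adde_ge0.
  have a34 q : (0 <= Q3 q + Q4 q)%E by exact: adde_ge0.
  have b12 := emeasurable_funD m1 m2; have b34 := emeasurable_funD m3 m4.
  have gD (A B' : R * R -> \bar R) : (forall q, 0 <= A q)%E -> (forall q, 0 <= B' q)%E ->
      measurable_fun setT A -> measurable_fun setT B' ->
      (\int[(mu \x mu)%E]_q (A q + B' q) =
       \int[(mu \x mu)%E]_q A q + \int[(mu \x mu)%E]_q B' q)%E.
    by move=> A0 B0 mA mB'; rewrite ge0_integralD.
  have -> := gD _ _ n5 (fun q => adde_ge0 (a12 q) (a34 q)) m5 (emeasurable_funD b12 b34).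
  have -> := gD _ _ a12 a34 b12 b34; have -> := gD _ _ n1 n2 m1 m2.
  have -> := gD _ _ n3 n4 m3 m4.
  exact: (leeD i5 (leeD (leeD i1 i2) (leeD i3 i4))).
apply: le_lt_trans Cfin.
(* The bound [C] does not depend on the radius, so monotone convergence along closed discs carries
   it to the open disc. *)
pose S (n : nat) : set (R * R) := [set p | (cnorm (toC p) <= 1 - n.+1%:R^-1)%R].
have SU : [set p : R * R | (cnorm (toC p) < 1)%R] = \bigcup_n S n.
  apply/seteqP; split => q /=.
    move=> q1; have d0 : 0 < 1 - cnorm (toC q) by rewrite subr_gt0.
    have /ltr_add_invr[n] : 0 < 1 - cnorm (toC q) by [].
    by rewrite add0r => hn; exists n => //; rewrite /S /= lerBrDr -lerBrDl ltW.
  move=> [n _ /= h]; apply: (le_lt_trans h).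
  by rewrite ltrBlDr ltrDl invr_gt0.
rewrite SU.
have lt1 n : 1 - n.+1%:R^-1 < 1 :> R by rewrite ltrBlDr ltrDl invr_gt0.
have cv : (\int[(mu \x mu)%E]_(x in S i) f x)%E @[i --> \oo] -->
    (\int[(mu \x mu)%E]_(x in \bigcup_i S i) f x)%E.
  apply: ge0_nondecreasing_set_cvg_integral.
  - apply/nondecreasing_seqP => n; apply/subsetPset => q /= h; apply: (le_trans h).
    by rewrite lerD2l lerN2 lef_pV2 ?posrE// ler_nat.
  - by move=> n; exact: measurable_closed_disc.
  - move=> n; apply: measurable_funS mf; first by apply: popen_measurable; exact: popen_disc.
    by move=> q /= h; exact: le_lt_trans h (lt1 n).
  - by move=> n q h; apply: f0; exact: le_lt_trans h (lt1 n).
rewrite -(cvg_lim _ cv)//; apply: lime_le; first by apply/cvg_ex; eexists; exact: cv.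
by apply: nearW => n; exact: key.
Qed.

End WeightArea.

(** * Energies of finite configurations and their growth *)

Section DiscreteEnergy.
Context {R : realType}.
Variable gam : R[i] -> R[i] -> R.
Hypothesis gam_sym : forall z w, gam z w = gam w z.

Fixpoint pair_energy (s : seq R[i]) : R :=
  if s is x :: t then \sum_(y <- t) gam x y + pair_energy t else 0.

(** [rem] deletes one occurrence of [x]; for a duplicate-free [s] this leaves exactly the other
    points. *)
Definition potential (s : seq R[i]) (x : R[i]) : R := \sum_(y <- rem x s) gam x y.

Lemma pair_energy_rem s x : x \in s ->
  pair_energy s = pair_energy (rem x s) + potential s x.
Proof.
elim: s => // a t IH; rewrite inE /potential /=; case: eqVneq => [->|xa] /=.
  by move=> _; rewrite addrC.
move=> xt; rewrite IH//= (big_rem x xt) big_cons /=.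
by rewrite (gam_sym a x) /potential; ring.
Qed.

Lemma sum_potential s : uniq s -> \sum_(x <- s) potential s x = 2 * pair_energy s.
Proof.
elim: s => [|a t IH] /=; first by rewrite big_nil mulr0.
move=> /andP[at' ut]; rewrite big_cons {1}/potential /= eqxx.
rewrite [X in _ + X](eq_big_seq (fun x => gam a x + potential t x)); last first.
  move=> x xt; rewrite /potential /=.
  have [ax|ax] := eqVneq a x; first by rewrite ax xt in at'.
  by rewrite big_cons gam_sym.
by rewrite big_split/= IH//; ring.
Qed.

Lemma pair_energy_ge0 (K : set R[i]) s : (forall z w, K z -> K w -> z != w -> 0 <= gam z w) ->
  uniq s -> (forall z, z \in s -> K z) -> 0 <= pair_energy s.
Proof.
move=> g0; elim: s => //= a t IH /andP[at' ut] sK.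
rewrite addr_ge0//; last by apply: IH => // z zt; apply: sK; rewrite inE zt orbT.
rewrite big_seq; apply: sumr_ge0 => y yt; apply: g0.
- by apply: sK; rewrite inE eqxx.
- by apply: sK; rewrite inE yt orbT.
- by apply: contraNneq at' => ->.
Qed.

End DiscreteEnergy.

Section EnergySequence.
Context {R : realType}.
Variables (E : nat -> R) (L : R).
Let T (n : nat) : R := n%:R * (n%:R - 1) / 2.
Hypothesis EL : forall n, E n <= T n * L.
(** As [T n.+1 / T n = (n + 1) / (n - 1)], this is the monotonicity of [E n / T n], in a
    division-free form that makes sense also at [n = 0] and [n = 1]. *)
Hypothesis Emono : forall n, n.+1%:R * E n <= (n%:R - 1) * E n.+1.

Let TS n : T n.+1 = T n + n%:R.
Proof. by rewrite /T -natr1; field. Qed.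

Let T0 n : (2 <= n)%N -> 0 < T n.
Proof.
move=> n2; rewrite /T divr_gt0// mulr_gt0 ?ltr0n ?(leq_trans _ n2)//.
by rewrite subr_gt0 ltr1n.
Qed.

Let ratio_mono n : (2 <= n)%N -> E n / T n <= E n.+1 / T n.+1.
Proof.
move=> n2; rewrite ler_pdivrMr ?T0// mulrAC ler_pdivlMr ?T0 ?leqW//.
have := Emono n; have n0 : 0 <= n%:R :> R by [].
rewrite /T -natr1 => h.
have := ler_wpM2l (divr_ge0 n0 (ler0n R 2)) h; lra.
Qed.

(* Since [E n / T n] converges, increments much larger than [n L] on a whole
   block [m < n <= (1 + delta) m] would contradict the Cauchy criterion. *)
Lemma small_increment (eps delta : R) : 0 < eps -> 0 < delta ->
  exists m0 : nat, forall m : nat, (m0 <= m)%N -> exists n : nat,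
    [/\ (m < n.+1)%N, n.+1%:R <= (1 + delta) * m%:R + 1 &
        E n.+1 - E n <= n%:R * (L + eps)].
Proof.
move=> eps0 delta0.
pose X := [set E n / T n | n in [set n : nat | (2 <= n)%N]].
have X0 : X !=set0 by exists (E 2 / T 2), 2%N.
have XL : ubound X L by move=> _ [n /= n2 <-]; rewrite ler_pdivrMr ?T0// mulrC.
have supX : has_sup X by split => //; exists L.
have eL : sup X <= L by exact: ge_sup.
have le_e n : (2 <= n)%N -> E n <= T n * sup X.
  move=> n2; rewrite mulrC -ler_pdivrMr ?T0//; apply: ub_le_sup; first by case: supX.
  by exists n.
(* From [k] on, all ratios lie within [eps * delta] of their supremum. *)
have [_ [k /= k2 <-] hk] := sup_adherent (mulr_gt0 eps0 delta0) supX.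
have ge_e n : (k <= n)%N -> T n * (sup X - eps * delta) <= E n.
  move=> kn; rewrite mulrC -ler_pdivlMr ?T0 ?(leq_trans k2)//.
  apply: (le_trans (ltW hk)).
  elim: n kn => [|n IH]; first by rewrite leqn0 => /eqP <-.
  rewrite leq_eqVlt => /predU1P[->//|]; rewrite ltnS => kn.
  by apply: (le_trans (IH kn)); apply: ratio_mono; exact: leq_trans kn.
exists k => m km; have m2 : (2 <= m)%N by exact: leq_trans km.
have m0 : 0 < m%:R :> R by rewrite ltr0n (leq_trans _ m2).
(* The block consists of [j] increments, with [delta * m < j <= delta * m + 1]; the final [+ 1] of
   the statement comes from this rounding. *)
pose j := (Num.truncn (delta * m%:R)).+1.
have dm0 : 0 <= delta * m%:R by rewrite mulr_ge0// ltW.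
have [jle jgt] : j%:R <= delta * m%:R + 1 /\ delta * m%:R < j%:R :> R.
  have /andP[h1 h2] := truncn_itv dm0.
  by split => //; rewrite -natr1 lerD2r.
apply: contrapT => /forallNP H.
have step i : (i < j)%N -> (m + i)%:R * (L + eps) < E (m + i).+1 - E (m + i)%N.
  move=> ij; rewrite ltNge; apply/negP => h; apply: (H (m + i)%N); split => //.
    by rewrite ltnS leq_addr.
  have : (m + i).+1%:R <= (m + j)%:R :> R by rewrite ler_nat -addnS leq_add2l.
  by rewrite natrD; lra.
have tele i : (i <= j)%N -> (T (m + i) - T m) * (L + eps) <= E (m + i)%N - E m.
  elim: i => [|i IH] ij; first by rewrite addn0 !subrr mul0r.
  have := IH (ltnW ij); have := step i ij; rewrite addnS TS; lra.
have := tele j (leqnn _).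
have mj2 : (2 <= m + j)%N by rewrite (leq_trans m2)// leq_addr.
have := le_e _ mj2; have := ge_e m km.
(* The telescoped lower bound and the bounds for [E (m + j)] and [E m] yield [eps * (T (m + j) - T
   m) <= eps * delta * T m], because [sup X <= L]; this inequality contradicts it. *)
have TT : delta * T m < T (m + j) - T m.
  have -> : T (m + j) - T m = (j%:R * (2 * m%:R + j%:R - 1)) / 2.
    by rewrite /T natrD; field.
  have j1 : 1 <= j%:R :> R by rewrite ler1n.
  have m1 : 1 <= m%:R :> R by rewrite ler1n (leq_trans _ m2).
  rewrite /T.
  have : delta * m%:R * (m%:R - 1) <= j%:R * (m%:R - 1).
    by apply: ler_wpM2r; [lra|exact: ltW].
  have : (j%:R : R) * (m%:R - 1) < j%:R * (2 * m%:R + j%:R - 1).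
    by rewrite (ltr_pM2l (lt_le_trans ltr01 j1)); lra.
  lra.
have Tm := T0 m2.
have : (T (m + j) - T m) * (sup X + eps) <= (T (m + j) - T m) * (L + eps).
  by rewrite ler_wpM2l// ?lerD2r//; have := mulr_gt0 delta0 Tm; lra.
have := ltr_pM2l eps0 (delta * T m) (T (m + j) - T m); rewrite TT.
lra.
Qed.

End EnergySequence.

(** * The Green function of the disc *)

Section GreenKernel.
Context {R : realType}.
Implicit Types z w : R[i].

(** The real-valued Green function. On the diagonal, division by zero gives a junk value instead of
    [+oo], so it is meaningful for distinct points only. *)
Definition gker z w : R := ln (cnorm (1 - (w^*)%C * z) / cnorm (z - w)).

Lemma greenE z w : z != w -> green z w = (gker z w)%:E.
Proof. by rewrite /green => /negPf ->. Qed.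

Lemma green_sym z w : green z w = green w z.
Proof.
rewrite /green eq_sym; case: ifP => // _; congr EFin; congr (ln (_ / _)).
  rewrite -cnorm_conj; congr cnorm; case: z w => [a b] [c d].
  by apply/eqP; rewrite eq_complex/=; apply/andP; split; apply/eqP; ring.
exact: cnormB.
Qed.

Lemma gker_sym z w : gker z w = gker w z.
Proof.
have [->//|zw] := eqVneq z w; apply: EFin_inj.
by rewrite -!greenE// 1?eq_sym// green_sym.
Qed.

(** The right-hand side is positive on the disc; this gives at once that the Green function is
    nonnegative and that its numerator does not vanish. *)
Lemma pseudohyperbolic z w : cnorm (1 - (w^*)%C * z) ^+ 2 - cnorm (z - w) ^+ 2 =
  (1 - cnorm z ^+ 2) * (1 - cnorm w ^+ 2).
Proof. by case: z w => [a b] [c d]; rewrite !cnorm_sqr/=; ring. Qed.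

Lemma cnorm_sub_le_green z w : disc z -> disc w ->
  cnorm (z - w) <= cnorm (1 - (w^*)%C * z).
Proof.
move=> z1 w1; rewrite -(ler_pXn2r (ltn0Sn 1)) ?nnegrE ?cnorm_ge0//.
rewrite -subr_ge0 pseudohyperbolic mulr_ge0// subr_ge0 expr_le1 ?cnorm_ge0// ltW//.
Qed.

Lemma green_den_gt0 z w : disc z -> disc w -> 0 < cnorm (1 - (w^*)%C * z).
Proof.
move=> z1 w1; rewrite -(ltr_pXn2r (ltn0Sn 1)) ?nnegrE ?cnorm_ge0//.
rewrite expr0n/= -subr_gt0 subr0.
have := pseudohyperbolic z w; have := sqr_ge0 (cnorm (z - w)).
have : 0 < (1 - cnorm z ^+ 2) * (1 - cnorm w ^+ 2).
  by rewrite mulr_gt0// subr_gt0 expr_lt1 ?cnorm_ge0.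
lra.
Qed.

Lemma gker_ge0 z w : disc z -> disc w -> z != w -> 0 <= gker z w.
Proof.
move=> z1 w1 zw; rewrite ln_ge0// ler_pdivlMr ?mul1r; first exact: cnorm_sub_le_green.
by rewrite cnorm_gt0 subr_eq0.
Qed.

Lemma green_ge0 z w : disc z -> disc w -> (0 <= green z w)%E.
Proof.
move=> z1 w1; rewrite /green; case: eqVneq => [_|zw]; first exact: leey.
by rewrite lee_fin; exact: gker_ge0.
Qed.

Lemma measurable_cnorm {d : measure_display} {T : measurableType d} (f g : T -> R) :
  measurable_fun setT f -> measurable_fun setT g ->
  measurable_fun setT (fun x => cnorm (f x +i* g x)%C).
Proof.
move=> mf mg; rewrite /cnorm/=.
apply: (@measurableT_comp _ _ _ _ _ _ (@Num.sqrt R)).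
  by apply: continuous_measurable_fun; exact: sqrt_continuous.
by apply: measurable_funD; apply: measurable_funX.
Qed.

(** The inverse is written as [expR (- ln (f x))], and its conventional value at zero is treated
    apart. *)
Lemma measurable_inv {d : measure_display} {T : measurableType d} (f : T -> R) :
  (forall x, 0 <= f x) ->
  measurable_fun setT f -> measurable_fun setT (fun x => (f x)^-1).
Proof.
move=> f0 mf.
have -> : (fun x => (f x)^-1) = (fun x => if f x == 0 then 0 else expR (- ln (f x))).
  apply/funext => x; case: eqVneq => [->|fx]; first by rewrite invr0.
  by rewrite expRN lnK// posrE lt0r fx f0.
apply: measurable_fun_ifT => //; first exact: measurable_fun_eqr.
by apply: measurableT_comp => //; apply: measurableT_comp => //; apply: measurableT_comp.
Qed.

Lemma measurable_green :
  measurable_fun setT (fun x : (R * R) * (R * R) => green (toC x.1) (toC x.2)).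
Proof.
have m11 : measurable_fun setT (fun x : (R * R) * (R * R) => x.1.1).
  by apply: measurableT_comp.
have m12 : measurable_fun setT (fun x : (R * R) * (R * R) => x.1.2).
  by apply: measurableT_comp.
have m21 : measurable_fun setT (fun x : (R * R) * (R * R) => x.2.1).
  by apply: measurableT_comp.
have m22 : measurable_fun setT (fun x : (R * R) * (R * R) => x.2.2).
  by apply: measurableT_comp.
have mD : measurable_fun setT (fun x : (R * R) * (R * R) => cnorm (toC x.1 - toC x.2)).
  apply: (@measurable_cnorm _ _ (fun x : (R * R) * (R * R) => x.1.1 - x.2.1)
    (fun x => x.1.2 - x.2.2)); exact: measurable_funB.
have mN : measurable_fun setT
    (fun x : (R * R) * (R * R) => cnorm (1 - ((toC x.2)^*)%C * toC x.1)).
  have -> : (fun x : (R * R) * (R * R) => cnorm (1 - ((toC x.2)^*)%C * toC x.1)) =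
    (fun x => cnorm ((1 - (x.2.1 * x.1.1 + x.2.2 * x.1.2)) +i*
                     (x.2.2 * x.1.1 - x.2.1 * x.1.2))%C).
    apply/funext => x; congr cnorm; rewrite /toC; apply/eqP.
    by rewrite eq_complex/=; apply/andP; split; apply/eqP; ring.
  apply: measurable_cnorm.
    apply: measurable_funB => //; apply: measurable_funD; exact: measurable_funM.
  apply: measurable_funB; exact: measurable_funM.
have -> : (fun x : (R * R) * (R * R) => green (toC x.1) (toC x.2)) =
  (fun x => if cnorm (toC x.1 - toC x.2) == 0 then +oo%E else
     (ln (cnorm (1 - ((toC x.2)^*)%C * toC x.1) * (cnorm (toC x.1 - toC x.2))^-1))%:E).
  by apply/funext => x; rewrite /green cnorm_eq0 subr_eq0.
apply: measurable_fun_ifT => //; first exact: measurable_fun_eqr.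
apply/measurable_EFinP; apply: measurableT_comp => //; apply: measurable_funM => //.
by apply: measurable_inv => // x; exact: cnorm_ge0.
Qed.

End GreenKernel.

(** * Selection of points with small Green energy *)

Section Selection.
Context {R : realType}.
Variables (mu : probability (R * R)%type R) (A : set (R * R)).
Hypothesis mA : measurable A.
Hypothesis Adisc : forall p, A p -> disc (toC p).

Local Notation g p q := (green (toC p) (toC q)).

Let U p := (\int[mu]_(q in A) g p q)%E.

Let g0 p q : A p -> A q -> (0 <= g p q)%E.
Proof. by move=> Ap Aq; apply: green_ge0; exact: Adisc. Qed.

Let mgp p : measurable_fun A (fun q => g p q).
Proof.
apply: measurable_funTS.
by apply: (measurableT_comp measurable_green (pair1_measurable p)).
Qed.

Let U0 p : A p -> (0 <= U p)%E.
Proof. by move=> Ap; apply: integral_ge0 => q Aq; exact: g0. Qed.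

(** Tonelli's theorem requires a nonnegative kernel on the whole product, so the Green function is
    first cut off outside [A x A]. *)
Lemma measurable_potential : measurable_fun A U.
Proof.
pose k (x : (R * R) * (R * R)) : \bar R := ((fun x => g x.1 x.2) \_ (A `*` A)) x.
have mk : measurable_fun setT k.
  apply/(measurable_restrictT _ (measurableX mA mA)).
  apply: measurable_funTS; exact: measurable_green.
have k0 x : (0 <= k x)%E.
  by rewrite /k patchE; case: ifP => //; rewrite inE => -[]; exact: g0.
have := measurable_fun_fubini_tonelli_F (m2 := mu) k mk k0.
move=> /(measurable_funTS (D := A)) mF.
apply: eq_measurable_fun mF => p; rewrite inE => Ap.
rewrite /U /fubini_F [RHS]integral_mkcond; apply: eq_integral => q _.
rewrite /k !patchE; case: ifP => [|h1].
  by rewrite inE => -[_ /= Aq]; rewrite mem_set.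
by case: ifP => //; rewrite inE => Aq; rewrite mem_set in h1.
Qed.

(** The energy with values in the extended reals: it is [+oo] as soon as a point of the disc is
    chosen twice, so a finite bound also separates the points. *)
Fixpoint lpairs (s : seq (R * R)) : \bar R :=
  if s is x :: t then (\sum_(y <- t) g x y + lpairs t)%E else 0%E.

Variables (m J : R).
Hypothesis m0 : 0 < m.
Hypothesis muA : mu A = m%:E.
Hypothesis JE : (\int[mu]_(p in A) U p = J%:E)%E.

(* Conditional expectations: choose the points one after the other, each time
   not exceeding the mean of the remaining expected energy. *)
Lemma energy_selection (n : nat) : forall (v : R * R -> \bar R) (eps : R), 0 < eps ->
  measurable_fun A v -> (forall p, A p -> (0 <= v p)%E) ->
  exists s : seq (R * R), [/\ size s = n, (forall p, p \in s -> A p) &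
    (\sum_(p <- s) v p + lpairs s <=
     (n%:R / m)%:E * \int[mu]_(p in A) v p +
       (n%:R * (n%:R - 1) / 2 * (J / m ^+ 2) + n%:R * eps)%:E)%E].
Proof.
elim: n => [|n IH] v eps eps0 mv v0.
  exists [::]; split => //=; rewrite big_nil !mul0r mul0e.
  by rewrite add0e add0e addr0.
have J0 : 0 <= J.
  by rewrite -lee_fin -JE; apply: integral_ge0 => p Ap; exact: U0.
have [a Aa] : A !=set0.
  by apply/set0P/eqP => A0; move: muA m0; rewrite A0 measure0 => -[<-]; rewrite ltxx.
have sz : exists s : seq (R * R), size s = n.+1 /\ (forall p, p \in s -> A p).
  exists (nseq n.+1 a); rewrite size_nseq; split => // p.
  by move/nseqP => [->].
have V0 : (0 <= \int[mu]_(p in A) v p)%E by exact: integral_ge0.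
have nm0 : 0 <= n%:R / m by rewrite divr_ge0// ltW.
case Ev : (\int[mu]_(p in A) v p)%E V0 => [av| |]//; last first.
  have [s [s1 s2]] := sz; exists s; split => //.
  by rewrite gt0_muley ?addye ?leey// lte_fin divr_gt0.
rewrite lee_fin => av0.
(* Up to [eps], this is the mean over [A] of [v + (n / m) U], the expected cost of the next point
   together with its interaction with the [n] remaining ones. The [eps] makes integrating
   [c <= v + (n / m) U] contradictory. *)
pose c : R := av / m + n%:R * (J / m ^+ 2) + eps.
have [x Ax xc] : exists2 x, A x & (v x + (n%:R / m)%:E * U x <= c%:E)%E.
  apply: contrapT => H.
  have lb p : A p -> (c%:E <= v p + (n%:R / m)%:E * U p)%E.
    move=> Ap; rewrite leNgt; apply/negP => h; apply: H; exists p => //; exact: ltW.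
  have mnU : measurable_fun A (fun p => (n%:R / m)%:E * U p)%E.
    by apply: emeasurable_funM => //; exact: measurable_potential.
  have nU0 p : A p -> (0 <= (n%:R / m)%:E * U p)%E.
    by move=> Ap; rewrite mule_ge0 ?lee_fin//; exact: U0.
  have c0 : 0 <= c.
    by rewrite /c !addr_ge0 ?(ltW eps0) ?divr_ge0 ?(ltW m0)// mulr_ge0// divr_ge0// exprn_ge0// ltW.
  have : (\int[mu]_(p in A) c%:E <= \int[mu]_(p in A) (v p + (n%:R / m)%:E * U p))%E.
    apply: ge0_le_integral => //; first exact: emeasurable_funD.
  rewrite integral_cst// ge0_integralD// ge0_integralZl//; last exact: measurable_potential.
  rewrite Ev [X in (_ <= _ + _ * X)%E]JE [X in (_ * X <= _)%E]muA.
  rewrite -!EFinM -EFinD lee_fin; apply/negP; rewrite -ltNge.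
  have -> : c * m = av + n%:R / m * J + eps * m by rewrite /c; field; rewrite gt_eqF.
  by have := mulr_gt0 eps0 m0; lra.
(* The chosen point becomes part of the external field felt by the later ones; this is why the
   induction is over all [v]. *)
pose v' p := (v p + g x p)%E.
have mv' : measurable_fun A v' by exact: emeasurable_funD.
have v'0 p : A p -> (0 <= v' p)%E by move=> Ap; rewrite adde_ge0 ?v0 ?g0.
have [s [s1 s2 s3]] := IH v' eps eps0 mv' v'0.
exists (x :: s); split => /=; first by rewrite s1.
  by move=> p; rewrite inE => /predU1P[->//|]; exact: s2.
have iv' : (\int[mu]_(p in A) v' p = av%:E + U x)%E.
  by rewrite ge0_integralD ?Ev// => q Aq; exact: g0.
have sv' : (\sum_(p <- s) v' p = \sum_(p <- s) v p + \sum_(p <- s) g x p)%E.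
  rewrite [LHS]big_seq_cond [X in (X + _)%E]big_seq_cond [X in (_ + X)%E]big_seq_cond.
  rewrite -big_split/=; apply: eq_bigr => //.
rewrite iv' sv' in s3.
rewrite big_cons addeA -(addeA (v x)).
apply: (@le_trans _ _ (v x + ((n%:R / m)%:E * (av%:E + U x) +
  (n%:R * (n%:R - 1) / 2 * (J / m ^+ 2) + n%:R * eps)%:E))%E).
  by rewrite -addeA leeD2l.
rewrite ge0_muleDr ?lee_fin ?U0//.
apply: (@le_trans _ _ (c%:E + ((n%:R / m * av)%:E +
  (n%:R * (n%:R - 1) / 2 * (J / m ^+ 2) + n%:R * eps)%:E))%E).
  rewrite -EFinM [X in (_ + (X + _) <= _)%E]addeC -addeA addeA leeD2r//.
rewrite -EFinM -!EFinD lee_fin le_eqVlt; apply/orP; left; apply/eqP.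
by rewrite /c -natr1; field; rewrite gt_eqF.
Qed.

End Selection.

(** * Energy of the restriction of a measure *)

Section EnergyRestriction.
Context {R : realType}.
Variables (mu : probability (R * R)%type R) (K : set (R * R)).
Hypothesis mK : measurable K.
Hypothesis muK : mu (~` K) = 0%E.
Hypothesis Kdisc : forall p, K p -> disc (toC p).

Local Notation g p q := (green (toC p) (toC q)).

Let ae_eq_patch (f : R * R -> \bar R) : ae_eq mu setT f (f \_ K).
Proof.
exists (~` K); split => //; first exact: measurableC.
by move=> p /= h Kp; apply: h => _; rewrite patchE mem_set.
Qed.

Let integral_supp (f : R * R -> \bar R) : measurable_fun setT f ->
  (\int[mu]_p f p = \int[mu]_(p in K) f p)%E.
Proof.
move=> mf; rewrite [RHS]integral_mkcond; apply: ae_eq_integral => //.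
by apply/(measurable_restrictT _ mK); exact: measurable_funTS.
Qed.

(** The kernel can be negative when one of the points is outside the disc; since [mu] charges only
    [K], the energy is in fact an integral of nonnegative quantities. *)
Lemma energy_restrict : energy mu = (\int[mu]_(p in K) \int[mu]_(q in K) g p q)%E.
Proof.
have mg (p : R * R) : measurable_fun setT (fun q : R * R => g p q).
  exact: (measurableT_comp measurable_green (pair1_measurable p)).
have inner p : (\int[mu]_q g p q = \int[mu]_(q in K) g p q)%E by exact: integral_supp.
rewrite /energy; transitivity (\int[mu]_p \int[mu]_(q in K) g p q)%E.
  by apply: eq_integral => p _.
apply: integral_supp.
pose G (x : (R * R) * (R * R)) := g x.1 x.2.
have mG : measurable_fun setT G by exact: measurable_green.
(* On the whole plane the kernel has no sign, so measurability of the inner integral is obtained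
   from Tonelli's theorem for its positive and negative parts. *)
have -> : (fun p => \int[mu]_(q in K) g p q)%E =
    (fun p => \int[mu]_q (G^\+)%E (p, q) - \int[mu]_q (G^\-)%E (p, q))%E.
  apply/funext => p; rewrite -inner (integralE mu setT (fun q => g p q)).
  by congr (_ - _)%E; apply: eq_integral => q _; rewrite ?funeposE ?funenegE.
apply: emeasurable_funB.
  apply: (measurable_fun_fubini_tonelli_F (m2 := mu) (G^\+)%E) => //.
  exact: measurable_funepos.
apply: (measurable_fun_fubini_tonelli_F (m2 := mu) (G^\-)%E) => //.
exact: measurable_funeneg.
Qed.

(** On [K], inside the disc, the kernel is nonnegative, so shrinking either domain of integration
    lowers the value. *)
Lemma energy_subset (A : set (R * R)) : measurable A -> A `<=` K ->
  (\int[mu]_(p in A) \int[mu]_(q in A) g p q <= energy mu)%E.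
Proof.
move=> mA AK; rewrite energy_restrict.
have mg (p : R * R) : measurable_fun setT (fun q : R * R => g p q).
  exact: (measurableT_comp measurable_green (pair1_measurable p)).
have g0 p q : K p -> K q -> (0 <= g p q)%E.
  by move=> Kp Kq; apply: green_ge0; exact: Kdisc.
have mU (B : set (R * R)) : measurable B -> B `<=` K ->
    measurable_fun B (fun p => \int[mu]_(q in B) g p q)%E.
  by move=> mB BK; apply: measurable_potential => // p /BK; exact: Kdisc.
apply: (@le_trans _ _ (\int[mu]_(p in A) \int[mu]_(q in K) g p q)%E).
  apply: ge0_le_integral => //.
  - by move=> p Ap; apply: integral_ge0 => q Aq; apply: g0; exact: AK.
  - exact: mU.
  - by apply: measurable_funS (mU K mK _).
  - move=> p Ap; apply: ge0_subset_integral => //; first exact: measurable_funTS.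
    by move=> q Kq; apply: g0 => //; exact: AK.
apply: ge0_subset_integral => //; first exact: mU.
by move=> p Kp; apply: integral_ge0 => q Kq; exact: g0.
Qed.

Lemma energy_ge0 : (0 <= energy mu)%E.
Proof.
rewrite energy_restrict; apply: integral_ge0 => p Kp; apply: integral_ge0 => q Kq.
by apply: green_ge0; exact: Kdisc.
Qed.

End EnergyRestriction.

(** * Nearly minimizing configurations *)

Section GoodConfiguration.
Context {R : realType}.
Variables (mu : probability (R * R)%type R) (A : set (R * R)).
Hypothesis mA : measurable A.
Hypothesis Adisc : forall p, A p -> disc (toC p).
Variables (m J : R).
Hypothesis m0 : 0 < m.
Hypothesis muA : mu A = m%:E.
Hypothesis JE : (\int[mu]_(p in A) \int[mu]_(q in A) green (toC p) (toC q) = J%:E)%E.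

Let K : set R[i] := toC @` A.
Let conf (n : nat) : set (seq R[i]) :=
  [set s | [/\ uniq s, size s = n & forall z, z \in s -> K z]].
Let pe := pair_energy (@gker R).
Let L := J / m ^+ 2.

Let Kdisc z : K z -> disc z.
Proof. by move=> [p Ap <-]; exact: Adisc. Qed.

Lemma lpairs_ge0 s : (forall p, p \in s -> A p) -> (0 <= lpairs s)%E.
Proof.
elim: s => //= x t IH sA; apply: adde_ge0; last first.
  by apply: IH => p pt; apply: sA; rewrite inE pt orbT.
rewrite big_seq; apply: sume_ge0 => y yt; apply: green_ge0; apply: Adisc; apply: sA.
  by rewrite inE eqxx.
by rewrite inE yt orbT.
Qed.

(** A repetition would put a diagonal value [+oo] in a sum whose other terms are nonnegative. *)
Lemma lpairs_finite s : (forall p, p \in s -> A p) -> (lpairs s < +oo)%E ->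
  uniq (map toC s) /\ lpairs s = (pe (map toC s))%:E.
Proof.
elim: s => //= x t IH sA.
have tA p : p \in t -> A p by move=> pt; apply: sA; rewrite inE pt orbT.
have g0 y : y \in t -> (0 <= green (toC x) (toC y))%E.
  move=> yt; apply: green_ge0; apply: Adisc; first by apply: sA; rewrite inE eqxx.
  exact: tA.
have s0 : (0 <= \sum_(y <- t) green (toC x) (toC y))%E.
  by rewrite big_seq; apply: sume_ge0 => y; exact: g0.
move=> h; have l0 := lpairs_ge0 tA.
have lt : (lpairs t < +oo)%E by apply: le_lt_trans h; rewrite leeDr.
have st : (\sum_(y <- t) green (toC x) (toC y) < +oo)%E by apply: le_lt_trans h; rewrite leeDl.
have [ut ->] := IH tA lt.
have ne y : y \in t -> toC x != toC y.
  move=> yt; apply/eqP => xy; move: st; rewrite (big_rem y yt)/=.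
  rewrite {1}/green xy eqxx addye ?ltxx//.
  rewrite gt_eqF// (lt_le_trans _ (_ : 0 <= _)%E)//.
  rewrite big_seq; apply: sume_ge0 => z /mem_rem zt.
  by have := g0 z zt; rewrite xy.
have -> : (\sum_(y <- t) green (toC x) (toC y) =
    (\sum_(z <- map toC t) gker (toC x) z)%:E)%E.
  rewrite big_map -sumEFin; apply: eq_big_seq => y yt; exact: greenE (ne y yt).
split => //; rewrite ut andbT; apply/mapP => -[y yt xy].
by have := ne y yt; rewrite xy eqxx.
Qed.

Let J0 : 0 <= J.
Proof.
rewrite -lee_fin -JE; apply: integral_ge0 => p Ap; apply: integral_ge0 => q Aq.
by apply: green_ge0; exact: Adisc.
Qed.

(** The selection is run without external field, [v = 0]; finiteness of the energy then makes the
    points distinct. *)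
Let conf_le n (eps : R) : 0 < eps ->
  exists2 s, conf n s & pe s <= n%:R * (n%:R - 1) / 2 * L + n%:R * eps.
Proof.
move=> eps0.
have [||s [s1 s2 s3]] := energy_selection mA Adisc m0 muA JE n (v := cst 0%E) eps0.
- exact: measurable_cst.
- by [].
have {}s3 : (lpairs s <= (n%:R * (n%:R - 1) / 2 * L + n%:R * eps)%:E)%E.
  move: s3; rewrite big1// integral0 mule0 !add0e; exact.
have [us sE] := lpairs_finite s2 (le_lt_trans s3 (ltry _)).
exists (map toC s); last by rewrite -lee_fin -sE.
split => //; first by rewrite size_map.
by move=> _ /mapP[p ps ->]; exists p => //; exact: s2.
Qed.

Let E n := inf [set pe s | s in conf n].

Let E_inf n : has_inf [set pe s | s in conf n].
Proof.
split; first by have [s sn _] := conf_le n ltr01; exists (pe s), s.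
exists 0 => _ [s [us _ sK] <-]; apply: (@pair_energy_ge0 _ _ K) => //.
by move=> z w /Kdisc z1 /Kdisc w1; exact: gker_ge0.
Qed.

Let E_le n s : conf n s -> E n <= pe s.
Proof. by move=> sn; apply: ge_inf; [case: (E_inf n)|exists s]. Qed.

Let E0 n : 0 <= E n.
Proof.
apply: lb_le_inf; first by case: (E_inf n).
move=> _ [s [us _ sK] <-]; apply: (@pair_energy_ge0 _ _ K) => //.
by move=> z w /Kdisc z1 /Kdisc w1; exact: gker_ge0.
Qed.

Let EL n : E n <= n%:R * (n%:R - 1) / 2 * L.
Proof.
apply/ler_addgt0Pr => e e0.
have n1 : 0 < n%:R + 1 :> R by rewrite ltr_wpDl.
have e1 : 0 < e / (n%:R + 1) by rewrite divr_gt0.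
have [s sn h] := conf_le n e1; apply: (le_trans (E_le sn)); apply: (le_trans h).
rewrite lerD2l mulrA ler_pdivrMr// mulrDr mulr1 mulrC; lra.
Qed.

Let conf_rem n s x : conf n.+1 s -> x \in s -> conf n (rem x s).
Proof.
move=> [us ss sK] xs; split; first exact: rem_uniq.
  by rewrite size_rem// ss.
by move=> z /mem_rem; exact: sK.
Qed.

Let potential_le n s x : conf n.+1 s -> x \in s ->
  potential gker s x <= pe s - E n.
Proof.
move=> sn xs; rewrite /pe (pair_energy_rem gker_sym xs).
by have := E_le (conf_rem sn xs); rewrite /pe; lra.
Qed.

(** In a configuration [s] of [n + 1] points the potentials add up to [2 * pe s], and each is at
    most [pe s - E n]; hence [2 * pe s <= (n + 1) * (pe s - E n)]. Then the infimum over [s] is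
    taken. *)
Let Emono n : n.+1%:R * E n <= (n%:R - 1) * E n.+1.
Proof.
have key s : conf n.+1 s -> n.+1%:R * E n <= (n%:R - 1) * pe s.
  move=> sn; have [us ss sK] := sn.
  have : 2 * pe s <= n.+1%:R * (pe s - E n).
    rewrite -(sum_potential gker_sym us) -ss -sum1_size natr_sum mulr_suml.
    by rewrite !big_seq; apply: ler_sum => x xs; rewrite mul1r; exact: potential_le.
  by rewrite -natr1; lra.
(* For [n <= 1] the factor [n - 1] is not positive and cannot be divided by, but [E 0 = E 1 = 0]. *)
have [n2|n2] := leqP n 1.
  have E10 : E n <= 0.
    apply: (le_trans (EL n)); case: n n2 {key} => [|[|]]// _; rewrite ?mul0r//.
    by rewrite subrr mulr0 !mul0r.
  have -> : E n = 0 by apply/eqP; rewrite eq_le E10 E0.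
  rewrite mulr0; case: n n2 {key E10} => [|[|]]// _; last by rewrite subrr mul0r.
  have : E 1 <= 0 by apply: (le_trans (EL 1)); rewrite subrr mulr0 !mul0r.
  by have := E0 1; lra.
have nn : 0 < n%:R - 1 :> R by rewrite subr_gt0 ltr1n.
rewrite -ler_pdivrMl//.
apply: lb_le_inf; first by case: (E_inf n.+1).
by move=> _ [s sn <-]; rewrite ler_pdivrMl//; exact: key.
Qed.

Lemma good_configuration (eps delta : R) : 0 < eps -> 0 < delta ->
  exists m0 : nat, forall N : nat, (m0 <= N)%N -> exists s : seq R[i],
    [/\ uniq s, (forall z, z \in s -> K z), (N < size s)%N,
        (size s)%:R <= (1 + delta) * N%:R + 1 &
        forall x, x \in s -> potential gker s x <= (size s)%:R * (L + eps) + 1].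
Proof.
move=> eps0 delta0.
have [k Hk] := small_increment EL Emono eps0 delta0.
exists k => N kN; have [n [n1 n2 n3]] := Hk N kN.
(* [A] is only measurable, so a minimizer may fail to exist; an additive error 1 in the potentials
   is harmless. *)
have [_ [s sn <-] hs] := inf_adherent ltr01 (E_inf n.+1).
have [us ss sK] := sn; exists s; rewrite ss; split => // x xs.
apply: (le_trans (potential_le sn xs)).
have Le : 0 <= L + eps by rewrite addr_ge0 ?(ltW eps0)// divr_ge0// exprn_ge0// ltW.
rewrite -natr1 mulrDl mul1r; rewrite -/(E n.+1) in hs; lra.
Qed.

End GoodConfiguration.

(** * Finite Blaschke products *)

Section Blaschke.
Context {R : realType}.
Implicit Types (z w : R[i]) (t : seq R[i]).

Definition blaschke_factor w z : R[i] := (z - w) / (1 - (w^*)%C * z).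

Definition blaschke t z : R[i] := \prod_(y <- t) blaschke_factor y z.

Lemma blaschke_factor_le1 w z : disc w -> disc z -> cnorm (blaschke_factor w z) <= 1.
Proof.
move=> w1 z1; rewrite cnormM cnormV ler_pdivrMr ?green_den_gt0// mul1r.
exact: cnorm_sub_le_green.
Qed.

Lemma blaschke_le1 t z : (forall y, y \in t -> disc y) -> disc z ->
  cnorm (blaschke t z) <= 1.
Proof.
move=> t1 z1; rewrite cnorm_prod big_seq; apply: prodr_ile1 => y yt.
by rewrite cnorm_ge0 blaschke_factor_le1//; exact: t1.
Qed.

Lemma blaschke_eq0 t y : y \in t -> blaschke t y = 0.
Proof.
by move=> yt; rewrite /blaschke (big_rem y yt)/= /blaschke_factor subrr !mul0r.
Qed.

(** Each factor has modulus [expR (- gker x y)]: the Green function is minus the logarithm of the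
    pseudohyperbolic distance. *)
Lemma blaschke_potential s x : uniq s -> x \in s -> (forall y, y \in s -> disc y) ->
  cnorm (blaschke (rem x s) x) = expR (- potential gker s x).
Proof.
move=> us xs sd; rewrite cnorm_prod /potential -sumrN expR_sum.
apply: eq_big_seq => y; rewrite (mem_rem_uniq _ us) inE => /andP[yx ys].
rewrite /gker cnormM cnormV -lnV ?posrE ?divr_gt0 ?green_den_gt0 ?cnorm_gt0 ?subr_eq0 1?eq_sym//;
  try exact: sd.
rewrite invf_div lnK// posrE divr_gt0 ?green_den_gt0 ?cnorm_gt0 ?subr_eq0 1?eq_sym//;
  exact: sd.
Qed.

Variable r : R.
Hypothesis r01 : 0 <= r < 1.

(** The denominator has modulus at least [1 - r] throughout the disc; the two terms of the
    derivative are at most [(1 - r)^-1] and [2 * (1 - r) ^- 2]. *)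
Lemma blaschke_factor_deriv w z : cnorm w <= r -> disc z ->
  exists2 u, has_cderiv (blaschke_factor w) z u & cnorm u <= 3 / (1 - r) ^+ 2.
Proof.
have [r0 r1] := andP r01; move=> wr z1.
have q0 : 0 < 1 - r by rewrite subr_gt0.
have wz : cnorm ((w^*)%C * z) <= r.
  rewrite cnormM cnorm_conj -[r]mulr1 ler_pM ?cnorm_ge0//; exact: ltW.
have den : 1 - r <= cnorm (1 - (w^*)%C * z).
  by have := cnorm_dist 1 ((w^*)%C * z); rewrite cnorm1; lra.
have den0 : 0 < cnorm (1 - (w^*)%C * z) by exact: lt_le_trans den.
have dz : 1 - (w^*)%C * z != 0 by rewrite -cnorm_gt0.
have d1 : has_cderiv (fun u => u - w) z (1 - 0).
  by apply: has_cderivB; [exact: has_cderiv_id|exact: has_cderiv_cst].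
have d2 : has_cderiv (fun u => 1 - (w^*)%C * u) z (0 - (w^*)%C * 1).
  apply: has_cderivB; first exact: has_cderiv_cst.
  by apply: has_cderivZ; exact: has_cderiv_id.
have d3 := has_cderiv_comp d2 (has_cderivV dz).
eexists; first exact: (has_cderivM d1 d3).
apply: (le_trans (cnormD _ _)).
rewrite subr0 mul1r sub0r mulr1 mulrNN /= cnormM cnormV cnormM cnorm_conj cnormV cnormX.
set D := cnorm _ in den den0 *.
have Dq : D^-1 <= (1 - r)^-1 by rewrite lef_pV2 ?posrE.
have D2q : D ^- 2 <= (1 - r) ^- 2.
  by rewrite lef_pV2 ?posrE ?exprn_gt0// ler_pXn2r ?nnegrE ?(ltW q0) ?(ltW den0).
have q1 : (1 - r)^-1 <= (1 - r) ^- 2.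
  rewrite lef_pV2 ?posrE ?exprn_gt0// expr2 -[leRHS]mulr1 ler_pM2l//; lra.
have zw : cnorm (z - w) <= 2.
  have := cnormD z (- w); rewrite cnormN; move: z1; rewrite /disc/=; lra.
have h : cnorm (z - w) * (D ^- 2 * cnorm w) <= 2 * ((1 - r) ^- 2 * 1).
  apply: ler_pM; rewrite ?cnorm_ge0 ?mulr_ge0 ?cnorm_ge0 ?invr_ge0 ?exprn_ge0 ?(ltW den0)//.
  apply: ler_pM; rewrite ?cnorm_ge0 ?invr_ge0 ?exprn_ge0 ?(ltW den0)//; lra.
lra.
Qed.

(** By the product rule there is one term for each factor, and the undifferentiated factors have
    modulus at most 1. *)
Lemma blaschke_deriv t z : (forall y, y \in t -> cnorm y <= r) -> disc z ->
  exists2 u, has_cderiv (blaschke t) z u & cnorm u <= (size t)%:R * (3 / (1 - r) ^+ 2).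
Proof.
have [r0 r1] := andP r01; move=> + z1; elim: t => [|a t IH] tr.
  exists 0; last by rewrite cnorm0 mul0r.
  rewrite (_ : blaschke [::] = fun=> 1); first exact: has_cderiv_cst.
  by apply/funext => x; rewrite /blaschke big_nil.
have ar : cnorm a <= r by apply: tr; rewrite inE eqxx.
have tr' y : y \in t -> cnorm y <= r by move=> yt; apply: tr; rewrite inE yt orbT.
have [u Hu u1] := IH tr'.
have [v Hv v1] := blaschke_factor_deriv ar z1.
exists (v * blaschke t z + blaschke_factor a z * u).
  rewrite (_ : blaschke (a :: t) = fun x => blaschke_factor a x * blaschke t x).
    exact: has_cderivM.
  by apply/funext => x; rewrite /blaschke big_cons.
apply: (le_trans (cnormD _ _)); rewrite (cnormM v) (cnormM (blaschke_factor a z)).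
rewrite /= -natr1 mulrDl mul1r [leRHS]addrC.
apply: lerD.
  rewrite -[leRHS]mulr1 ler_pM ?cnorm_ge0// blaschke_le1// => y yt.
  exact: (le_lt_trans (tr' _ yt)).
rewrite -[leRHS]mul1r ler_pM ?cnorm_ge0// blaschke_factor_le1//.
exact: (le_lt_trans ar).
Qed.

End Blaschke.

(** * Norm estimates, finite-rank operators and the operator bound *)

Section NormBound.
Context {R : realType}.
Local Notation mu := (@lebesgue_measure R).

(** [W] is the integral of the weight for the normalized area, finite by [weight_area_finite]; a
    uniform bound on the derivative factors out of the integral. *)
Lemma Hnorm2_le (omega : R -> R) : admissible_weight omega ->
  exists2 W : R, 0 <= W & forall (f : R[i] -> R[i]) (M : R), 0 <= M ->
    (forall z, disc z -> exists2 w, has_cderiv f z w & cnorm w <= M) ->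
    (Hnorm2 omega f <= (cnorm (f 0) ^+ 2 + M ^+ 2 * W)%:E)%E.
Proof.
move=> homega; pose D := [set p : R * R | (cnorm (toC p) < 1)%R].
pose I := (\int[(mu \x mu)%E]_(p in D) (omega (cnorm (toC p)))%:E)%E.
have [_ opos _] := homega.
have mD : measurable D by apply: popen_measurable; exact: popen_disc.
have o0 p : D p -> 0 <= omega (cnorm (toC p)).
  by move=> Dp; apply/ltW/opos; rewrite cnorm_ge0.
have mw := measurable_weight homega.
have I0 : (0 <= I)%E by apply: integral_ge0 => p Dp; rewrite lee_fin o0.
have Ifin : I = (fine I)%:E.
  by rewrite fineK// ge0_fin_numE//; exact: weight_area_finite homega.
have pi0 : 0 <= (pi : R)^-1 by rewrite invr_ge0 pi_ge0.
exists (pi^-1 * fine I); first by rewrite mulr_ge0// fine_ge0.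
move=> f M M0 H.
pose g z := xget 0 [set w | has_cderiv f z w /\ cnorm w <= M].
have gP z : disc z -> has_cderiv f z (g z) /\ cnorm (g z) <= M.
  move=> z1; have [w w1 w2] := H z z1.
  by apply: (@xgetPex _ 0 [set w | has_cderiv f z w /\ cnorm w <= M]); exists w.
have gd z (z1 : disc z) : has_cderiv f z (g z) := (gP z z1).1.
apply: le_trans (ereal_inf_lbound _) _; first by exists g => //; exact: gd.
rewrite EFinD leeD2l// mulrCA EFinM lee_wpmul2l ?lee_fin// EFinM -Ifin.
rewrite -ge0_integralZl//; last 2 first.
- exact/measurable_EFinP.
- by rewrite lee_fin exprn_ge0.
apply: ge0_le_integral => //.
- by move=> p Dp; rewrite lee_fin mulr_ge0 ?exprn_ge0 ?cnorm_ge0// o0.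
- by apply/measurable_EFinP/measurable_funM => //; exact: measurable_cnorm_sqr gd.
- by apply/measurable_EFinP/measurable_funM.
- move=> p Dp; rewrite -EFinM lee_fin ler_wpM2r ?o0// ler_pXn2r ?nnegrE ?cnorm_ge0//.
  exact: (gP _ Dp).2.
Qed.

End NormBound.

Section FiniteRank.
Context {R : realType}.

(** Expressed through the spanning family [gs], the values [Rop (F i)] form an [n x m] matrix with
    [m < n], so its left kernel is nonzero. The scalar [a] inside the sum prepares the normalization
    of the test function. *)
Lemma rank_lt_kernel (omega : R -> R) (n : nat) (Rop : (R[i] -> R[i]) -> R[i] -> R[i])
    (F : 'I_n -> R[i] -> R[i]) : rank_lt omega n Rop ->
  (forall (l : seq 'I_n) (c : 'I_n -> R[i]),
     Hspace omega (fun z => \sum_(i <- l) c i * F i z)) ->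
  exists2 c : 'I_n -> R[i], exists i, c i != 0 &
    forall (a : R[i]) z, disc z -> Rop (fun u => \sum_i (a * c i) * F i u) z = 0.
Proof.
move=> [lin [m [mn [gs [_ range]]]]] HF.
have FH i : Hspace omega (F i).
  rewrite (_ : F i = fun z => \sum_(j <- [:: i]) (fun=> 1) j * F j z); first exact: HF.
  by apply/funext => z; rewrite big_seq1 mul1r.
have linsum (l : seq 'I_n) (d : 'I_n -> R[i]) z : disc z ->
    Rop (fun u => \sum_(i <- l) d i * F i u) z = \sum_(i <- l) d i * Rop (F i) z.
  move=> z1; elim: l => [|i l IH].
    have H0 := HF [::] d.
    (* Linearity is given for combinations of two functions only, so the zero function is presented
       as such a combination with null coefficients. *)
    transitivity (Rop (fun u => 0 * \sum_(i <- [::]) d i * F i u +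
                                0 * \sum_(i <- [::]) d i * F i u) z).
      by congr (Rop _ z); apply/funext => u; rewrite !mul0r addr0 big_nil.
    by rewrite lin// !mul0r addr0 big_nil.
  have := lin _ _ (FH i) (HF l d) (d i) 1 z z1; rewrite mul1r IH big_cons => <-.
  by congr (Rop _ z); apply/funext => u; rewrite big_cons mul1r.
have [A HA] : exists A : 'M[R[i]]_(n, m), forall i z, disc z ->
    Rop (F i) z = \sum_(j < m) A i j * gs j z.
  have /choice[c Hc] : forall i, exists c : 'I_m -> R[i],
      forall z, disc z -> Rop (F i) z = \sum_(j < m) c j * gs j z.
    by move=> i; exact: range.
  exists (\matrix_(i, j) c i j) => i z z1; rewrite Hc//.
  by apply: eq_bigr => j _; rewrite mxE.
have kn0 : kermx A != 0.
  rewrite kermx_eq0 -row_leq_rank -ltnNge; exact: leq_ltn_trans (rank_leq_col A) mn.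
have [v /sub_kermxP vA vi0] := rowV0Pn kn0.
exists (fun i => v 0 i).
  apply: contrapT => /forallNP H; move/eqP: vi0; apply; apply/rowP => j.
  by rewrite [RHS]mxE; apply/eqP; have := H j; case: eqP.
move=> a z z1; rewrite linsum//.
under eq_bigr => i _ do rewrite HA// mulr_sumr.
rewrite exchange_big/= big1// => j _.
have := congr1 (fun M : 'rV_m => M 0 j) vA; rewrite !mxE => vj.
under eq_bigr => i _ do rewrite mulrA -(mulrA a).
by rewrite -mulr_suml -mulr_sumr vj mulr0 mul0r.
Qed.

End FiniteRank.

Section LowerBound.
Context {R : realType}.

(** The power 4 is the square of two losses of a factor [size s]: one from the derivative bound when
    the test function is normalized, one because a large coefficient is only known to reach the
    mean. *)
Lemma opnorm2_lower_bound (omega : R -> R) (phi : R[i] -> R[i]) (r rho : R) :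
  admissible_weight omega -> 0 <= r < 1 -> 0 <= rho < 1 ->
  exists2 k : R, 0 < k & forall (s : seq R[i]) (tau : R) Rop,
    uniq s -> (0 < size s)%N ->
    (forall w, w \in s -> cnorm w <= r /\ exists2 z, cnorm z <= rho & phi z = w) ->
    (forall w, w \in s -> potential gker s w <= tau) ->
    rank_lt omega (size s) Rop ->
    ((k * expR (- (2 * tau)) / (size s)%:R ^+ 4)%:E <=
       opnorm2 omega (fun f z => (Comp phi f z - Rop f z)%R))%E.
Proof.
move=> homega r01 rho01; have [r0 r1] := andP r01; have [rho0 rho1] := andP rho01.
have [W W0 HW] := Hnorm2_le homega.
have [c c0 Hc] := point_evaluation homega rho01.
pose C : R := 3 / (1 - r) ^+ 2.
have C0 : 0 <= C by rewrite divr_ge0// exprn_ge0// subr_ge0 ltW.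
(* Chosen so that [1 + C ^+ 2 * W <= K ^+ 2], which is what [Hnorm2 omega f <= 1] reduces to. *)
pose K : R := 1 + C * (1 + W).
have K0 : 0 < K by rewrite ltr_wpDr// mulr_ge0// addr_ge0.
exists (c / K ^+ 2); first by rewrite divr_gt0// exprn_gt0.
move=> s tau Rop us s0 sP stau rk.
pose n := size s.
have n1 : 1 <= n%:R :> R by rewrite ler1n.
have n0 : 0 < n%:R :> R by exact: lt_le_trans n1.
pose w (i : 'I_n) := nth 0 s i.
have ws i : w i \in s by rewrite mem_nth.
have sdisc y : y \in s -> disc y by move=> /sP[yr _]; exact: le_lt_trans yr r1.
have sr y : y \in s -> cnorm y <= r by move=> /sP[].
pose F (i : 'I_n) := blaschke (rem (w i) s).
have Fd i y : y \in rem (w i) s -> disc y by move/mem_rem; exact: sdisc.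
have Fle i z : disc z -> cnorm (F i z) <= 1 by move=> z1; apply: blaschke_le1 => //; exact: Fd.
have Fder i z : disc z -> exists2 u, has_cderiv (F i) z u & cnorm u <= n%:R * C.
  move=> z1; have [|u u1 u2] := @blaschke_deriv _ r r01 (rem (w i) s) z _ z1.
    by move=> y /mem_rem; exact: sr.
  exists u => //; apply: (le_trans u2); rewrite ler_wpM2r// ler_nat size_rem// leq_pred//.
have comb (l : seq 'I_n) (d : 'I_n -> R[i]) z : disc z ->
    exists2 u, has_cderiv (fun z => \sum_(i <- l) d i * F i z) z u &
      cnorm u <= (\sum_(i <- l) cnorm (d i)) * (n%:R * C).
  move=> z1; elim: l => [|i l [u u1 u2]].
    exists 0; last by rewrite big_nil mul0r cnorm0.
    rewrite (_ : (fun z => _) = fun=> 0); first exact: has_cderiv_cst.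
    by apply/funext => x; rewrite big_nil.
  have [v v1 v2] := Fder i z z1; exists (d i * v + u).
    rewrite (_ : (fun z => _) = fun z => d i * F i z + \sum_(j <- l) d j * F j z).
      by apply: has_cderivD => //; exact: has_cderivZ.
    by apply/funext => x; rewrite big_cons.
  rewrite big_cons mulrDl (le_trans (cnormD _ _))// lerD//.
  by rewrite cnormM ler_wpM2l ?cnorm_ge0.
have bound0 (l : seq 'I_n) (d : 'I_n -> R[i]) :
    cnorm (\sum_(i <- l) d i * F i 0) <= \sum_(i <- l) cnorm (d i).
  apply: (le_trans (cnorm_sum _ _)); apply: ler_sum => i _.
  rewrite cnormM -[leRHS]mulr1 ler_wpM2l ?cnorm_ge0// Fle// /disc/= cnorm0; exact: ltr01.
have S0 (l : seq 'I_n) (d : 'I_n -> R[i]) : 0 <= \sum_(i <- l) cnorm (d i).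
  by apply: sumr_ge0 => i _; exact: cnorm_ge0.
have HF (l : seq 'I_n) (d : 'I_n -> R[i]) : Hspace omega (fun z => \sum_(i <- l) d i * F i z).
  have M0 := mulr_ge0 (S0 l d) (mulr_ge0 (ltW n0) C0).
  exact: le_lt_trans (HW _ _ M0 (comb l d)) (ltry _).
have [d [i0 di0] Hd] := rank_lt_kernel rk HF.
pose S := \sum_i cnorm (d i).
have Spos : 0 < S.
  rewrite /S (bigD1 i0)//= ltr_pwDl ?cnorm_gt0//.
  by apply: sumr_ge0 => i _; exact: cnorm_ge0.
have nK0 : 0 < n%:R * K by rewrite mulr_gt0.
(* This makes the moduli of the coefficients [a * d i] add up to [(n * K)^-1]. *)
pose a : R[i] := ((S * (n%:R * K))^-1)%:C%C.
have na : cnorm a = (S * (n%:R * K))^-1.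
  by rewrite cnorm_real ger0_norm// invr_ge0 mulr_ge0// ltW.
pose f z := \sum_i (a * d i) * F i z.
have Sa : \sum_i cnorm (a * d i) = (n%:R * K)^-1.
  under eq_bigr do rewrite cnormM.
  by rewrite -mulr_sumr na -/S; field; rewrite !gt_eqF.
have f1 : (Hnorm2 omega f <= 1)%E.
  have M0 := mulr_ge0 (S0 (index_enum _) (fun i => a * d i)) (mulr_ge0 (ltW n0) C0).
  apply: (le_trans (HW _ _ M0 (comb _ _))).
  have := bound0 (index_enum _) (fun i => a * d i); rewrite Sa => h0.
  rewrite lee_fin; apply: (@le_trans _ _ ((n%:R * K) ^- 2 + (C / K) ^+ 2 * W)).
    apply: lerD.
      by rewrite -exprVn ler_pXn2r ?nnegrE ?cnorm_ge0 ?invr_ge0 ?(ltW nK0).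
    rewrite le_eqVlt; apply/orP; left; apply/eqP; congr (_ ^+ 2 * W).
    by field; rewrite !gt_eqF.
  have -> : (n%:R * K) ^- 2 + (C / K) ^+ 2 * W = (n%:R ^- 2 + C ^+ 2 * W) / K ^+ 2.
    by field; rewrite !gt_eqF.
  rewrite ler_pdivrMr ?exprn_gt0// mul1r.
  have : n%:R ^- 2 <= 1 :> R by rewrite invf_le1 ?exprn_gt0// exprn_ege1.
  have CW : 0 <= C * W by rewrite mulr_ge0.
  have : K ^+ 2 = 1 + 2 * (C + C * W) + C ^+ 2 + 2 * (C ^+ 2 * W) + (C * W) ^+ 2.
    by rewrite /K; ring.
  have := sqr_ge0 (C * W); have := sqr_ge0 C; have := mulr_ge0 (sqr_ge0 C) W0; lra.
have [j Hj] : exists j, (n%:R * (n%:R * K))^-1 <= cnorm (a * d j).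
  apply: contrapT => /forallNP H.
  have : \sum_(i < n) cnorm (a * d i) < \sum_(i < n) (n%:R * (n%:R * K))^-1.
    apply: ltr_sum => //; first by apply/hasP; exists i0; rewrite // mem_index_enum.
    by move=> i _; rewrite ltNge; apply/negP; exact: H.
  rewrite Sa sumr_const card_ord -[X in _ < X]mulr_natr.
  have -> : (n%:R * (n%:R * K))^-1 * n%:R = (n%:R * K)^-1 :> R.
    by field; rewrite !gt_eqF.
  by rewrite ltxx.
have [_ [z zrho zw]] := sP _ (ws j).
have z1 : disc z by exact: le_lt_trans zrho rho1.
(* [Rop f] vanishes, and at [w j] every [F i] with [i != j] has a zero, so a single term
   survives. *)
have fz : cnorm (f (phi z) - Rop f z) = cnorm (a * d j) * expR (- potential gker s (w j)).
  rewrite Hd// subr0 zw /f (bigD1 j)//= big1 ?addr0; last first.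
    move=> i ij; rewrite /F blaschke_eq0 ?mulr0//.
    rewrite (mem_rem_uniq _ us) inE ws andbT; apply: contraNneq ij => e.
    apply/eqP/val_inj => /=; apply/eqP.
    by rewrite -(nth_uniq 0 _ _ us)// -/(w i) -/(w j) e.
  by rewrite cnormM blaschke_potential//.
apply: (@le_trans _ _ (Hnorm2 omega (fun z => Comp phi f z - Rop f z))); last first.
  by apply: ereal_sup_ubound; exists f.
apply: le_trans (Hc (fun z => Comp phi f z - Rop f z) z zrho).
rewrite lee_fin /Comp /= fz.
have -> : c / K ^+ 2 * expR (- (2 * tau)) / n%:R ^+ 4 =
    c * ((n%:R * (n%:R * K))^-1 * expR (- tau)) ^+ 2.
  rewrite (_ : - (2 * tau) = - tau + - tau); last by ring.
  by rewrite expRD; field; rewrite !gt_eqF.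
have q0 : 0 <= (n%:R * (n%:R * K))^-1 by rewrite invr_ge0 ltW// mulr_gt0.
have lb : (n%:R * (n%:R * K))^-1 * expR (- tau) <=
    cnorm (a * d j) * expR (- potential gker s (w j)).
  by apply: ler_pM; rewrite ?expR_ge0// ler_expR lerN2; exact: stau.
by rewrite ler_wpM2l ?(ltW c0)// ler_pXn2r// nnegrE mulr_ge0 ?cnorm_ge0 ?expR_ge0.
Qed.

End LowerBound.

(** * Exhaustion by images of closed discs *)

Section Exhaustion.
Context {R : realType}.

Lemma compact_measurable (K : set (R * R)) : compact K -> measurable K.
Proof.
move=> cK; have clK : closed K by apply: compact_closed => //; exact: norm_hausdorff.
rewrite -(setCK K); apply: measurableC; apply: popen_measurable; apply: open_popen.
exact: closed_openC.
Qed.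

Lemma compact_closed_disc (rho : R) : compact [set p : R * R | (cnorm (toC p) <= rho)%R].
Proof.
apply: (@subclosed_compact _ _ (`[- rho, rho]%classic `*` `[- rho, rho]%classic)).
- rewrite -(setCK [set p | _]); apply: open_closedC; apply: popen_open.
  exact: popen_closed_discC.
- by apply: compact_setX; exact: segment_compact.
- move=> p /= h; have := ler_Re_cnorm (toC p); have := ler_Im_cnorm (toC p).
  rewrite /= !ler_norml !in_itv /= => /andP[? ?] /andP[? ?].
  by split; apply/andP; split; lra.
Qed.

Lemma compact_image_disc (phi : R[i] -> R[i]) (rho : R) : rho < 1 ->
  (forall z, disc z -> ccont phi z) ->
  compact [set p : R * R | exists2 z, cnorm z <= rho & phi z = toC p].
Proof.
move=> rho1 cphi.
pose psi (p : R * R) : R * R := (complex.Re (phi (toC p)), complex.Im (phi (toC p))).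
have toCK (z : R[i]) : toC (complex.Re z, complex.Im z) = z by case: z.
have -> : [set p : R * R | exists2 z, cnorm z <= rho & phi z = toC p] =
    psi @` [set p : R * R | (cnorm (toC p) <= rho)%R].
  apply/seteqP; split => [[x y] /= [z zr zp]|_ [p pr <-] /=].
    by exists (complex.Re z, complex.Im z); rewrite /psi /= toCK// zp.
  by exists (toC p) => //; rewrite /psi toCK.
apply: continuous_compact; last exact: compact_closed_disc.
apply: continuous_in_subspaceT => p; rewrite inE /= => pr.
apply/cvg_ballP => e e0.
have [d d0 Hd] := cphi (toC p) (le_lt_trans pr rho1) e e0.
exists (ball p.1 (d / 2), ball p.2 (d / 2)).
  by split; apply: nbhsx_ballx; rewrite divr_gt0.
move=> q [/= q1 q2].
have dq : cnorm (toC q - toC p) < d.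
  have := cnorm_toC_le p q; rewrite (distrC q.1) (distrC q.2); move: q1 q2; rewrite /ball/=; lra.
have := Hd _ dq; have := ler_Re_cnorm (phi (toC q) - phi (toC p)).
have := ler_Im_cnorm (phi (toC q) - phi (toC p)).
rewrite Re_add Im_add Re_opp Im_opp => h1 h2 h3.
by split; rewrite /ball/= distrC; lra.
Qed.

(** Point evaluations are uniformly bounded only on discs [|z| <= rho < 1], so the points must have
    preimages in such a disc. The parts of [K] covered by the images of the discs of radius
    [n / (n + 1)] increase to [K], and continuity from below of [mu] gives the mass. *)
Lemma exhaustion (mu : probability (R * R)%type R) (phi : R[i] -> R[i])
    (K : set (R * R)) (t : R) :
  (forall z, disc z -> ccont phi z) -> compact K ->
  (forall p, K p -> (phi @` disc) (toC p)) -> mu (~` K) = 0%E -> t < 1 ->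
  exists (rho : R) (A : set (R * R)), [/\ 0 <= rho < 1, measurable A, A `<=` K,
    (forall p, A p -> exists2 z, cnorm z <= rho & phi z = toC p) & (t%:E < mu A)%E].
Proof.
move=> cphi cK Kphi muK t1.
pose rho (n : nat) : R := n%:R / n.+1%:R.
have rho01 n : 0 <= rho n < 1.
  by rewrite divr_ge0//= ltr_pdivrMr// mul1r ltr_nat.
pose F n := K `&` [set p : R * R | exists2 z, cnorm z <= rho n & phi z = toC p].
have mK := compact_measurable cK.
have mF n : measurable (F n).
  apply: measurableI => //; apply: compact_measurable; apply: compact_image_disc => //.
  by case/andP: (rho01 n).
have UF : \bigcup_n F n = K.
  apply/seteqP; split => [p [n _ []//]|p Kp].
  have [z z1 zp] := Kphi p Kp; have z1' : cnorm z < 1 := z1.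
  (* Then [(1 - cnorm z) * (n + 1) > 1], that is [cnorm z < n / (n + 1)]. *)
  pose n := Num.truncn (1 - cnorm z)^-1.
  exists n => //; split => //=; exists z => //.
  have zz : 0 < 1 - cnorm z by rewrite subr_gt0.
  have zV : 0 <= (1 - cnorm z)^-1 by rewrite invr_ge0 ltW.
  have /andP[_ hn] := truncn_itv zV.
  rewrite /rho ler_pdivlMr//.
  have : 1 < (1 - cnorm z) * n.+1%:R by rewrite -ltr_pdivrMl// mulr1.
  by rewrite -natr1; lra.
have ndF : nondecreasing_seq F.
  move=> m n mn; rewrite subsetEset; apply: setIS => p /= [z zm zp]; exists z => //.
  apply: (le_trans zm); rewrite /rho ler_pdivrMr// mulrAC ler_pdivlMr//.
  by rewrite -!natrM ler_nat !mulnS leq_add// mulnC.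
have muK1 : mu K = 1%E.
  have := probability_setC mu mK; rewrite muK => h.
  have := probability_setC mu (measurableC mK); rewrite setCK muK sube0; exact.
apply: contrapT => H.
have : (mu K <= t%:E)%E.
  rewrite -UF; apply: (cvge_to_le (nondecreasing_cvg_mu _ _ ndF)) => //.
    by rewrite UF.
  apply: nearW => n /=; rewrite leNgt; apply/negP => h; apply: H.
  by exists (rho n), (F n); split => // p [].
by rewrite muK1 lee_fin leNgt t1.
Qed.

End Exhaustion.

(** * Asymptotic lower bound for the approximation numbers *)

Section Asymptotics.
Context {R : realType}.

(** Write [expR (a * N)] as the fifth power of [expR (a / 5 * N) >= a / 5 * N]; one factor [N] out
    of five absorbs the constant. *)
Lemma expR_ge_pow4 (a b : R) : 0 < a -> 0 < b ->
  exists N0 : nat, forall N : nat, (N0 <= N)%N -> b * N%:R ^+ 4 <= expR (a * N%:R).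
Proof.
move=> a0 b0; pose q := (a / 5) ^+ 5.
have q0 : 0 < q by rewrite exprn_gt0// divr_gt0.
exists (Num.truncn (b / q)).+1 => N hN.
have bq : b <= q * N%:R.
  rewrite -ler_pdivrMl// mulrC; have /andP[_ h] := truncn_itv (ltW (divr_gt0 b0 q0)).
  by apply: (le_trans (ltW h)); rewrite ler_nat.
apply: (@le_trans _ _ (q * N%:R * N%:R ^+ 4)); first by rewrite ler_wpM2r// exprn_ge0.
have -> : q * N%:R * N%:R ^+ 4 = (a / 5 * N%:R) ^+ 5 by rewrite /q; field.
have -> : expR (a * N%:R) = expR (a / 5 * N%:R) ^+ 5.
  by rewrite -expRM_natl; congr expR; field.
rewrite ler_pXn2r ?nnegrE ?expR_ge0 ?mulr_ge0 ?divr_ge0 ?(ltW a0)//.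
by have := expR_ge1Dx (a / 5 * N%:R); lra.
Qed.

Lemma rank_lt_leq (omega : R -> R) (m n : nat) (Rop : (R[i] -> R[i]) -> R[i] -> R[i]) :
  (m <= n)%N -> rank_lt omega m Rop -> rank_lt omega n Rop.
Proof.
by move=> mn [lin [k [km H]]]; split => //; exists k; split => //; exact: leq_trans mn.
Qed.

Lemma le_limn_einf (u : (\bar R)^nat) (x : \bar R) (N0 : nat) :
  (forall n, (N0 <= n)%N -> (x <= u n)%E) -> (x <= limn_einf u)%E.
Proof.
move=> H; rewrite limn_einf_lim; apply: lime_ge; first exact: is_cvg_einfs.
exists N0 => // n /= Nn; apply: le_ereal_inf_tmp => _ [k /= nk <-].
by apply: H; exact: leq_trans nk.
Qed.

Lemma approx_num_lower_bound (omega : R -> R) (phi : R[i] -> R[i]) (r : R)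
    (mu : probability (R * R)%type R) (K : set (R * R)) (lam : R) :
  admissible_weight omega -> 0 <= r < 1 ->
  (forall z, disc z -> ccont phi z) -> (forall z, disc z -> cnorm (phi z) <= r) ->
  compact K -> (forall p, K p -> (phi @` disc) (toC p)) -> mu (~` K) = 0%E ->
  (energy mu < lam%:E)%E ->
  exists N0 : nat, forall N : nat, (N0 <= N)%N ->
    ((expR (- (N%:R * lam)))%:E <= approx_num omega (Comp phi) N)%E.
Proof.
move=> homega r01 cphi phir cK Kphi muK Ilam; have [r0 r1] := andP r01.
have mK := compact_measurable cK.
have Kdisc p : K p -> disc (toC p).
  by move=> /Kphi[z z1 <-]; exact: (le_lt_trans (phir z z1)).
have I0 := energy_ge0 mK muK Kdisc.
have Ifin : energy mu = (fine (energy mu))%:E.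
  by rewrite fineK// ge0_fin_numE// (lt_le_trans Ilam)// leey.
set I := fine (energy mu) in Ifin.
move: Ilam I0; rewrite Ifin lte_fin lee_fin => Ilam I0.
have lam0 : 0 < lam by exact: le_lt_trans Ilam.
(* [t < 1] while [t ^+ 2 > x], so a mass [m > t] forces [J / m ^+ 2 <= I / m ^+ 2 < lam]. *)
pose x := I / lam; pose t := (1 + x) / 2.
have x1 : x < 1 by rewrite ltr_pdivrMr// mul1r.
have x0 : 0 <= x by rewrite divr_ge0// ltW.
have t1 : t < 1 by rewrite /t; lra.
have t0 : 0 < t by rewrite /t; lra.
have xt : x < t ^+ 2.
  have : t ^+ 2 - x = ((1 - x) / 2) ^+ 2 by rewrite /t; field.
  have : 0 < ((1 - x) / 2) ^+ 2 by rewrite exprn_gt0// divr_gt0// subr_gt0.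
  lra.
have [rho [A [rho01 mA AK Aphi tA]]] := exhaustion cphi cK Kphi muK t1.
have Adisc p : A p -> disc (toC p) by move=> /AK; exact: Kdisc.
have muAfin : mu A = (fine (mu A))%:E by rewrite fineK// fin_num_measure.
set m := fine (mu A) in muAfin.
have tm : t < m by rewrite -lte_fin -muAfin.
have m0 : 0 < m by exact: lt_trans tm.
have JI := energy_subset mK muK Kdisc mA AK; rewrite Ifin in JI.
have J0 : (0 <= \int[mu]_(p in A) \int[mu]_(q in A) green (toC p) (toC q))%E.
  by apply: integral_ge0 => p Ap; apply: integral_ge0 => q Aq; apply: green_ge0; exact: Adisc.
have JE : (\int[mu]_(p in A) \int[mu]_(q in A) green (toC p) (toC q))%E =
    (fine (\int[mu]_(p in A) \int[mu]_(q in A) green (toC p) (toC q))%E)%:E.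
  by rewrite fineK// ge0_fin_numE// (le_lt_trans JI)// ltry.
set J := fine _ in JE; rewrite JE !lee_fin in JI J0.
pose L := J / m ^+ 2.
have m20 : 0 < m ^+ 2 by rewrite exprn_gt0.
have L0 : 0 <= L by rewrite divr_ge0// ltW.
have Llam : L < lam.
  rewrite ltr_pdivrMr//; apply: (le_lt_trans JI).
  have -> : I = lam * x by rewrite /x; field; rewrite gt_eqF.
  rewrite ltr_pM2l//; apply: (lt_trans xt).
  by rewrite ltr_pXn2r ?nnegrE ?(ltW t0) ?(ltW m0).
pose e := (lam - L) / 4.
have e0 : 0 < e by rewrite divr_gt0// subr_gt0.
pose delta := e / (L + e + 1).
have Le0 : 0 < L + e + 1 by lra.
have delta0 : 0 < delta by rewrite divr_gt0.
have dLe : delta * (L + e) <= e.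
  by rewrite /delta mulrAC ler_pdivrMr// ler_wpM2l ?(ltW e0)//; lra.
have [N1 HN1] := good_configuration mA Adisc m0 muAfin JE e0 delta0.
have [k k0 Hk] := opnorm2_lower_bound phi homega r01 rho01.
(* Since [n <= (1 + delta) * N + 1] and [delta * (L + e) <= e], the exponent [2 * (n * (L + e) + 1)]
   is at most [2 * N * (L + 2 * e) + c], while [2 * N * lam = 2 * N * (L + 4 * e)]. The surplus
   [4 * e * N] pays for the constants and, as [n <= (2 + delta) * N], for [n ^+ 4]. *)
pose c := 2 * (L + e + 1).
pose b := (2 + delta) ^+ 4 * expR c / k.
have b0 : 0 < b by rewrite divr_gt0// mulr_gt0 ?expR_gt0// exprn_gt0// addr_gt0.
have [N2 HN2] := expR_ge_pow4 (mulr_gt0 (ltr0Sn R 3) e0) b0.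
exists (maxn 1 (maxn N1 N2)) => N; rewrite !geq_max => /and3P[N0 /HN1 + /HN2 {HN2}HN2].
move=> {HN1} [s [us sA Ns sN spot]]; pose n := size s.
have NR : 1 <= N%:R :> R by rewrite ler1n.
have n0 : 0 < n%:R :> R by rewrite ltr0n (leq_ltn_trans _ Ns).
have key : expR (- (2 * (N%:R * lam))) <= k * expR (- (2 * (n%:R * (L + e) + 1))) / n%:R ^+ 4.
  rewrite ler_pdivlMr ?exprn_gt0//.
  have n4 : n%:R ^+ 4 <= ((2 + delta) * N%:R) ^+ 4 :> R.
    have dN : 0 <= (2 + delta) * N%:R by rewrite mulr_ge0// addr_ge0// ltW.
    by rewrite ler_pXn2r ?nnegrE ?(ltW n0)//; apply: (le_trans sN); lra.
  have h1 : n%:R ^+ 4 <= k * expR (- c) * expR (4 * e * N%:R).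
    apply: (le_trans n4).
    have -> : ((2 + delta) * N%:R) ^+ 4 = k * expR (- c) * (b * N%:R ^+ 4).
      by rewrite /b expRN; field; rewrite !gt_eqF ?expR_gt0.
    by rewrite ler_wpM2l// mulr_ge0 ?expR_ge0// ltW.
  apply: (@le_trans _ _ (expR (- (2 * (N%:R * lam))) * (k * expR (- c) * expR (4 * e * N%:R)))).
    by rewrite ler_wpM2l ?expR_ge0.
  have -> : expR (- (2 * (N%:R * lam))) * (k * expR (- c) * expR (4 * e * N%:R)) =
      k * expR (- (2 * (N%:R * lam)) - c + 4 * e * N%:R) by rewrite !expRD; ring.
  rewrite ler_wpM2l ?(ltW k0)// ler_expR.
  have : n%:R * (L + e) <= ((1 + delta) * N%:R + 1) * (L + e).
    by rewrite ler_wpM2r//; lra.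
  have : (delta * (L + e)) * N%:R <= e * N%:R by rewrite ler_wpM2r.
  have -> : lam = L + 4 * e by rewrite /e; field.
  rewrite /c; lra.
have inf_ge : ((expR (- (2 * (N%:R * lam))))%:E <=
    ereal_inf [set opnorm2 omega (fun f z => (Comp phi f z - Rop f z)%R)
      | Rop in [set Rop | rank_lt omega N Rop]])%E.
  apply: le_ereal_inf_tmp => _ [Rop rk <-].
  apply: (@le_trans _ _ (k * expR (- (2 * (n%:R * (L + e) + 1))) / n%:R ^+ 4)%:E).
    by rewrite lee_fin.
  apply: Hk => //; first by rewrite (leq_ltn_trans _ Ns).
    move=> w /sA[p Ap <-]; split; last exact: Aphi.
    by have [z z1 <-] := Kphi p (AK _ Ap); exact: phir.
  by apply: rank_lt_leq rk; exact: ltnW.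
(* [approx_num] takes the square root of an infimum of squared operator norms. *)
have -> : expR (- (N%:R * lam)) = expR (- (2 * (N%:R * lam))) `^ 2^-1.
  by rewrite -expRM; congr expR; field.
rewrite -poweR_EFin; apply: gt0_ler_poweR (inf_ge).
- by rewrite invr_ge0.
- by rewrite in_itv/= lee_fin expR_ge0 leey.
- by rewrite in_itv/= leey andbT (le_trans _ inf_ge)// lee_fin expR_ge0.
Qed.

End Asymptotics.

Theorem theorem3p10 (R : realType) (omega : R -> R) (phi : R[i] -> R[i])
  (homega : admissible_weight omega)
  (hphiH : Hspace omega phi)
  (hphi_sup : exists2 r : R, r < 1 & forall z, disc z -> cnorm (phi z) <= r) :
  (expeR (- (Cap (phi @` disc))^-1) <=
   limn_einf (fun n : nat => approx_num omega (Comp phi) n `^ (n%:R^-1)))%E.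
Proof.
rewrite /Cap inveK.
have [r r1 phir] := hphi_sup.
have r01 : 0 <= r < 1.
  rewrite r1 andbT (le_trans (cnorm_ge0 (phi 0)))// phir// /disc/= cnorm0; exact: ltr01.
have cphi z : disc z -> ccont phi z.
  (* A finite infimum is over a nonempty set, which provides a derivative of [phi] on the disc. *)
  have [_ [g Hg _] _] := ereal_inf_lt hphiH.
  by move=> /Hg; exact: has_cderiv_cont.
set l := limn_einf _.
have l0 : (0 <= l)%E by apply: (@le_limn_einf _ _ _ 0) => n _; exact: poweR_ge0.
have V0 : (0 <= Vgreen (phi @` disc))%E.
  apply: le_ereal_inf_tmp => _ [mu [K [cK Kphi muK]] <-].
  apply: (energy_ge0 (compact_measurable cK) muK) => p /Kphi[z z1 <-].
  exact: (le_lt_trans (phir z z1)).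
(* Some admissible measure has energy below [lam]; taking [n]-th roots of its bound, for [n >= 1],
   gives a constant lower bound. *)
have key (lam : R) : (Vgreen (phi @` disc) < lam%:E)%E -> ((expR (- lam))%:E <= l)%E.
  move=> /ereal_inf_lt[_ [mu [K [cK Kphi muK]] <-] Ilam].
  have [N0 HN0] := approx_num_lower_bound homega r01 cphi phir cK Kphi muK Ilam.
  apply: (@le_limn_einf _ _ _ (maxn 1 N0)) => n; rewrite geq_max => /andP[n1 /HN0 h].
  have n0 : 0 < n%:R :> R by rewrite ltr0n.
  have -> : expR (- lam) = expR (- (n%:R * lam)) `^ n%:R^-1.
    by rewrite -expRM; congr expR; field; rewrite gt_eqF.
  rewrite -poweR_EFin; apply: gt0_ler_poweR h.
  - by rewrite invr_ge0.
  - by rewrite in_itv/= lee_fin expR_ge0 leey.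
  - by rewrite in_itv/= poweR_ge0 leey.
(* For infinite [V] the left-hand side is [0]; for finite [V], [lam] will tend to [V]. *)
case: (Vgreen _) V0 key => [V| |] V0 key; [|exact: l0|by []].
case: l l0 key => [l| |] l0 key; [|exact: leey|by []].
(* Positivity allows writing [l] as the exponential of its logarithm and comparing exponents. *)
have lpos : 0 < l.
  have := key (V + 1); rewrite lte_fin ltrDl ltr01 lee_fin => /(_ isT).
  exact: lt_le_trans (expR_gt0 _).
rewrite -[l]lnK ?posrE// lee_fin /= ler_expR lerNl; apply/ler_addgt0Pr => e e0.
have := key (V + e); rewrite lte_fin ltrDl e0 lee_fin => /(_ isT) h.
by rewrite lerNl -ler_expR lnK ?posrE.
Qed.
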